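(* Let $\mathcal{P}$ be a Poisson point process of unit intensity in $\mathbb{R}^2$ with law $\mathbb{P}$ on $\mathbb{M}$. There exists a deterministic isometry-equivariant $6$-coloring scheme of the Poisson–Voronoi map: a measurable map $F:\mathbb{M}\to\mathbb{M}^6$ such that $F(\mathcal{P})$ is $\mathbb{P}$-a.s. a proper $6$-coloring of $\mathcal{P}$, and $\gamma F(\mathcal{P})=F(\gamma\mathcal{P})$ for every isometry $\gamma$ of $\mathbb{R}^2$.
   Context: $\mathbb{M}$ is the space of locally finite subsets of $\mathbb{R}^d$ with the local topology and Borel $\sigma$-algebra. For a nonempty locally finite $S\subset\mathbb{R}^d$, the Voronoi cell of $x\in S$ is $C(x)=\{z\in\mathbb{R}^d: d(z,x)=d(z,S)\}$. The Delaunay graph of $S$ has vertex set $S$ and an edge $(x,y)$ iff $|C(x)\cap C(y)|>1$. A (proper) $k$-coloring of $S$ is a partition $S=\bigcup_{i=1}^k S_i$ (an element of $\mathbb{M}^k$) such that no two Delaunay-adjacent points lie in the same $S_i$. Isometries act on $\mathbb{M}$ and $\mathbb{M}^k$ in the natural way. *)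

(* Defs.v *)
From HB Require Import structures.
From mathcomp Require Import all_boot all_order all_algebra.
From mathcomp Require Import all_classical all_reals all_analysis.
Set Implicit Arguments. Unset Strict Implicit. Unset Printing Implicit Defensive.
Import Order.TTheory GRing.Theory Num.Theory.
Local Open Scope classical_set_scope.
Local Open Scope ring_scope.

Section PoissonVoronoi.
Variable R : realType.

Definition pt2 := (R * R)%type.

Definition edist (x y : pt2) : R :=
  Num.sqrt ((x.1 - y.1) ^+ 2 + (x.2 - y.2) ^+ 2).

Definition bounded_set (B : set pt2) : Prop :=
  exists r : R, forall x, B x -> `|x.1| <= r /\ `|x.2| <= r.

Definition card_eq (A : set pt2) (k : nat) : Prop :=
  exists s : seq pt2, [/\ uniq s, size s = k & A = [set x | x \in s]].

Definition locally_finite (S : set pt2) : Prop :=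
  forall B, bounded_set B -> finite_set (S `&` B).

Definition count_event (B : set pt2) (k : nat) : set (set pt2) :=
  [set S | card_eq (S `&` B) k].

Definition count_gen : set (set (set pt2)) :=
  [set E | exists B k, [/\ measurable B, bounded_set B & E = count_event B k]].

Definition Mspace := g_sigma_algebraType count_gen.

Definition leb2 := (@lebesgue_measure R \x @lebesgue_measure R)%E.

Definition poisson_mass (l : R) (k : nat) : R :=
  l ^+ k / (k`!)%:R * expR (- l).

Definition poisson_law (P : probability Mspace R) : Prop :=
  forall (n : nat) (B : 'I_n -> set pt2) (k : 'I_n -> nat),
    (forall i, measurable (B i) /\ bounded_set (B i)) ->
    (forall i j, i != j -> B i `&` B j = set0) ->
    P [set S : Mspace | forall i, card_eq (S `&` B i) (k i)] =
      (\prod_(i < n) poisson_mass (fine (leb2 (B i))) (k i))%:E.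

Definition voronoi_cell (S : set pt2) (x : pt2) : set pt2 :=
  [set z | edist z x = inf [set edist z y | y in S]].

Definition delaunay_adj (S : set pt2) (x y : pt2) : Prop :=
  [/\ S x, S y & exists z1 z2, [/\ z1 <> z2,
      (voronoi_cell S x `&` voronoi_cell S y) z1 &
      (voronoi_cell S x `&` voronoi_cell S y) z2]].

Definition proper_coloring (k : nat) (S : set pt2)
    (C : 'I_k -> set pt2) : Prop :=
  [/\ (forall x, S x <-> exists i, C i x),
      (forall i j, i != j -> C i `&` C j = set0) &
      (forall i x y, x <> y -> C i x -> C i y -> ~ delaunay_adj S x y)].

Definition is_isometry (g : pt2 -> pt2) : Prop :=
  forall x y, edist (g x) (g y) = edist x y.

End PoissonVoronoi.

(* Main.v *)
(* Put core 0 = S and let core (k+1) be the points of core k with at least six neighbours in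
   core k. Almost surely every point leaves the cores at some finite stage. Each point has at
   most five neighbours among the points that leave at the same stage or later, so a greedy
   coloring in order of decreasing stage needs six colors. Ties are broken by a preliminary
   greedy 6-labelling of the points of equal stage, which in turn is guided by labels that
   tell adjacent points apart because the distances between points of S are generic. Along a
   dependency chain of the greedy coloring the stage increases within six steps, so the
   recursion is well founded as soon as no point near the origin lies in a deep core.

   For the latter, a plane straight-line graph has at most 3|V| edges, and a definite
   proportion fewer if near each vertex some vertical line has a point that no triangle of the
   graph covers. With high probability every vertical line near the origin passes, at bounded
   height, through a unit box whose point of S has too few neighbours to lie in core 1 and
   whose bottom side meets no triangle of core 1. Let W_k be the part of core (n-k) within
   distance k L of a point y of core n. Each vertex of W_k has six neighbours in W_(k+1), so
   |W_(k+1)| >= (1 + 1/3N) |W_k|, which contradicts the quadratic volume growth of the plane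
   for n large. *)
Require Import Defs.
From HB Require Import structures.
From mathcomp Require Import all_boot all_order all_algebra.
From mathcomp Require Import all_classical all_reals all_analysis.
From mathcomp Require Import finmap ring lra zify measurable_realfun lebesgue_measure.
Set Implicit Arguments. Unset Strict Implicit. Unset Printing Implicit Defensive.
Import Order.TTheory GRing.Theory Num.Theory.
Import numFieldNormedType.Exports.
(* edist, card_eq and bounded_set also exist in MathComp-Analysis *)
Import Defs.
Local Open Scope ring_scope.

(** * Finite plane straight-line graphs *)

(** The edge bound comes from a charging argument, not from Euler's formula, because it also has to
    localise the savings. Every vertex pays for its highest edge to the right, its highest edge to
    the left and the edge straight below it, and every edge is paid for. A saving is an edge paid
    twice or a vertex without an edge on one side. Unless a saving is near, an edge carries a
    triangle on its upper side, so one can climb along a vertical line from triangle to triangle; a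
    point of the line that no triangle covers stops the climb at a saving. Coordinates enter only
    this estimate, never the coloring, which must commute with isometries.

    The coloring may use no choice: it is a relation on the points of S obtained by countable
    inductions and countable quantifiers, which gives equivariance and measurability together.

    The scales fit because a blocking configuration up to scale 2^K involves a number of boxes
    linear in K: all lengths and counts are 2^O(K), against failure probabilities exponentially
    small in 2^K. *)

Section PlaneGraph.
Variables (R : realFieldType) (T : finType).
Implicit Types (X Y : T -> R) (adj : rel T).

(** Planarity as weak separation of two edges by a line, strict at every end that they do not share.
    For Delaunay edges the radical axis of two empty discs is such a line. *)
Definition planar X Y adj := forall p r a b, adj p r -> adj a b ->
  (p, r) <> (a, b) -> (p, r) <> (b, a) -> exists A B C : R,
  let f v := A * X v + B * Y v + C in
  [/\ f p <= 0 /\ f r <= 0, 0 <= f a /\ 0 <= f b,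
      (p != a -> p != b -> f p < 0) /\ (r != a -> r != b -> f r < 0) &
      (a != p -> a != r -> 0 < f a) /\ (b != p -> b != r -> 0 < f b)].

Definition height X Y p r (x : R) := Y p + (x - X p) * ((Y r - Y p) / (X r - X p)).
Definition edge X adj p r := adj p r && (X p < X r).
End PlaneGraph.

Section Order.
Variables (R : realFieldType) (T : finType) (X Y : T -> R) (adj : rel T).
Hypothesis Xinj : injective X.
Hypothesis adjC : symmetric adj.
Hypothesis adjP : planar X Y adj.
Local Notation h := (height X Y).
Local Notation edge := (edge X adj).

Lemma edge_lt p r : edge p r -> X p < X r. Proof. by case/andP. Qed.
Lemma edge_adj p r : edge p r -> adj p r. Proof. by case/andP. Qed.
Hint Resolve edge_lt : core.

Lemma height_l p r : h p r (X p) = Y p.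
Proof. by rewrite /height subrr mul0r addr0. Qed.
Lemma height_r p r : X p < X r -> h p r (X r) = Y r.
Proof. by move=> H; rewrite /height; field; lra. Qed.

(* the value on the segment of an affine form is a convex combination of the values at its ends *)
Lemma height_conv p r x : X p < X r -> X p <= x <= X r -> exists t,
  [/\ 0 <= t <= 1, x = (1 - t) * X p + t * X r & h p r x = (1 - t) * Y p + t * Y r].
Proof.
move=> Hpr /andP[H1 H2]; exists ((x - X p) / (X r - X p)).
have d0 : 0 < X r - X p by lra.
split; last by rewrite /height; field; lra.
- by rewrite divr_ge0 ?ler_pdivrMr ?mul1r //; lra.
- by field; lra.
Qed.

Lemma edge_sep p r a b : edge p r -> edge a b -> (p, r) <> (a, b) ->
  exists A B C : R, let f v := A * X v + B * Y v + C in
  [/\ f p <= 0 /\ f r <= 0, 0 <= f a /\ 0 <= f b,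
      (p != a -> p != b -> f p < 0) /\ (r != a -> r != b -> f r < 0) &
      (a != p -> a != r -> 0 < f a) /\ (b != p -> b != r -> 0 < f b)].
Proof.
move=> e e' n; apply: adjP => //; try exact: edge_adj.
by case=> E1 E2; move: (edge_lt e) (edge_lt e'); rewrite E1 E2; lra.
Qed.

Lemma height_zero p r (A B C : R) x : edge p r -> X p <= x <= X r ->
  (A * X p + B * Y p + C <= 0) -> (A * X r + B * Y r + C <= 0) ->
  A * x + B * h p r x + C = 0 ->
  (x = X p /\ A * X p + B * Y p + C = 0) \/ (x = X r /\ A * X r + B * Y r + C = 0)
  \/ (A * X p + B * Y p + C = 0 /\ A * X r + B * Y r + C = 0).
Proof.
move=> e Hx fp fr.
have [t [/andP[t0 t1] -> ->]] := height_conv (edge_lt e) Hx.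
set u := _ + C in fp *; set v := A * X r + _ + C in fr *.
move=> E0; have {}E0 : (1 - t) * u + t * v = 0 by rewrite -E0 /u /v; ring.
have [t0'|tn0] := eqVneq t 0.
  by left; split; [rewrite t0'; ring|move: E0; rewrite t0'; lra].
have [t1'|tn1] := eqVneq t 1.
  by right; left; split; [rewrite t1'; ring|move: E0; rewrite t1'; lra].
have t0' : 0 < t by rewrite lt_neqAle eq_sym tn0.
have t1' : t < 1 by rewrite lt_neqAle tn1.
right; right.
have H1 : (1 - t) * u <= 0 by nra.
have H2 : t * v <= 0 by nra.
have U : (1 - t) * u = 0 by lra.
have V : t * v = 0 by lra.
move/eqP: U; rewrite mulf_eq0 => /orP[/eqP|/eqP->]; first by lra.
move/eqP: V; rewrite mulf_eq0 (negbTE tn0) /= => /eqP->; done.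
Qed.

Definition shared p r a b x :=
  (x = X p /\ (p = a \/ p = b)) \/ (x = X r /\ (r = a \/ r = b)).

(** Strictness in [planar] turns a vanishing end of p r into an end of a b. If both ends vanished,
    the two oriented edges would coincide. *)
Lemma zero_shared p r a b (A B C : R) x : edge p r -> edge a b -> (p, r) <> (a, b) ->
  let f v := A * X v + B * Y v + C in
  [/\ f p <= 0 /\ f r <= 0, 0 <= f a /\ 0 <= f b,
      (p != a -> p != b -> f p < 0) /\ (r != a -> r != b -> f r < 0) &
      (a != p -> a != r -> 0 < f a) /\ (b != p -> b != r -> 0 < f b)] ->
  X p <= x <= X r -> A * x + B * h p r x + C = 0 -> shared p r a b x.
Proof.
move=> e e' n f [[fp fr] [fa fb] [sp sr] [sa sb]] Hx H.
have sh v : v \in [:: p; r] -> f v = 0 -> v = a \/ v = b.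
  move=> vpr v0; case: (eqVneq v a) => [->|na]; first by left.
  case: (eqVneq v b) => [->|nb]; first by right.
  by move: vpr; rewrite !inE => /orP[] /eqP E; subst v; [have := sp na nb|have := sr na nb]; rewrite v0 ltxx.
case: (height_zero e Hx fp fr H) => [[-> /sh S]|[[-> /sh S]|[/sh S1 /sh S2]]].
- by left; split=> //; apply: S; rewrite !inE eqxx.
- by right; split=> //; apply: S; rewrite !inE eqxx ?orbT.
exfalso.
have lt1 := edge_lt e; have lt2 := edge_lt e'.
case: (S1) => [|E1|E1]; rewrite ?inE ?eqxx ?orbT //;
case: (S2) => [|E2|E2]; rewrite ?inE ?eqxx ?orbT //; subst; rewrite ?ltxx in lt1 lt2 * => //.
by move: (lt_trans lt1 lt2); rewrite ltxx.
Qed.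

Lemma height_eq p r a b x : edge p r -> edge a b -> (p, r) <> (a, b) ->
  X p <= x <= X r -> X a <= x <= X b -> h p r x = h a b x -> shared p r a b x.
Proof.
move=> e e' n Hx Hx' E.
have [A [B [C H]]] := edge_sep e e' n.
apply: (zero_shared e e' n H Hx).
case: H => -[fp fr] [fa fb] _ _.
have L : A * x + B * h p r x + C <= 0.
  by have [t [/andP[t0 t1] -> ->]] := height_conv (edge_lt e) Hx; nra.
have U : 0 <= A * x + B * h a b x + C.
  by have [t [/andP[t0 t1] -> ->]] := height_conv (edge_lt e') Hx'; nra.
by rewrite -E in U; lra.
Qed.

(** If the order were reversed, comparing the signs of the separating form at x and at x' would
    force B = 0, so the form vanishes at abscissa x. Both edges then have an end there, and
    injectivity of X makes it the same vertex. *)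
Lemma nocross p r a b x x' : edge p r -> edge a b ->
  X p <= x <= X r -> X a <= x <= X b -> X p <= x' <= X r -> X a <= x' <= X b ->
  h p r x < h a b x -> h p r x' <= h a b x'.
Proof.
move=> e e' H1 H2 H3 H4 lt1; rewrite leNgt; apply/negP => lt2.
have n : (p, r) <> (a, b) by case=> E1 E2; move: lt1; rewrite E1 E2 ltxx.
have [A [B [C H]]] := edge_sep e e' n.
have nn : (a, b) <> (p, r) by move=> E; apply: n.
have Lo y : X p <= y <= X r -> A * y + B * h p r y + C <= 0.
  by case: H => -[fp fr] _ _ _ Hy; have [t [/andP[t0 t1] -> ->]] := height_conv (edge_lt e) Hy; nra.
have Up y : X a <= y <= X b -> 0 <= A * y + B * h a b y + C.
  by case: H => _ [fa fb] _ _ Hy; have [t [/andP[t0 t1] -> ->]] := height_conv (edge_lt e') Hy; nra.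
have B0 : B = 0 by have := Lo _ H1; have := Up _ H2; have := Lo _ H3; have := Up _ H4; nra.
have Z : A * x + B * h p r x + C = 0.
  by have := Lo _ H1; have := Up _ H2; rewrite B0 !mul0r; lra.
have Z' : - A * x + - B * h a b x + - C = 0 by move: Z; rewrite B0; lra.
have S := zero_shared e e' n H H1 Z.
have S' : shared a b p r x.
  apply: (zero_shared e' e nn _ H2 Z').
  have EN v : - A * X v + - B * Y v + - C = - (A * X v + B * Y v + C) by ring.
  case: H => -[fp fr] [fa fb] [sp sr] [sa sb].
  by split; split; rewrite !EN ?oppr_le0 ?oppr_ge0 ?oppr_lt0 ?oppr_gt0.
have YY v w : X v = x -> X w = x -> v = w by move=> Hv Hw; apply: Xinj; rewrite Hv Hw.
have L1 : exists2 v, X v = x & h p r x = Y v.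
  case: S => -[-> _]; [exists p|exists r] => //; [exact: height_l|exact: height_r (edge_lt e)].
have L2 : exists2 v, X v = x & h a b x = Y v.
  case: S' => -[-> _]; [exists a|exists b] => //; [exact: height_l|exact: height_r (edge_lt e')].
case: L1 L2 => v Hv Ev [w Hw Ew].
by move: lt1; rewrite Ev Ew (YY v w Hv Hw) ltxx.
Qed.
End Order.

(** * Charging the edges to the vertices *)

Section ChargeDefs.
Variables (R : realFieldType) (T : finType) (X Y : T -> R) (adj : rel T).
Local Notation h := (height X Y).
Local Notation edge := (edge X adj).

Definition slope p r := (Y r - Y p) / (X r - X p).

(** The three payments of a vertex: p pays for its highest edge to the right, r for its highest edge
    to the left (the one of least slope), and q for the first edge straight below it. *)
Definition topright p r := edge p r && [forall s, edge p s ==> (slope p s <= slope p r)].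
Definition topleft p r := edge p r && [forall t, edge t r ==> (slope p r <= slope t r)].
Definition under q p r := [&& edge p r, X p < X q < X r, h p r (X q) < Y q &
  [forall a, forall b, [&& edge a b, X a < X q < X b & h a b (X q) < Y q] ==>
     (h a b (X q) <= h p r (X q))]].

Definition noright q := [forall s, ~~ edge q s].
Definition noleft q := [forall t, ~~ edge t q].
Definition overcharged p r :=
  (2 <= topright p r + topleft p r + #|[set q | under q p r]|)%N.

(** The successor of p r in counterclockwise order among the right edges at p; [nextleft] is the
    successor in clockwise order among the left edges at r. *)
Definition nextright p r s := [/\ edge p s, slope p r < slope p s &
  forall s', edge p s' -> slope p r < slope p s' -> slope p s <= slope p s'].
Definition nextleft p r t := [/\ edge t r, slope t r < slope p r &
  forall t', edge t' r -> slope t' r < slope p r -> slope t' r <= slope t r].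

Definition wedge_r p r s q := [/\ X p < X q < X r, h p r (X q) < Y q, X q <= X s &
  Y q <= h p s (X q)].
Definition wedge_l p r t q := [/\ X p < X q < X r, h p r (X q) < Y q, X t <= X q &
  Y q <= h t r (X q)].

Definition tri p q r (x y : R) := exists a b c : R, [/\ 0 <= a /\ 0 <= b, 0 <= c, a + b + c = 1,
  x = a * X p + b * X q + c * X r & y = a * Y p + b * Y q + c * Y r].
End ChargeDefs.

Section Charge.
Variables (R : realFieldType) (T : finType) (X Y : T -> R) (adj : rel T).
Hypothesis Xinj : injective X.
Hypothesis adjC : symmetric adj.
Hypothesis adjP : planar X Y adj.
Local Notation h := (height X Y).
Local Notation edge := (edge X adj).
Local Notation slope := (slope X Y).
Local Notation topright := (topright X Y adj).
Local Notation topleft := (topleft X Y adj).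
Local Notation under := (under X Y adj).
Local Notation nextright := (nextright X Y adj).
Local Notation nextleft := (nextleft X Y adj).
Local Notation noleft := (noleft X adj).
Local Notation wedge_r := (wedge_r X Y).

Lemma height_slope_l p r x : h p r x = Y p + (x - X p) * slope p r.
Proof. by []. Qed.
Lemma height_slope_r p r x : X p < X r -> h p r x = Y r - (X r - x) * slope p r.
Proof. by move=> H; rewrite /height /slope; field; lra. Qed.

Lemma slope_height p r s x : X p < x -> (slope p r < slope p s) = (h p r x < h p s x).
Proof. by move=> H; rewrite !height_slope_l ltrD2l ltr_pM2l // subr_gt0. Qed.

Lemma slope_height_r p t r x : x < X r -> X p < X r -> X t < X r ->
  (slope t r < slope p r) = (h p r x < h t r x).
Proof.
by move=> H H1 H2; rewrite !height_slope_r // ltrD2l ltrN2 ltr_pM2l // subr_gt0.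
Qed.

Lemma nexist_right p r : edge p r -> ~~ topright p r -> exists s, nextright p r s.
Proof.
move=> e; rewrite /topright e /= negb_forall => /existsP[s0].
rewrite negb_imply -ltNge => /andP[e0 l0].
pose Q s := edge p s && (slope p r < slope p s).
have Q0 : Q s0 by rewrite /Q e0.
case: (Order.TotalTheory.arg_minP (fun s => slope p s) Q0) => s /andP[es ls] ms.
by exists s; split=> // s' es' ls'; apply: ms; rewrite /Q es'.
Qed.

Lemma topright_uniq p r r' : topright p r -> topright p r' -> r = r'.
Proof.
move=> /andP[e /forallP m] /andP[e' /forallP m'].
have Es : slope p r = slope p r'.
  by apply/eqP; rewrite eq_le; rewrite (implyP (m' r) e) (implyP (m r') e').
case: (eqVneq r r') => // n; exfalso.
have lt1 := edge_lt e; have lt2 := edge_lt e'.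
have nE : (p, r) <> (p, r') by case=> E; rewrite E eqxx in n.
set x := Num.min (X r) (X r').
have Hx : X p <= x <= X r by rewrite /x le_min ge_min lexx (ltW lt1) (ltW lt2).
have Hx' : X p <= x <= X r' by rewrite /x le_min ge_min lexx (ltW lt1) (ltW lt2) orbT.
have E : h p r x = h p r' x by rewrite !height_slope_l Es.
have xp : X p < x by rewrite /x lt_min lt1.
case: (height_eq adjP e e' nE Hx Hx' E) => -[Ex D].
  by rewrite Ex ltxx in xp.
by case: D => D; [rewrite D ltxx in lt1 | rewrite D eqxx in n].
Qed.

Lemma under_uniq q p r p' r' : under q p r -> under q p' r' -> (p, r) = (p', r').
Proof.
move=> /and4P[e s l /forallP m] /and4P[e' s' l' /forallP m'].
apply/eqP/negPn/negP => /eqP n.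
have E : h p r (X q) = h p' r' (X q).
  apply/eqP; rewrite eq_le (implyP (forallP (m' p) r)) ?e ?s //=.
  by rewrite (implyP (forallP (m p') r')) ?e' ?s'.
case/andP: (s) => s1 s2; case/andP: (s') => s3 s4.
case: (height_eq adjP e e' n _ _ E) => [| |[Ex _]|[Ex _]]; rewrite ?ltW //.
  by rewrite Ex ltxx in s1.
by rewrite Ex ltxx in s2.
Qed.

(* the face above [p r] at [p] is bounded by [p s]; its leftmost vertex rests on [p r] *)
Lemma wedge_leftmost p r s : edge p r -> nextright p r s -> (exists q, wedge_r p r s q) ->
  exists q, [/\ wedge_r p r s q, under q p r & q <> s -> noleft q].
Proof.
move=> e [es ls ms] [q0 W0].
pose Q q := [&& X p < X q < X r, h p r (X q) < Y q, X q <= X s & Y q <= h p s (X q)].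
have QE q : reflect (wedge_r p r s q) (Q q) by apply: and4P.
have Q0 : Q q0 by apply/QE.
case: (Order.TotalTheory.arg_minP X Q0) => q /QE Wq mq.
case: (Wq) => /andP[q1 q2] q3 q4 q5.
(* No edge passes strictly between p r and p s over q: followed to the left it would run through p,
   start at a vertex of the wedge left of q, or start at p with a slope between the two. *)
have K a b : edge a b -> X a < X q -> X q <= X b -> h p r (X q) < h a b (X q) ->
    h a b (X q) < h p s (X q) -> False.
  move=> eab aq qb l1 l2.
  case: (ltgtP (X a) (X p)) => [ap|pa|/Xinj ap].
  - have Hp : h a b (X p) = Y p.
      apply/eqP; rewrite eq_le; apply/andP; split.
        rewrite -[leRHS](height_l X Y p s).
        by apply: (nocross Xinj adjP eab es _ _ _ _ l2); rewrite ?lexx; lra.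
      rewrite -[leLHS](height_l X Y p r).
      by apply: (nocross Xinj adjP e eab _ _ _ _ l1); rewrite ?lexx; lra.
    have n : (p, r) <> (a, b) by case=> E1 E2; rewrite E1 ltxx in ap.
    have Sh : shared X p r a b (X p).
      by apply: (height_eq adjP e eab n); rewrite ?Hp ?height_l //; lra.
    by case: Sh => [[_ [E|E]]|[E _]]; [rewrite E ltxx in ap | subst b; lra | lra].
  - have na : (p, r) <> (a, b) by case=> E1 E2; rewrite E1 ltxx in pa.
    have Wa : Q a.
      apply/and4P; split; [lra| |lra|].
        rewrite lt_neqAle; apply/andP; split; last first.
          rewrite -[leRHS](height_l X Y a b).
          by apply: (nocross Xinj adjP e eab _ _ _ _ l1); lra.
        apply/eqP => E.
        have Sh : shared X p r a b (X a).
          by apply: (height_eq adjP e eab na); rewrite ?height_l //; lra.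
        by case: Sh => -[E' _]; lra.
      rewrite -[leLHS](height_l X Y a b).
      by apply: (nocross Xinj adjP eab es _ _ _ _ l2); lra.
    by have := mq _ Wa; lra.
  - subst a.
    have l3 : slope p r < slope p b by rewrite (slope_height _ _ q1).
    have := ms _ eab l3.
    by rewrite leNgt (slope_height _ _ q1) l2.
exists q; split=> //.
  apply/and4P; split=> //; first by rewrite q1.
  apply/forallP => a; apply/forallP => b; apply/implyP => /and3P[eab /andP[aq qb] l].
  by rewrite leNgt; apply/negP => l'; apply: (K a b) => //; lra.
move=> nqs; apply/forallP => a; apply/negP => eaq.
have aq := edge_lt eaq.
apply: (K a q) => //; rewrite height_r // lt_neqAle q5 andbT.
apply/eqP => E.
have n : (a, q) <> (p, s) by case=> _ /nqs.
have Sh : shared X a q p s (X q).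
  by apply: (height_eq adjP eaq es n); rewrite ?height_r //; lra.
by case: Sh => [[E' _]|[_ [E'|//]]]; [lra|subst q; lra].
Qed.

(** If s is left of r, it lies in the wedge itself. Otherwise t r stays below p s; were t left of p,
    then t r would pass strictly above p and yet not above p s there, so t is right of p and lies in
    the wedge. *)
Lemma wedge_nonempty p r s t : edge p r -> nextright p r s -> nextleft p r t ->
  exists q, wedge_r p r s q.
Proof.
move=> e [es ls _] [et lt' _].
have lpr := edge_lt e; have lps := edge_lt es; have ltr := edge_lt et.
case: (ltgtP (X s) (X r)) => [sr|rs|/Xinj sr]; last by subst s; rewrite ltxx in ls.
  exists s; split; rewrite ?lexx //; first lra.
    by rewrite -[ltRHS](height_r Y lps) -slope_height.
  by rewrite height_r.
have tr x : x < X r -> h p r x < h t r x by move=> H; rewrite -slope_height_r.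
have le1 x : X p <= x <= X r -> X t <= x -> h t r x <= h p s x.
  move=> Hx Hx'; apply: (nocross Xinj adjP et es (x := X r)); try lra.
  by rewrite height_r // -{1}(height_r Y lpr) -slope_height.
case: (ltgtP (X t) (X p)) => [tp|pt|/Xinj tp]; last by subst t; rewrite ltxx in lt'.
  have := tr _ lpr; rewrite height_l.
  by have := le1 (X p); rewrite height_l lexx (ltW tp) (ltW lpr) => /(_ isT isT); lra.
exists t; split; [lra| |lra|].
  by rewrite -[ltRHS](height_l X Y t r); exact: tr.
by rewrite -[leLHS](height_l X Y t r); apply: le1; lra.
Qed.
End Charge.

(** * Reflection in a vertical line *)

Section Mirror.
Variables (R : realFieldType) (T : finType) (X Y : T -> R) (adj : rel T).
Hypothesis adjC : symmetric adj.
Let X' v := - X v.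

Lemma edge_mirror p r : edge X' adj r p = edge X adj p r.
Proof. by rewrite /edge /X' ltrN2 adjC. Qed.

Lemma planar_mirror : planar X Y adj -> planar X' Y adj.
Proof.
move=> H p r a b e e' n n'; have [A [B [C S]]] := H p r a b e e' n n'.
exists (- A), B, C => f.
have E v : f v = A * X v + B * Y v + C by rewrite /f /X'; ring.
by rewrite !E.
Qed.

Lemma height_mirror p r x : X p < X r -> height X' Y r p (- x) = height X Y p r x.
Proof. by move=> H; rewrite /height /X'; field; lra. Qed.

Lemma slope_mirror p r : X p < X r -> slope X' Y r p = - slope X Y p r.
Proof. by move=> H; rewrite /slope /X'; field; lra. Qed.

Lemma topright_mirror p r : topright X' Y adj r p = topleft X Y adj p r.
Proof.
rewrite /topright /topleft edge_mirror; case e: (edge X adj p r) => //=.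
apply: eq_forallb => t; rewrite edge_mirror; case e': (edge X adj t r) => //=.
by rewrite !slope_mirror ?lerN2 //; [exact: edge_lt e|exact: edge_lt e'].
Qed.

Lemma under_mirror q p r : under X' Y adj q r p = under X Y adj q p r.
Proof.
rewrite /under edge_mirror; case e: (edge X adj p r) => //=.
rewrite /X' !ltrN2 -/X' (andbC (X q < X r)); congr (_ && _).
rewrite (height_mirror _ (edge_lt e)); congr (_ && _).
rewrite (eq_forallb (P2 := fun a => [forall b, [&& edge X adj b a, X b < X q < X a & height X Y b a (X q) < Y q] ==> (height X Y b a (X q) <= height X Y p r (X q))])).
  apply/forallP/forallP => H a; apply/forallP => b; apply: (forallP (H b)).
move=> a; apply: eq_forallb => b; rewrite edge_mirror.
case e': (edge X adj b a) => //=.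
by rewrite !ltrN2 (andbC (X b < X q)) (height_mirror _ (edge_lt e')).
Qed.

Lemma nextright_mirror p r t : edge X adj p r ->
  nextright X' Y adj r p t <-> nextleft X Y adj p r t.
Proof.
move=> /edge_lt e; rewrite /nextright /nextleft edge_mirror; split=> -[et l m].
  split=> //; first by move: l; rewrite !slope_mirror ?ltrN2 //; apply: edge_lt et.
  move=> t' et' l'; have := m t'; rewrite edge_mirror => /(_ et').
  rewrite !slope_mirror ?ltrN2 ?lerN2 //; try exact: edge_lt et; try exact: edge_lt et'.
  exact.
split=> //; first by rewrite !slope_mirror ?ltrN2 //; apply: edge_lt et.
move=> t'; rewrite edge_mirror => et'; have := m t' et'.
rewrite !slope_mirror ?ltrN2 ?lerN2 //; try exact: edge_lt et; try exact: edge_lt et'.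
Qed.

Lemma wedge_mirror p r t q : X p < X r -> X t < X r ->
  wedge_r X' Y r p t q <-> wedge_l X Y p r t q.
Proof.
move=> e e'; rewrite /wedge_r /wedge_l /X' !ltrN2 lerN2 -/X' !height_mirror //.
by rewrite (andbC (X q < X r)).
Qed.

Lemma noleft_mirror q : noleft X' adj q = noright X adj q.
Proof. by apply: eq_forallb => t; rewrite edge_mirror. Qed.

End Mirror.

(** * The triangle on the upper side of an edge *)

Section Apex.
Variables (R : realFieldType) (T : finType) (X Y : T -> R) (adj : rel T).
Hypothesis Xinj : injective X.
Hypothesis adjC : symmetric adj.
Hypothesis adjP : planar X Y adj.
Local Notation h := (height X Y).
Local Notation edge := (edge X adj).
Local Notation slope := (slope X Y).
Local Notation topright := (topright X Y adj).
Local Notation topleft := (topleft X Y adj).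
Local Notation under := (under X Y adj).
Local Notation noleft := (noleft X adj).
Local Notation noright := (noright X adj).

(** The height is that of the whole line through p and r, because the abscissa of q may fall outside
    the edge. *)
Definition apex p r q := [/\ adj p q, adj r q & h p r (X q) < Y q].

Definition multi p r := [\/ topright p r /\ topleft p r,
  (topright p r \/ topleft p r) /\ (exists q, under q p r) |
  exists q q', [/\ q <> q', under q p r & under q' p r]].

(** The ways in which p r can fail to carry a triangle, each exhibiting a saving close to p r. In
    the last case the triangle through s only serves to keep q close. *)
Definition defect p r := [\/ multi p r, noleft p \/ noright r,
  (exists p', edge p' p /\ multi p' p) \/ (exists r', edge r r' /\ multi r r') |
  exists q s, [/\ noleft q \/ noright q, tri X Y p r s (X q) (Y q) & adj p s \/ adj r s]].

Lemma wedge_tri p r s q : X p < X r -> X p < X s -> wedge_r X Y p r s q ->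
  tri X Y p r s (X q) (Y q).
Proof.
move=> pr ps [/andP[q1 q2] q3 q4 q5].
have [|t [/andP[t0 t1] E1 E2]] := @height_conv _ _ X Y p r (X q) pr; first lra.
have [|u [/andP[u0 u1] E3 E4]] := @height_conv _ _ X Y p s (X q) ps; first lra.
have d : 0 < h p s (X q) - h p r (X q) by lra.
pose w := (Y q - h p r (X q)) / (h p s (X q) - h p r (X q)).
have w0 : 0 <= w by rewrite divr_ge0; lra.
have w1 : w <= 1 by rewrite ler_pdivrMr //; lra.
have Ew : Y q = (1 - w) * h p r (X q) + w * h p s (X q) by rewrite /w; field; lra.
exists (1 - (1 - w) * t - w * u), ((1 - w) * t), (w * u); split.
- by split; nra.
- nra.
- ring.
- have -> : X q = (1 - w) * X q + w * X q by ring.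
  by rewrite {1}E1 {1}E3; ring.
- by rewrite Ew E2 E4; ring.
Qed.

Lemma nexist_left p r : edge p r -> ~~ topleft p r -> exists t, nextleft X Y adj p r t.
Proof.
move=> e; rewrite -topright_mirror // => H.
have [|t] := @nexist_right _ _ (fun v => - X v) Y adj r p _ H; first by rewrite edge_mirror.
by exists t; apply/nextright_mirror.
Qed.

Lemma wedge_rightmost p r t : edge p r -> nextleft X Y adj p r t ->
  (exists q, wedge_l X Y p r t q) ->
  exists q, [/\ wedge_l X Y p r t q, under q p r & q <> t -> noright q].
Proof.
move=> e nt [q W].
have tr : X t < X r by case: nt => /edge_lt.
have pr := edge_lt e.
have inj' : injective (fun v => - X v) by move=> u v /oppr_inj /Xinj.
case: (@wedge_leftmost _ _ (fun v => - X v) Y adj inj' (planar_mirror adjP) r p t).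
- by rewrite edge_mirror.
- exact/nextright_mirror.
- by exists q; apply/wedge_mirror.
move=> q' [W' U N]; exists q'; split.
- exact/wedge_mirror.
- by rewrite -under_mirror.
- by move=> /N; rewrite noleft_mirror.
Qed.

Lemma wedge_nonempty_l p r s t : edge p r -> nextright X Y adj p r s -> nextleft X Y adj p r t ->
  exists q, wedge_l X Y p r t q.
Proof.
move=> e ns nt.
have tr : X t < X r by case: nt => /edge_lt.
have ps : X p < X s by case: ns => /edge_lt.
have pr := edge_lt e.
have inj' : injective (fun v => - X v) by move=> u v /oppr_inj /Xinj.
have [|||q W] := @wedge_nonempty _ _ (fun v => - X v) Y adj inj' (planar_mirror adjP) r p t s.
- by rewrite edge_mirror.
- exact/nextright_mirror.
- case: ns => es ls ms; split.
  + by rewrite edge_mirror.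
  + by rewrite !slope_mirror ?ltrN2.
  + move=> s'; rewrite edge_mirror // => es'.
    rewrite !(slope_mirror _ pr, slope_mirror _ ps, slope_mirror _ (edge_lt es')).
    by rewrite ltrN2 lerN2; apply: ms.
by exists q; apply/wedge_mirror.
Qed.

Lemma topleft_exists q : ~~ noleft q -> exists p, topleft p q.
Proof.
rewrite /noleft negb_forall => /existsP[t0]; rewrite negbK => e0.
case: (Order.TotalTheory.arg_minP (P := fun t => edge t q) (fun t => slope t q) e0) => t et m.
by exists t; rewrite /topleft et; apply/forallP => u; apply/implyP => /m.
Qed.

(** If neither end pays, the extreme vertices of the two wedges coincide and equal both s and t, or
    a second payment or a vertex without edges on one side appears. If only p pays, look at the top
    left neighbour p' of p: without a defect, the edge after p' p at p' and the edge t r are one and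
    the same edge passing over p. The excluded case, in which only r pays, is the mirror image of
    the latter. *)
Lemma apex_or_defect p r : edge p r -> topright p r || ~~ topleft p r ->
  (exists q, apex p r q) \/ defect p r.
Proof.
move=> e; have pr := edge_lt e.
have [L|nL] := boolP (topleft p r).
  by rewrite orbF => R0; right; apply: Or41; apply: Or31.
move=> _.
have [t nt] := nexist_left e nL.
case: (nt) => et lt_t mt; have tr := edge_lt et.
have [Rt|nR] := boolP (topright p r); last first.
  have [s ns] := nexist_right e nR.
  case: (ns) => es ls ms; have ps := edge_lt es.
  have [q [W U N]] := wedge_leftmost Xinj adjP e ns (wedge_nonempty Xinj adjP e ns nt).
  have [q' [W' U' N']] := wedge_rightmost e nt (wedge_nonempty_l e ns nt).
  case: (eqVneq q q') => [E|/eqP n]; last first.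
    by right; apply: Or41; apply: Or33; exists q, q'.
  subst q'.
  case: (eqVneq q s) => [E1|/eqP n1]; last first.
    right; apply: Or44; exists q, s; split; first by left; apply: N.
      exact: wedge_tri W.
    by left; apply: edge_adj es.
  case: (eqVneq q t) => [E2|/eqP n2]; last first.
    right; apply: Or44; exists q, s; split; first by right; apply: N'.
      exact: wedge_tri W.
    by left; apply: edge_adj es.
  left; exists q; split.
  - by rewrite E1; apply: edge_adj es.
  - by rewrite E2 adjC; apply: edge_adj et.
  - by case: W.
have [/existsP[q0 U0]|nD] := boolP [exists q, under q p r].
  by right; apply: Or41; apply: Or32; split; [left|exists q0].
have [NLp|] := boolP (noleft p); first by right; apply: Or42; left.
move=> /topleft_exists[p' Lp']; have ep' : edge p' p by case/andP: Lp'.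
have pp' := edge_lt ep'.
have nt' : X t <> X p by move=> /Xinj E; subst t; rewrite ltxx in lt_t.
have Wempty q : ~ wedge_l X Y p r t q.
  move=> W; have [|q' [_ U' _]] := wedge_rightmost e nt; first by exists q.
  by case/existsP: nD; exists q'.
have het x : x < X r -> h p r x < h t r x by move=> H; rewrite -slope_height_r.
have tp : X t < X p.
  case: (ltgtP (X t) (X p)) => // pt; case: (Wempty t); split; rewrite ?lexx ?height_l //; first lra.
  by rewrite -[ltRHS](height_l X Y t r); exact: het.
have [Rp'|nRp'] := boolP (topright p' p).
  by right; apply: Or43; left; exists p'; split=> //; apply: Or31.
have [/existsP[q0 U0]|nD'] := boolP [exists q, under q p' p].
  by right; apply: Or43; left; exists p'; split=> //; apply: Or32; split; [right|exists q0].
have [s ns] := nexist_right ep' nRp'; case: (ns) => es ls ms; have ps := edge_lt es.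
have Wempty' q : ~ wedge_r X Y p' p s q.
  move=> W; have [|q' [_ U' _]] := wedge_leftmost Xinj adjP ep' ns; first by exists q.
  by case/existsP: nD'; exists q'.
have hes x : X p' < x -> h p' p x < h p' s x by move=> H; rewrite -slope_height.
have sp : X p < X s.
  case: (ltgtP (X s) (X p)) => [sp| //|/Xinj E]; last by subst s; rewrite ltxx in ls.
  case: (Wempty' s); split; rewrite ?lexx ?height_r //; first lra.
  by rewrite -[ltRHS](height_r Y ps); exact: hes.
have tp1 := het _ pr; have sp1 := hes _ pp'; rewrite height_l in tp1; rewrite height_r // in sp1.
have hpp' : h p' p (X p) = Y p by exact: height_r.
have hpr : h p r (X p) = Y p by exact: height_l.
case: (eqVneq (p', s) (t, r)) => [[E1 E2]|/eqP n].
  subst p' s; left; exists t; split.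
  - by rewrite adjC; apply: edge_adj ep'.
  - by rewrite adjC; apply: edge_adj et.
  - by rewrite -[ltRHS](height_l X Y t r); exact: het.
(* The lower of the two edges over p has an end in a wedge known to be empty, or runs through an end
   of the other edge, or shares an end with it and contradicts the choice of the next edge. *)
exfalso; case: (ltgtP (h t r (X p)) (h p' s (X p))) => [l|l|E].
- case: (ltgtP (X t) (X p')) => [tp'|p't|/Xinj E].
  + have A1 : h p' p (X p') <= h t r (X p').
      by apply: (nocross Xinj adjP ep' et (x := X p)); rewrite ?hpp'; lra.
    have A2 : h t r (X p') <= h p' s (X p').
      by apply: (nocross Xinj adjP et es (x := X p)); lra.
    have n' : (p', p) <> (t, r) by case=> F _; subst p'; lra.
    have : shared X p' p t r (X p').
      by apply: (height_eq adjP ep' et n'); rewrite ?height_l in A1 A2 *; lra.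
    by case=> -[F [G|G]]; subst; lra.
  + apply: (Wempty' t); split; [lra| |lra|].
      have A1 : h p' p (X t) <= h t r (X t).
        by apply: (nocross Xinj adjP ep' et (x := X p)); rewrite ?hpp'; lra.
      rewrite height_l in A1; rewrite lt_neqAle A1 andbT; apply/eqP => F.
      have n' : (p', p) <> (t, r) by case=> F1 _; subst p'; lra.
      have : shared X p' p t r (X t).
        by apply: (height_eq adjP ep' et n'); rewrite ?height_l; lra.
      by case=> -[F' _]; lra.
    rewrite -[leLHS](height_l X Y t r).
    by apply: (nocross Xinj adjP et es (x := X p)); lra.
  + subst p'.
    have := ms r et; rewrite leNgt !(slope_height Y _ _ pp') hpp' l.
    by move=> /(_ tp1).
- case: (ltgtP (X s) (X r)) => [sr|rs|/Xinj E].
  + apply: (Wempty s); split; [lra| |lra|].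
      have A1 : h p r (X s) <= h p' s (X s).
        by apply: (nocross Xinj adjP e es (x := X p)); rewrite ?hpr; lra.
      rewrite height_r // in A1; rewrite lt_neqAle A1 andbT; apply/eqP => F.
      have n' : (p, r) <> (p', s) by case=> F1 _; subst p'; lra.
      have : shared X p r p' s (X s).
        by apply: (height_eq adjP e es n'); rewrite ?height_r; lra.
      by case=> -[F' _]; lra.
    rewrite -[leLHS](height_r Y ps).
    by apply: (nocross Xinj adjP es et (x := X p)); lra.
  + have A1 : h p r (X r) <= h p' s (X r).
      by apply: (nocross Xinj adjP e es (x := X p)); rewrite ?hpr; lra.
    have A2 : h p' s (X r) <= h t r (X r).
      by apply: (nocross Xinj adjP es et (x := X p)); lra.
    have n' : (p, r) <> (p', s) by case=> F _; subst p'; lra.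
    rewrite !height_r // in A1 A2.
    have : shared X p r p' s (X r).
      by apply: (height_eq adjP e es n'); rewrite ?height_r; lra.
    by case=> -[F [G|G]]; subst; lra.
  + subst s.
    have F1 : slope p' r < slope p r by rewrite (slope_height_r Y pr pr ps) hpr.
    have := mt p' es F1; rewrite leNgt (slope_height_r Y pr ps tr).
    by rewrite l.
- have : shared X t r p' s (X p).
    by apply: (height_eq adjP et es) => //; [move=> F; apply: n; rewrite F|lra|lra].
  by case=> -[F _]; lra.
Qed.

End Apex.

Section MirrorApex.
Variables (R : realFieldType) (T : finType) (X Y : T -> R) (adj : rel T).
Hypothesis adjC : symmetric adj.
Let X' v := - X v.

Lemma multi_mirror p r : multi X' Y adj r p -> multi X Y adj p r.
Proof.
have E1 := topright_mirror X Y adjC; have E3 := under_mirror X Y adjC.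
have E2 a b : topleft X' Y adj b a = topright X Y adj a b.
  rewrite -topright_mirror //; rewrite /topright /edge /slope.
  by under eq_forallb => s do rewrite !opprK; rewrite !opprK.
case=> [[]|[D [q U]]|[q [q' [n U U']]]].
- by rewrite E1 E2 => A B; apply: Or31.
- apply: Or32; split; first by case: D; rewrite ?E1 ?E2; [right|left].
  by exists q; rewrite -E3.
- by apply: Or33; exists q, q'; rewrite -!E3.
Qed.

Lemma defect_mirror p r : defect X' Y adj r p -> defect X Y adj p r.
Proof.
have N1 := noleft_mirror X adjC.
have N2 q : noright X' adj q = noleft X adj q.
  by rewrite -noleft_mirror //; apply: eq_forallb => t; rewrite /edge !opprK.
case=> [M|[N|N]|[[q [e M]]|[q [e M]]]|[q [s [N Tr A]]]].
- by apply: Or41; apply: multi_mirror.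
- by apply: Or42; right; rewrite -N1.
- by apply: Or42; left; rewrite -N2.
- apply: Or43; right; exists q; split; first by rewrite -edge_mirror.
  exact: multi_mirror.
- apply: Or43; left; exists q; split; first by rewrite -edge_mirror.
  exact: multi_mirror.
- apply: Or44; exists q, s; split.
  + by case: N; rewrite ?N1 ?N2; [right|left].
  + case: Tr => a [b [c [[a0 b0] c0 S1 Ex Ey]]]; exists b, a, c; split=> //.
    * by rewrite (addrC b).
    * by apply: oppr_inj; rewrite -/(X' q) Ex /X'; ring.
    * by rewrite Ey; ring.
  + by case: A; [right|left].
Qed.
End MirrorApex.

(** * Climbing along a vertical line, and the edge count *)

Section Chain.
Variables (R : realFieldType) (T : finType) (X Y : T -> R) (adj : rel T).
Hypothesis Xinj : injective X.
Hypothesis adjC : symmetric adj.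
Hypothesis adjP : planar X Y adj.
Local Notation h := (height X Y).
Local Notation edge := (edge X adj).

Theorem apex_defect p r : edge p r -> (exists q, apex X Y adj p r q) \/ defect X Y adj p r.
Proof.
move=> e; have [] := boolP (topright X Y adj p r || ~~ topleft X Y adj p r).
  exact: apex_or_defect.
rewrite negb_or negbK => /andP[nR L].
have inj' : injective (fun v => - X v) by move=> u v /oppr_inj /Xinj.
case: (apex_or_defect inj' adjC (planar_mirror adjP) (p := r) (r := p)).
- by rewrite edge_mirror.
- by rewrite topright_mirror // L.
- move=> [q [A B H]]; left; exists q; split=> //.
  by move: H; rewrite height_mirror ?(edge_lt e).
- by move=> D; right; apply: defect_mirror.
Qed.

(** Take the highest edge over x0 that is still below y0. An apex would give a triangle one of whose
    other two sides crosses the line higher up: either that side is still below y0, against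
    maximality, or the triangle covers the point. *)
Lemma chain p0 r0 x0 y0 : (forall v, X v <> x0) ->
  (forall p q r, adj p q -> adj q r -> adj p r -> ~ tri X Y p q r x0 y0) ->
  edge p0 r0 -> X p0 < x0 < X r0 -> h p0 r0 x0 < y0 ->
  exists p r, [/\ edge p r, X p < x0 < X r, h p0 r0 x0 <= h p r x0 < y0 & defect X Y adj p r].
Proof.
move=> gen blk e0 sp0 l0.
pose Q (e : T * T) := [&& edge e.1 e.2, X e.1 < x0 < X e.2 & h p0 r0 x0 <= h e.1 e.2 x0 < y0].
have Q0 : Q (p0, r0) by rewrite /Q e0 sp0 lexx.
case: (Order.TotalTheory.arg_maxP (fun e => h e.1 e.2 x0) Q0) => -[p r] /and3P[/= e sp l] m.
case: (apex_defect e) => [[q [pq rq lq]]|D]; last by exists p, r.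
exfalso.
have pr := edge_lt e.
have [t [/andP[t0 t1] Ex Ey]] := @height_conv _ _ X Y p r x0 pr (ltac:(lra)).
have Eh : h p r (X q) = Y p + (X q - X p) * ((Y r - Y p) / (X r - X p)) by [].
have E0 : h p r x0 = Y p + (x0 - X p) * ((Y r - Y p) / (X r - X p)) by [].
have Er : Y r = h p r (X r) by rewrite height_r.
have ErE : h p r (X r) = Y p + (X r - X p) * ((Y r - Y p) / (X r - X p)) by [].
set sl := (Y r - Y p) / _ in Eh E0 ErE.
(* the next edge [a b] is the side of the triangle through the apex that meets the line x = x0 *)
have fin a b : edge a b -> X a < x0 < X b -> h p r x0 < h a b x0 ->
    (forall y, h p r x0 <= y <= h a b x0 -> tri X Y p q r x0 y) -> False.
  move=> ab sab lab cov.
  have [ly|ly] := ltP (h a b x0) y0.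
    by have := m (a, b); rewrite /Q /= ab sab ly /= => /(_ _); lra.
  by apply: (blk p q r) => //; [rewrite adjC|apply: edge_adj e|apply: cov; lra].
have cv u w : X u < x0 < X w -> exists s, [/\ 0 <= s <= 1, x0 = (1 - s) * X u + s * X w & h u w x0 = (1 - s) * Y u + s * Y w].
  by move=> H; apply: height_conv; lra.
have mix y y1 : h p r x0 <= y <= y1 -> h p r x0 < y1 -> exists w, [/\ 0 <= w, w <= 1 & y = (1 - w) * h p r x0 + w * y1].
  move=> H1 H2; exists ((y - h p r x0) / (y1 - h p r x0)); split.
  - by rewrite divr_ge0; lra.
  - by rewrite ler_pdivrMr; lra.
  - by field; lra.
case: (ltgtP (X q) x0) => [qx|xq|/gen//].
- have sq : X q < x0 < X r by lra.
  have [s [/andP[s0 s1] Fx Fy]] := cv _ _ sq.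
  have lt1 : h p r x0 < h q r x0.
    have s1' : s < 1 by rewrite lt_neqAle s1 andbT; apply/eqP => s1'; rewrite s1' in Fx; lra.
    have -> : h p r x0 = (1 - s) * h p r (X q) + s * Y r.
      by rewrite Er ErE Eh E0 Fx; ring.
    by rewrite Fy ltrD2r ltr_pM2l //; lra.
  apply: (fin q r) => //; first by rewrite /edge adjC rq; lra.
  move=> y Hy; have [w [w0 w1 Ew]] := mix _ _ Hy lt1.
  exists ((1 - w) * (1 - t)), (w * (1 - s)), ((1 - w) * t + w * s); split.
  + by split; nra.
  + nra.
  + ring.
  + by have -> : x0 = (1 - w) * x0 + w * x0 by [ring]; rewrite {1}Ex {1}Fx; ring.
  + by rewrite Ew Ey Fy; ring.
- have sq : X p < x0 < X q by lra.
  have [s [/andP[s0 s1] Fx Fy]] := cv _ _ sq.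
  have lt1 : h p r x0 < h p q x0.
    have s0' : 0 < s by rewrite lt_neqAle s0 andbT; apply/eqP => s0'; rewrite -s0' in Fx; lra.
    have -> : h p r x0 = (1 - s) * Y p + s * h p r (X q) by rewrite Eh E0 Fx; ring.
    by rewrite Fy ltrD2l ltr_pM2l.
  apply: (fin p q) => //; first by rewrite /edge pq; lra.
  move=> y Hy; have [w [w0 w1 Ew]] := mix _ _ Hy lt1.
  exists ((1 - w) * (1 - t) + w * (1 - s)), (w * s), ((1 - w) * t); split.
  + by split; nra.
  + nra.
  + ring.
  + by have -> : x0 = (1 - w) * x0 + w * x0 by [ring]; rewrite {1}Ex {1}Fx; ring.
  + by rewrite Ew Ey Fy; ring.
Qed.

(** An edge paid by neither end is paid by the leftmost vertex of the wedge on it; hence every edge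
    is paid for. *)
Lemma nocharge_edge p r : edge p r -> ~~ topright X Y adj p r -> ~~ topleft X Y adj p r ->
  exists q, under X Y adj q p r.
Proof.
move=> e nR nL.
have [s ns] := nexist_right e nR; have [t nt] := nexist_left adjC e nL.
have [q [_ U _]] := wedge_leftmost Xinj adjP e ns (wedge_nonempty Xinj adjP e ns nt).
by exists q.
Qed.

Lemma topleft_uniq p p' r : topleft X Y adj p r -> topleft X Y adj p' r -> p = p'.
Proof.
rewrite -!topright_mirror //; apply: topright_uniq.
by apply: planar_mirror.
Qed.

Lemma multi_overcharged p r : multi X Y adj p r -> overcharged X Y adj p r.
Proof.
rewrite /overcharged => -[[-> ->] //|[D [q U]]|[q [q' [n U U']]]].
  have c1 : (0 < #|[set q | under X Y adj q p r]|)%N by apply/card_gt0P; exists q; rewrite inE.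
  by case: D => ->; lia.
have : (#|[set q; q']| <= #|[set q | under X Y adj q p r]|)%N.
  by apply: subset_leq_card; apply/fintype.subsetP => v; rewrite !inE => /orP[]/eqP->.
by rewrite cards2; move/eqP: n => ->; lia.
Qed.

Definition edges := [set e : T * T | edge e.1 e.2].
Definition over := [set e : T * T | edge e.1 e.2 && overcharged X Y adj e.1 e.2].
Definition noR := [set q | noright X adj q].
Definition noL := [set q | noleft X adj q].

Lemma card_topright : (#|[set e : T * T | topright X Y adj e.1 e.2]| + #|noR| <= #|T|)%N.
Proof.
rewrite addnC -(cardsC noR) leq_add2l.
rewrite -(card_in_imset (f := fst)); last first.
  by move=> [p r] [p' r']; rewrite !inE /= => H H' E; subst p'; rewrite (topright_uniq adjP H H').
apply: subset_leq_card; apply/fintype.subsetP => q /imsetP[[p r]]; rewrite !inE /= => /andP[e _] ->.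
by rewrite negb_forall; apply/existsP; exists r; rewrite negbK.
Qed.

Lemma card_topleft : (#|[set e : T * T | topleft X Y adj e.1 e.2]| + #|noL| <= #|T|)%N.
Proof.
rewrite addnC -(cardsC noL) leq_add2l.
rewrite -(card_in_imset (f := snd)); last first.
  by move=> [p r] [p' r']; rewrite !inE /= => H H' E; subst r'; rewrite (topleft_uniq H H').
apply: subset_leq_card; apply/fintype.subsetP => q /imsetP[[p r]]; rewrite !inE /= => /andP[e _] ->.
by rewrite negb_forall; apply/existsP; exists p; rewrite negbK.
Qed.

Lemma card_under : (\sum_(e : T * T) #|[set q | under X Y adj q e.1 e.2]| <= #|T|)%N.
Proof.
under eq_bigr => e _ do rewrite -sum1_card big_mkcond /=.
rewrite exchange_big /= -sum1_card; apply: leq_sum => q _.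
rewrite (eq_bigr (fun e => if under X Y adj q e.1 e.2 then 1 else 0)%N); last first.
  by move=> e _; rewrite ?inE.
rewrite -big_mkcond /= sum1_card.
apply/card_le1_eqP => -[p r] [p' r']; rewrite -!topredE /= => U U'.
by rewrite (under_uniq adjP U U').
Qed.

(** Count payments: each of the three kinds is made at most once per vertex, the first two not by
    vertices without an edge on that side. Every edge receives a payment, an overcharged one at
    least two. *)
Theorem card_edges_defects : (#|edges| + #|over| + #|noR| + #|noL| <= 3 * #|T|)%N.
Proof.
have H : (#|edges| + #|over| <= #|[set e : T * T | topright X Y adj e.1 e.2]| +
    #|[set e : T * T | topleft X Y adj e.1 e.2]| +
    \sum_(e : T * T) #|[set q | under X Y adj q e.1 e.2]|)%N.
  rewrite -!sum1_card !(big_mkcond (fun e => e \in _)) /= -!big_split /=.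
  apply: leq_sum => -[p r] _; rewrite !inE /=.
  case e : (edge p r) => //=.
  have [c|] := boolP (overcharged X Y adj p r).
    by move: c; rewrite /overcharged; do 2!case: ifP => _; lia.
  case Rt : (topright X Y adj p r) => //= _.
  case Lt : (topleft X Y adj p r) => //=.
  have [q U] := nocharge_edge e (negbT Rt) (negbT Lt).
  have : (0 < #|[set q | under X Y adj q p r]|)%N by apply/card_gt0P; exists q; rewrite inE.
  lia.
have := card_topright; have := card_topleft; have := card_under; lia.
Qed.

Definition bad v := noright X adj v \/ noleft X adj v \/ exists r, edge v r /\ overcharged X Y adj v r.

(** Bad vertices are at most as many as savings, an overcharged edge being assigned to its left end.
    Each serves at most N vertices c, so there are at least |T| / N savings. *)
Corollary card_edges_near N (near : rel T) :
  (forall v, (#|[set c | near c v]| <= N)%N) -> (forall c, exists2 v, near c v & bad v) ->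
  (N * #|edges| + #|T| <= 3 * N * #|T|)%N.
Proof.
move=> HN Hb.
pose A := noR :|: noL :|: [set e.1 | e in over].
have cA : (#|A| <= #|noR| + #|noL| + #|over|)%N.
  apply: leq_trans (leq_card_setU _ _) _; apply: leq_add (leq_imset_card _ _).
  exact: leq_card_setU.
have cT : (#|T| <= #|A| * N)%N.
  rewrite -cardsT; apply: (@leq_trans (#|\bigcup_(v in A) [set c | near c v]|)).
    apply: subset_leq_card; apply/fintype.subsetP => c _; have [v cv bv] := Hb c.
    apply/bigcupP; exists v; last by rewrite inE.
    case: bv => [b|[b|[r [e o]]]]; rewrite !inE ?b ?orbT //.
    by apply/orP; right; apply/imsetP; exists (v, r); rewrite ?inE ?e.
  rewrite -sum_nat_const.
  elim/big_ind2: _ => [|m1 B1 m2 B2 h1 h2|v _]; rewrite ?cards0 //.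
  by apply: leq_trans (leq_card_setU _ _) _; apply: leq_add.
by have := card_edges_defects; nia.
Qed.
End Chain.

(** * Locating a bad vertex near a given one *)

Section Near.
Variables (R : realFieldType) (T : finType) (X Y : T -> R) (adj : rel T).
Hypothesis Xinj : injective X.
Hypothesis adjC : symmetric adj.
Hypothesis adjP : planar X Y adj.
Local Notation h := (height X Y).
Local Notation edge := (edge X adj).

Lemma conv_le (a b t B : R) : 0 <= t <= 1 -> `|a - b| <= B ->
  `|(1 - t) * a + t * b - a| <= B /\ `|(1 - t) * a + t * b - b| <= B.
Proof.
move=> /andP[t0 t1]; rewrite !ler_norml => /andP[h1 h2]; split; apply/andP; split; nra.
Qed.

Lemma tri_le (a b d x y z B : R) : 0 <= a -> 0 <= b -> 0 <= d -> a + b + d = 1 ->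
  `|x - y| <= B -> `|x - z| <= B -> `|x - (a * x + b * y + d * z)| <= B.
Proof.
move=> a0 b0 d0 s; rewrite !ler_norml => /andP[h1 h2] /andP[h3 h4].
have -> : a = 1 - b - d by lra.
have bd : b + d <= 1 by lra.
have -> : x - ((1 - b - d) * x + b * y + d * z) = b * (x - y) + d * (x - z) by ring.
by apply/andP; split; nra.
Qed.

Lemma generic_right c s (de : R) : X c < X s -> 0 < de -> exists x0,
  [/\ X c < x0 < X c + de, x0 < X s & forall v, X v <> x0].
Proof.
move=> cs de0.
case: (arg_minP (P := fun v => X c < X v) X cs) => v0 cv0 mv0.
have m0 : X c < Num.min (X v0) (X c + de) by rewrite lt_min cv0; lra.
have m1 : Num.min (X v0) (X c + de) <= X v0 by rewrite ge_min lexx.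
have m2 : Num.min (X v0) (X c + de) <= X c + de by rewrite ge_min lexx orbT.
have ms := mv0 s cs.
exists ((X c + Num.min (X v0) (X c + de)) / 2); split; [apply/andP; split; lra|lra|].
move=> v E; have [vc|cv] := leP (X v) (X c); first lra.
by have := mv0 v cv; lra.
Qed.

Lemma near_trans (x y z a b : R) : `|x - y| <= a -> `|y - z| <= b -> `|x - z| <= a + b.
Proof. by move=> h1 h2; apply: le_trans (ler_distD y x z) (lerD h1 h2). Qed.

(** Unless c itself has no edge to the right, climb from an edge c s on a generic line just right of
    c. The final edge has its ends within 2 L horizontally and La + L vertically of c, and the
    witnesses of its defect are at most 2 L further away. *)
Lemma bad_near (L La : R) (c : T) (y0 : R) : 0 < L ->
  (forall a b, adj a b -> `|X a - X b| < L /\ `|Y a - Y b| < L) ->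
  Y c + L <= y0 <= Y c + La ->
  forall de, 0 < de -> (forall x0, X c < x0 < X c + de -> forall p q r,
     adj p q -> adj q r -> adj p r -> ~ tri X Y p q r x0 y0) ->
  exists2 v, `|X c - X v| <= La + 4 * L /\ `|Y c - Y v| <= La + 4 * L & bad X Y adj v.
Proof.
move=> L0 sh' /andP[y1 y2] de de0 blk.
have sh a b : adj a b -> `|X a - X b| <= L /\ `|Y a - Y b| <= L.
  by move=> /sh'[h1 h2]; split; apply: ltW.
have La0 : L <= La by lra.
have [nc|] := boolP (noright X adj c).
  exists c; last by left.
  by rewrite !subrr normr0; split; lra.
rewrite negb_forall => /existsP[s]; rewrite negbK => es.
have cs := edge_lt es.
have [x0 [cx0 x0s gen]] := generic_right cs de0.
have [sh1 sh2] := sh _ _ (edge_adj es).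
have [|t [t01 Ex Ey]] := @height_conv _ _ X Y c s x0 cs.
  by lra.
have [hup1 _] : `|h c s x0 - Y c| <= L /\ `|h c s x0 - Y s| <= L.
  by rewrite Ey; apply: conv_le.
have hup : h c s x0 < y0.
  have [_ k2] := sh' _ _ (edge_adj es).
  have E : h c s x0 - Y c = t * (Y s - Y c) by rewrite Ey; ring.
  case/andP: t01 => t0 t1; rewrite ltr_norml in k2.
  have : h c s x0 - Y c < L by rewrite E; nra.
  by lra.
have [||p [r [epr spr hpr D]]] := chain Xinj adjC adjP gen (y0 := y0) _ es _ hup.
- by move=> p q r pq qr pr; apply: blk.
- by lra.
have pr := edge_lt epr.
have [a1 a2] := sh _ _ (edge_adj epr).
have [|u [u01 Fx Fy]] := @height_conv _ _ X Y p r x0 pr; first by lra.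
have [g1 g2] := conv_le u01 a1; rewrite -Fx in g1 g2.
have [g3 g4] := conv_le u01 a2; rewrite -Fy in g3 g4.
have xc : `|X c - x0| <= L.
  by move: sh1; rewrite !ler_norml; lra.
have yc : `|Y c - h p r x0| <= La.
  by move: hup1; rewrite !ler_norml; lra.
have [px py] : `|X c - X p| <= L + L /\ `|Y c - Y p| <= La + L.
  by split; [exact: near_trans xc g1|exact: near_trans yc g3].
have [rx ry] : `|X c - X r| <= L + L /\ `|Y c - Y r| <= La + L.
  by split; [exact: near_trans xc g2|exact: near_trans yc g4].
have fin v : `|X c - X v| <= 4 * L -> `|Y c - Y v| <= La + 3 * L ->
   `|X c - X v| <= La + 4 * L /\ `|Y c - Y v| <= La + 4 * L.
  by split; lra.
have wk (a b d : R) : a <= b -> b <= d -> a <= d by apply: le_trans.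
have fin1 v w : `|X c - X v| <= L + L -> `|Y c - Y v| <= La + L -> `|X v - X w| <= L + L ->
    `|Y v - Y w| <= L + L -> `|X c - X w| <= La + 4 * L /\ `|Y c - Y w| <= La + 4 * L.
  move=> h1 h2 h3 h4; apply: fin.
    by apply: wk (near_trans h1 h3) _; lra.
  by apply: wk (near_trans h2 h4) _; lra.
have z0 v : `|X v - X v| <= L + L by rewrite subrr normr0; lra.
have z1 v : `|Y v - Y v| <= L + L by rewrite subrr normr0; lra.
have dbl (a : R) : a <= L -> a <= L + L by lra.
have LL : L <= L + L by apply: dbl.
case: D => [M|[N|N]|[[q [e M]]|[q [e M]]]|[q [s' [N Tr A]]]].
- exists p; first exact: fin1 px py (z0 p) (z1 p).
  by right; right; exists r; split=> //; apply: multi_overcharged.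
- by exists p; [exact: fin1 px py (z0 p) (z1 p)|right; left].
- by exists r; [exact: fin1 rx ry (z0 r) (z1 r)|left].
- have [b1 b2] := sh _ _ (edge_adj e); rewrite distrC in b1; rewrite distrC in b2.
  exists q; first by apply: (fin1 p) => //; apply: dbl.
  by right; right; exists p; split=> //; apply: multi_overcharged.
- exists r; first exact: fin1 rx ry (z0 r) (z1 r).
  by right; right; exists q; split=> //; apply: multi_overcharged.
- have [b1 b2] : `|X p - X s'| <= L + L /\ `|Y p - Y s'| <= L + L.
    case: A => /sh[b1 b2]; first by split; apply: dbl.
    by split; [exact: near_trans a1 b1|exact: near_trans a2 b2].
  have bq : bad X Y adj q by case: N => ?; [right; left|left].
  exists q => //; case: Tr => a [b [d [[a0 b0] d0 S1 E1 E2]]].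
  apply: (fin1 p) => //.
    by rewrite E1; apply: tri_le => //; apply: dbl.
  by rewrite E2; apply: tri_le => //; apply: dbl.
Qed.
End Near.

(** * Delaunay graphs *)

Section Delaunay.
Local Open Scope classical_set_scope.
Local Open Scope ring_scope.
Variable R : realType.
Local Notation pt := (pt2 R).
Implicit Types (S : set pt) (x y z w u v : pt).

Definition d2 x y : R := (x.1 - y.1) ^+ 2 + (x.2 - y.2) ^+ 2.

Lemma d2_ge0 x y : 0 <= d2 x y. Proof. by rewrite addr_ge0 ?sqr_ge0. Qed.
Lemma d2C x y : d2 x y = d2 y x. Proof. by rewrite /d2; ring. Qed.
Lemma d2_eq0 x y : d2 x y = 0 -> x = y.
Proof.
case: x y => x1 x2 [y1 y2]; rewrite /d2 /= => /eqP.
rewrite paddr_eq0 ?sqr_ge0 // !sqrf_eq0 !subr_eq0 => /andP[/eqP-> /eqP->] //.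
Qed.
Lemma d2xx x : d2 x x = 0. Proof. by rewrite /d2; ring. Qed.
Lemma edist_le x y u v : (edist x y <= edist u v) = (d2 x y <= d2 u v).
Proof. by rewrite /edist ler_psqrt ?nnegrE ?d2_ge0. Qed.

Lemma cellP S x z : S x -> voronoi_cell S x z <-> forall y, S y -> d2 z x <= d2 z y.
Proof.
move=> Sx; rewrite /voronoi_cell /=.
have lb0 : has_lbound [set edist z y | y in S].
  by exists 0 => _ [y Sy <-]; exact: sqrtr_ge0.
split=> [E y Sy|H].
  by rewrite -edist_le E; apply: ge_inf => //; exists y.
apply/eqP; rewrite eq_le; apply/andP; split; last by apply: ge_inf => //; exists x.
apply: lb_le_inf; first by exists (edist z x), x.
by move=> _ [y Sy <-]; rewrite edist_le; apply: H.
Qed.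

(** [delaunay_adj] relates a point to itself as soon as its cell has two points, so distinctness is
    added. *)
Definition adjp S x y := x <> y /\ delaunay_adj S x y.
Definition nearest2 S x y z := forall w, S w -> d2 z x <= d2 z w /\ d2 z y <= d2 z w.

Lemma adjpP S x y : adjp S x y <->
  [/\ x <> y, S x, S y & exists z1 z2, [/\ z1 <> z2, nearest2 S x y z1 & nearest2 S x y z2]].
Proof.
rewrite /adjp /delaunay_adj; split.
  move=> [n [Sx Sy [z1 [z2 [n12 [/(cellP _ Sx) a1 /(cellP _ Sy) b1] [/(cellP _ Sx) a2 /(cellP _ Sy) b2]]]]]].
  by split=> //; exists z1, z2; split=> // w Sw; split; auto.
move=> [n Sx Sy [z1 [z2 [n12 h1 h2]]]]; split=> //; split=> //.
by exists z1, z2; split=> //; split; apply/cellP => // w Sw; case: (h1 w Sw); case: (h2 w Sw).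
Qed.

Lemma adjpC S x y : adjp S x y -> adjp S y x.
Proof.
move=> /adjpP[n Sx Sy [z1 [z2 [n12 h1 h2]]]]; apply/adjpP; split=> //; first by move/esym.
by exists z1, z2; split=> // w Sw; [case: (h1 w Sw)|case: (h2 w Sw)].
Qed.

Lemma adjp_mem S x y : adjp S x y -> S x /\ S y.
Proof. by case/adjpP. Qed.

(* three points of one circle that all lie on a line orthogonal to z2 - z1 cannot be distinct *)
Lemma bisector_two x y w z1 z2 : z1 <> z2 -> x <> y ->
  d2 z1 x = d2 z1 y -> d2 z1 x = d2 z1 w -> d2 z2 x = d2 z2 y -> d2 z2 x = d2 z2 w ->
  w = x \/ w = y.
Proof.
case: x y w z1 z2 => x1 x2 [y1 y2] [w1 w2] [p1 p2] [q1 q2] n12 nxy.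
rewrite /d2 /= => e1 e2 e3 e4.
pose u1 := y1 - x1; pose u2 := y2 - x2; pose v1 := w1 - x1; pose v2 := w2 - x2.
pose D := u1 ^+ 2 + u2 ^+ 2; pose N := u1 * v1 + u2 * v2.
have o1 : (q1 - p1) * u1 + (q2 - p2) * u2 = 0 by rewrite /u1 /u2; nra.
have o2 : (q1 - p1) * v1 + (q2 - p2) * v2 = 0 by rewrite /v1 /v2; nra.
have cr : u1 * v2 = u2 * v1.
  have c1 : (q1 - p1) * (u1 * v2 - u2 * v1) = 0.
    have -> : (q1 - p1) * (u1 * v2 - u2 * v1) = v2 * ((q1 - p1) * u1 + (q2 - p2) * u2) -
      u2 * ((q1 - p1) * v1 + (q2 - p2) * v2) by ring.
    by rewrite o1 o2; ring.
  have c2 : (q2 - p2) * (u1 * v2 - u2 * v1) = 0.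
    have -> : (q2 - p2) * (u1 * v2 - u2 * v1) = u1 * ((q1 - p1) * v1 + (q2 - p2) * v2) -
      v1 * ((q1 - p1) * u1 + (q2 - p2) * u2) by ring.
    by rewrite o1 o2; ring.
  move/eqP: c1; rewrite mulf_eq0 => /orP[/eqP d1|/eqP]; last lra.
  move/eqP: c2; rewrite mulf_eq0 => /orP[/eqP d2|/eqP]; last lra.
  by case: n12; congr pair; lra.
have D0 : D != 0.
  apply/eqP => /eqP; rewrite /D paddr_eq0 ?sqr_ge0 // !sqrf_eq0 /u1 /u2 !subr_eq0 => /andP[/eqP E1 /eqP E2].
  by apply: nxy; rewrite E1 E2.
have E1 : D * v1 = N * u1 by rewrite /D /N; have := congr1 (fun t => u2 * t) cr => /=; nra.
have E2 : D * v2 = N * u2 by rewrite /D /N; have := congr1 (fun t => u1 * t) cr => /=; nra.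
have F1 : D = 2 * ((p1 - x1) * u1 + (p2 - x2) * u2) by rewrite /D /u1 /u2; nra.
have F2 : v1 ^+ 2 + v2 ^+ 2 = 2 * ((p1 - x1) * v1 + (p2 - x2) * v2) by rewrite /v1 /v2; nra.
have F3 : N * (N - D) = 0.
  have G : D * (v1 ^+ 2 + v2 ^+ 2) = N ^+ 2.
    have -> : D * (v1 ^+ 2 + v2 ^+ 2) = (D * v1) * v1 + (D * v2) * v2 by ring.
    by rewrite E1 E2 /N; ring.
  have G' : D * (v1 ^+ 2 + v2 ^+ 2) = N * D.
    rewrite F2 [X in _ = N * X]F1.
    have -> : D * (2 * ((p1 - x1) * v1 + (p2 - x2) * v2)) =
      2 * ((p1 - x1) * (D * v1) + (p2 - x2) * (D * v2)) by ring.
    by rewrite E1 E2; ring.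
  by rewrite mulrBr -expr2 -G -G' subrr.
have v0 t : D * t = 0 -> t = 0 by move/eqP; rewrite mulf_eq0 (negbTE D0) /= => /eqP.
move/eqP: F3; rewrite mulf_eq0 => /orP[/eqP N0|/eqP ND].
  left; have a := v0 v1; have b := v0 v2; rewrite E1 E2 N0 !mul0r in a b.
  by congr pair; [have := a erefl; rewrite /v1|have := b erefl; rewrite /v2]; lra.
right.
have a : v1 - u1 = 0 by apply: v0; have := E1; have := ND; clear; nra.
have b : v2 - u2 = 0 by apply: v0; have := E2; have := ND; clear; nra.
by congr pair; [move: a; rewrite /v1 /u1|move: b; rewrite /v2 /u2]; lra.
Qed.

(* the midpoint of the two witnesses is the centre of a disc touching S at x and y only *)
Lemma adjp_disc S x y : adjp S x y -> exists z, d2 z x = d2 z y /\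
  forall w, S w -> w <> x -> w <> y -> d2 z x < d2 z w.
Proof.
move=> /adjpP[n Sx Sy [z1 [z2 [n12 h1 h2]]]].
pose z : pt := ((z1.1 + z2.1) / 2, (z1.2 + z2.2) / 2).
have Ez w v : d2 z w - d2 z v = ((d2 z1 w - d2 z1 v) + (d2 z2 w - d2 z2 v)) / 2.
  by rewrite /d2 /z /=; field.
have e1 : d2 z1 x = d2 z1 y by apply/eqP; rewrite eq_le (proj1 (h1 y Sy)) (proj2 (h1 x Sx)).
have e2 : d2 z2 x = d2 z2 y by apply/eqP; rewrite eq_le (proj1 (h2 y Sy)) (proj2 (h2 x Sx)).
exists z; split; first by apply/eqP; rewrite -subr_eq0 Ez e1 e2 !subrr addr0 mul0r.
move=> w Sw nx ny.
have [a1 _] := h1 w Sw; have [a2 _] := h2 w Sw.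
rewrite -subr_gt0 Ez divr_gt0 // lt_neqAle addr_ge0 ?subr_ge0 // andbT.
apply/eqP => /esym/eqP; rewrite paddr_eq0 ?subr_ge0 // !subr_eq0 => /andP[/eqP b1 /eqP b2].
by case: (bisector_two n12 n e1 (esym b1) e2 (esym b2)).
Qed.

(** The empty disc through x and y has radius at least half their distance, hence at least rho; a
    homothety with centre x shrinks it to radius rho inside itself. *)
Lemma adjp_empty_disc S x y rho : adjp S x y -> 0 < rho -> 4 * rho ^+ 2 <= d2 x y ->
  exists c, d2 c x = rho ^+ 2 /\ forall w, S w -> rho ^+ 2 <= d2 c w.
Proof.
move=> axy r0 rho_le; have [z [Ez Hz]] := adjp_disc axy.
have Hz' w : S w -> d2 z x <= d2 z w.
  move=> Sw; case: (pselect (w = x)) => [-> //|nx]; case: (pselect (w = y)) => [->|ny]; first by rewrite Ez.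
  by apply: ltW; apply: Hz.
have rD : rho ^+ 2 <= d2 z x.
  have : d2 x y <= 2 * d2 z x + 2 * d2 z y.
    rewrite /d2 -subr_ge0.
    have -> : 2 * ((z.1 - x.1) ^+ 2 + (z.2 - x.2) ^+ 2) + 2 * ((z.1 - y.1) ^+ 2 + (z.2 - y.2) ^+ 2) -
      ((x.1 - y.1) ^+ 2 + (x.2 - y.2) ^+ 2) = (2 * z.1 - x.1 - y.1) ^+ 2 + (2 * z.2 - x.2 - y.2) ^+ 2 by ring.
    by rewrite addr_ge0 ?sqr_ge0.
  by rewrite -Ez; lra.
have D0 : 0 < d2 z x by apply: lt_le_trans rD; rewrite exprn_gt0.
pose r := Num.sqrt (d2 z x).
have r0' : 0 < r by rewrite sqrtr_gt0.
have rr : r ^+ 2 = d2 z x by rewrite sqr_sqrtr ?d2_ge0.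
pose l := rho / r.
have l0 : 0 <= l by rewrite divr_ge0 // ltW.
have lr : rho <= r by rewrite -(@ler_pXn2r _ 2) ?nnegrE ?rr // ltW.
have l1 : l <= 1 by rewrite ler_pdivrMr ?mul1r.
have lD : l ^+ 2 * d2 z x = rho ^+ 2.
  by rewrite -rr /l -exprMn divfK // gt_eqF.
exists (x.1 + l * (z.1 - x.1), x.2 + l * (z.2 - x.2)); split.
  by rewrite -lD /d2 /=; ring.
move=> w Sw; rewrite -lD -subr_ge0.
(* The power of w for the shrunk disc is a convex combination of its powers for the point x and for
   the large disc. *)
have -> : d2 (x.1 + l * (z.1 - x.1), x.2 + l * (z.2 - x.2)) w - l ^+ 2 * d2 z x =
   (1 - l) * d2 w x + l * (d2 z w - d2 z x) by rewrite /d2 /=; ring.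
by rewrite addr_ge0 // mulr_ge0 ?d2_ge0 ?subr_ge0 // Hz'.
Qed.
End Delaunay.

(** * Planarity of the Delaunay graph *)

Section PlanarDelaunay.
Local Open Scope classical_set_scope.
Local Open Scope ring_scope.
Variables (R : realType) (S : set (pt2 R)) (C : {fset (pt2 R)}).
Let X (v : C) : R := (val v).1.
Let Y (v : C) : R := (val v).2.
Definition adjb : rel C := fun p q => `[< adjp S (val p) (val q) >].

Lemma adjb_sym : symmetric adjb.
Proof. by move=> p q; apply/asboolP/asboolP; apply: adjpC. Qed.

(** The form is the difference of the powers with respect to the empty discs of the two edges, with
    the radical axis as its zero set. The power for its own disc vanishes at the ends of an edge;
    the other power is nonnegative on S. *)
Lemma adjb_planar : planar X Y adjb.
Proof.
move=> p r a b /asboolP pr /asboolP ab n n'.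
have [z [Ez Hz]] := adjp_disc pr; have [w [Ew Hw]] := adjp_disc ab.
have [Sp Sr] := adjp_mem pr; have [Sa Sb] := adjp_mem ab.
exists (2 * (w.1 - z.1)), (2 * (w.2 - z.2)),
  (z.1 ^+ 2 + z.2 ^+ 2 - w.1 ^+ 2 - w.2 ^+ 2 - d2 z (val p) + d2 w (val a)) => f.
have Ef v : f v = (d2 z (val v) - d2 z (val p)) - (d2 w (val v) - d2 w (val a)).
  by rewrite /f /X /Y /d2; ring.
have Lz (v : C) : S (val v) -> v != p -> v != r -> 0 < d2 z (val v) - d2 z (val p).
  by move=> Sv vp vr; rewrite subr_gt0; apply: Hz => //; apply/eqP.
have Lw (v : C) : S (val v) -> v != a -> v != b -> 0 < d2 w (val v) - d2 w (val a).
  by move=> Sv vp vr; rewrite subr_gt0; apply: Hw => //; apply/eqP.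
have Lz' (v : C) : S (val v) -> 0 <= d2 z (val v) - d2 z (val p).
  move=> Sv; case: (eqVneq v p) => [->|vp]; first by rewrite subrr.
  by case: (eqVneq v r) => [->|vr]; [rewrite Ez subrr|apply/ltW/Lz].
have Lw' (v : C) : S (val v) -> 0 <= d2 w (val v) - d2 w (val a).
  move=> Sv; case: (eqVneq v a) => [->|vp]; first by rewrite subrr.
  by case: (eqVneq v b) => [->|vr]; [rewrite Ew subrr|apply/ltW/Lw].
have Zr : d2 z (val r) - d2 z (val p) = 0 by rewrite Ez subrr.
have Zb : d2 w (val b) - d2 w (val a) = 0 by rewrite Ew subrr.
rewrite !Ef Zr Zb !subrr !sub0r !subr0 !oppr_le0.
split; split; rewrite ?oppr_lt0; auto.
Qed.
End PlanarDelaunay.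

Lemma card_fset_finType (K : choiceType) (C : {fset K}) : #|` C| = #|fset_sub_type C : finType|.
Proof. by rewrite cardfE; apply: eq_card. Qed.

(** * Degree sums in finite parts of the Delaunay graph *)

Section DegreeSums.
Variables (R : realType) (S : set (pt2 R)).
Local Notation pt := (pt2 R).
Implicit Types (A B C : {fset pt}).

Definition adjnat (a b : pt) : nat := `[< adjp S a b >].
Definition deg B a := (\sum_(b <- B) adjnat a b)%N.
Definition arcs A B := (\sum_(a <- A) deg B a)%N.

Definition distinctX C := forall a b, a \in C -> b \in C -> a.1 = b.1 -> a = b.

Section Fixed.
Variable C : {fset pt}.
Hypothesis dX : distinctX C.
Let X (v : C) : R := (val v).1.
Let Y (v : C) : R := (val v).2.
Let adj : rel C := @adjb R S C.

Lemma Xinj : injective X.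
Proof. by move=> a b E; apply: val_inj; apply: dX => //; apply: valP. Qed.

Let adjC : symmetric adj := @adjb_sym R S C.

Lemma arcs_edges : arcs C C = (2 * #|edges X adj|)%N.
Proof.
rewrite /arcs big_seq_fsetE /=.
under eq_bigr => a _ do rewrite /deg big_seq_fsetE /=.
rewrite pair_big /= mul2n -addnn.
have -> : (\sum_(p : C * C) adjnat (fsval p.1) (fsval p.2))%N = #|[set e : C * C | adj e.1 e.2]|.
  by rewrite -sum1_card [RHS]big_mkcond /=; apply: eq_bigr => e _; rewrite inE /adj /adjb /adjnat; case: `[< _ >].
rewrite -(cardsID (edges X adj)).
have -> : [set e : C * C | adj e.1 e.2] :&: edges X adj = edges X adj.
  by apply/setP => e; rewrite !inE /edge; case: (adj _ _).
congr addn.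
pose sw (e : C * C) := (e.2, e.1).
have swK : involutive sw by case.
rewrite -[RHS](card_imset _ (inv_inj swK)).
apply: eq_card => -[a b]; rewrite !inE /edge /=.
apply/idP/imsetP => [/andP[]|[[u v]]].
  rewrite negb_and => /orP[/negbTE->//|]; rewrite -leNgt => ba ab.
  exists (b, a) => //; rewrite inE /edge /= adjC ab /= lt_neqAle ba andbT.
  apply/eqP => /Xinj E; subst b.
  by move/asboolP: ab => -[].
by rewrite inE /edge /= => /andP[uv l] [-> ->]; rewrite adjC uv /= -leNgt ltW.
Qed.

Lemma arcs_le : (arcs C C <= 6 * #|` C|)%N.
Proof.
have H : (#|edges X adj| <= 3 * #|` C|)%N.
  rewrite card_fset_finType.
  apply: leq_trans (card_edges_defects Xinj adjC (@adjb_planar R S C)).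
  by rewrite -!addnA leq_addr.
by rewrite arcs_edges; lia.
Qed.

Lemma arcs_near N (near : rel C) : (forall v, (#|[set c | near c v]| <= N)%N) ->
  (forall c, exists2 v, near c v & bad X Y adj v) ->
  (N * arcs C C + 2 * #|` C| <= 6 * N * #|` C|)%N.
Proof.
move=> h1 h2.
have H : (N * #|edges X adj| + #|` C| <= 3 * N * #|` C|)%N.
  rewrite card_fset_finType.
  exact: (card_edges_near Xinj adjC (@adjb_planar R S C) h1 h2).
by rewrite arcs_edges; nia.
Qed.

Definition supd (a b : pt) : R := Num.max `|a.1 - b.1| `|a.2 - b.2|.

Lemma supd_le a b r : supd a b <= r <-> `|a.1 - b.1| <= r /\ `|a.2 - b.2| <= r.
Proof. by rewrite /supd ge_max; split=> [/andP|/andP]. Qed.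

Lemma sqr_lt (t L : R) : 0 < L -> t ^+ 2 < L ^+ 2 -> `|t| < L.
Proof. by move=> L0 H; rewrite -(@ltr_pXn2r _ 2) ?nnegrE ?normr_ge0 ?real_normK ?num_real // ltW. Qed.

Lemma d2_sup a b (L : R) : 0 < L -> d2 a b < L ^+ 2 -> `|a.1 - b.1| < L /\ `|a.2 - b.2| < L.
Proof.
move=> L0 H; split; apply: sqr_lt => //; apply: le_lt_trans H; rewrite /d2 ?lerDl ?lerDr sqr_ge0 //.
Qed.

Lemma defect_near (L La : R) (c : C) (y0 : R) : 0 < L ->
  (forall a b : C, adj a b -> d2 (val a) (val b) < L ^+ 2) ->
  (val c).2 + L <= y0 <= (val c).2 + La ->
  forall de, 0 < de -> (forall x0, (val c).1 < x0 < (val c).1 + de -> forall p q r : C,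
     adj p q -> adj q r -> adj p r -> ~ tri X Y p q r x0 y0) ->
  exists2 v, supd (val c) (val v) <= La + 4 * L & bad X Y adj v.
Proof.
move=> L0 short y0c de de0 blk.
have sh a b : adj a b -> `|X a - X b| < L /\ `|Y a - Y b| < L.
  by move=> /short; apply: d2_sup.
have [v h1 b] := bad_near Xinj adjC (@adjb_planar R S C) L0 sh y0c de0 blk.
by exists v => //; apply/supd_le.
Qed.
End Fixed.

(** With D the complement of C in C', planarity gives arcs C C + 2 arcs C D <= 6 |C'|, and the
    degrees give arcs C C + arcs C D >= 6 |C|. Eliminating arcs C D leaves 12 |C| - arcs C C <= 6
    |C'|, so a saving in arcs C C becomes growth. *)
Lemma arcs_growth N C C' : distinctX C' -> (C `<=` C')%fset ->
  (forall c, c \in C -> (6 <= deg C' c)%N) ->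
  (N * arcs C C + 2 * #|` C| <= 6 * N * #|` C|)%N ->
  ((3 * N + 1) * #|` C| <= 3 * N * #|` C'|)%N.
Proof.
move=> dX sub d6 near.
have E0 : (arcs C' C' = arcs C C' + arcs (C' `\` C)%fset C')%N.
  rewrite /arcs -big_cat /=; apply: perm_big; rewrite uniq_perm ?fset_uniq //.
    rewrite cat_uniq !fset_uniq andbT /=; apply/hasPn => x; rewrite !inE => /andP[/negbTE -> //].
  by move=> x; rewrite mem_cat !inE; case: (boolP (x \in C)) => [/(fsubsetP sub) ->|].
have E1 A : (arcs A C' = arcs A C + arcs A (C' `\` C)%fset)%N.
  rewrite /arcs -big_split /=; apply: eq_bigr => a _.
  rewrite /deg -big_cat /=; apply: perm_big; rewrite uniq_perm ?fset_uniq //.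
    rewrite cat_uniq !fset_uniq andbT /=; apply/hasPn => x; rewrite !inE => /andP[/negbTE -> //].
  by move=> x; rewrite mem_cat !inE; case: (boolP (x \in C)) => [/(fsubsetP sub) ->|].
have E2 A B : arcs A B = arcs B A.
  rewrite /arcs /deg exchange_big /=; apply: eq_bigr => b _; apply: eq_bigr => a _.
  by congr nat_of_bool; apply/asboolP/asboolP; apply: adjpC.
have L1 : (6 * #|` C| <= arcs C C')%N.
  rewrite /arcs -sum1_size big_distrr /= big_seq [leqRHS]big_seq.
  by apply: leq_sum => c cC; rewrite muln1 d6.
have L2 := arcs_le dX.
have := E1 C; have := E1 (C' `\` C)%fset; rewrite (E2 _ C).
nia.
Qed.
End DegreeSums.

Local Open Scope classical_set_scope.
Local Open Scope ring_scope.

(** * Blocking configurations *)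

Section Cells.
Variable R : realType.
Local Notation pt := (pt2 R).
Implicit Types (o c p : pt) (t : R) (ij : int * int).

Definition cell o t ij : set pt :=
  [set p | o.1 + ij.1%:~R * t <= p.1 < o.1 + (ij.1 + 1)%:~R * t /\
           o.2 + ij.2%:~R * t <= p.2 < o.2 + (ij.2 + 1)%:~R * t].
Definition idx o t p : int * int :=
  (Num.floor ((p.1 - o.1) / t), Num.floor ((p.2 - o.2) / t)).
Definition inr (n : nat) (i : int) := - n%:Z <= i < n%:Z.
Definition inr2 n ij := inr n ij.1 && inr n ij.2.
(** The centre and four corners; with half-open cells, index -15 is the mirror image of index 14. *)
Definition five : seq (int * int) :=
  [:: (0, 0); (14, 14); (-15, 14); (14, -15); (-15, -15)].

Lemma cellP_idx o t ij p : 0 < t -> cell o t ij p <-> idx o t p = ij.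
Proof.
move=> t0; case: ij => i j; rewrite /cell /idx /=.
have E (a b : R) (k : int) : (Num.floor ((a - b) / t) == k) = (b + k%:~R * t <= a < b + (k + 1)%:~R * t).
  by rewrite floor_eq ler_pdivlMr // ltr_pdivrMr // lerBrDl ltrBlDl.
rewrite -!E; split=> [[/eqP-> /eqP->] //|[-> ->]]; by rewrite !eqxx.
Qed.

Lemma mem_cell o t p : 0 < t -> cell o t (idx o t p) p.
Proof. by move=> t0; apply/cellP_idx. Qed.

Lemma inr_floor n (u t : R) : 0 < t -> inr n (Num.floor (u / t)) = (- (n%:R * t) <= u < n%:R * t).
Proof.
move=> t0; rewrite /inr floor_ge_int floor_lt_int ler_pdivlMr // ltr_pdivrMr //.
by rewrite intrN mulNr.
Qed.

Lemma inr2_idx n o t p : 0 < t -> inr2 n (idx o t p) =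
  (- (n%:R * t) <= p.1 - o.1 < n%:R * t) && (- (n%:R * t) <= p.2 - o.2 < n%:R * t).
Proof. by move=> t0; rewrite /inr2 /= !inr_floor. Qed.

Lemma cell_dist o t ij p q : 0 < t -> cell o t ij p -> cell o t ij q ->
  `|p.1 - q.1| < t /\ `|p.2 - q.2| < t.
Proof.
by move=> t0 [/andP[a1 a2] /andP[a3 a4]] [/andP[b1 b2] /andP[b3 b4]];
  rewrite !intrD !mulrDl !mul1r in a2 a4 b2 b4; rewrite !ltr_norml; lra.
Qed.

Lemma d2_lt (p q : pt) (a b : R) : `|p.1 - q.1| <= a -> `|p.2 - q.2| <= b -> d2 p q <= a ^+ 2 + b ^+ 2.
Proof.
move=> h1 h2; rewrite /d2 -[_ ^+ 2 + _](congr2 +%R (real_normK (num_real _)) (real_normK (num_real _))).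
by apply: lerD; rewrite ler_pXn2r ?nnegrE ?normr_ge0 //; apply: le_trans (normr_ge0 _) _; eassumption.
Qed.

(* isolates the point of the central box: its short Delaunay edges can only lead to the points of
   the four corner boxes of [five], because the other boxes leave no room for larger empty discs
   at any scale up to 2^K *)
Definition Theta (K : nat) o (S : set pt) :=
  [/\ forall c : int * int, c \in five -> card_eq (S `&` cell o 1 c) 1,
      forall c : int * int, inr2 39 c -> c \notin five -> card_eq (S `&` cell o 1 c) 0,
      forall c : int * int, inr2 60 c -> ~~ inr2 39 c -> S `&` cell o 1 c !=set0 &
      forall k (c : int * int), (0 < k <= K)%N -> inr2 60 c -> ~~ inr2 30 c ->
        S `&` cell o (2 ^+ k) c !=set0].

Lemma supd_lt (a b : pt) r : supd a b < r <-> `|a.1 - b.1| < r /\ `|a.2 - b.2| < r.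
Proof. by rewrite /supd gt_max; split=> [/andP|/andP]. Qed.

Lemma inr2_near n o p t : 0 < t -> supd p o < n%:R * t -> inr2 n (idx o t p).
Proof.
move=> t0 /supd_lt[]; rewrite !ltr_norml inr2_idx // => /andP[a b] /andP[c d].
by rewrite b d !ltW.
Qed.

Lemma inr2_far n o p t : 0 < t -> ~~ inr2 n (idx o t p) -> n%:R * t <= supd p o.
Proof. by move=> t0; rewrite leNgt; apply: contra; apply: inr2_near. Qed.

(** For the least k with c in the square of radius 60 2^k, the point c lies in the occupied ring of
    scale k. Since 60 2^(k-1) <= 4 rho + 1, the boxes of that ring are small compared with rho. *)
Lemma theta_far K o S c (rho : R) : Theta K o S -> 19 <= rho ->
  supd c o <= 4 * rho + 1 -> ~~ inr2 60 (idx o 1 c) -> supd c o < 60 * 2 ^+ K ->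
  exists2 w, S w & d2 c w < rho ^+ 2.
Proof.
move=> [_ _ _ f4] rho19 m1 nr m2.
have t0 k : 0 < 2 ^+ k :> R by rewrite exprn_gt0.
have exP : exists k, inr2 60 (idx o (2 ^+ k) c).
  by exists K; apply: inr2_near.
case: (ex_minnP exP) => k Pk min_k.
have k0 : (0 < k)%N.
  by rewrite lt0n; apply/eqP => k0; move: Pk nr; rewrite k0 expr0 => ->.
have kK : (k <= K)%N by apply: min_k; apply: inr2_near.
have nk : ~~ inr2 60 (idx o (2 ^+ k.-1) c).
  by apply/negP => /min_k; rewrite -ltnS prednK // ltnn.
have mk := inr2_far (t0 _) nk.
have Ek : 2 ^+ k = 2 * 2 ^+ k.-1 :> R by rewrite -exprS prednK.
have nk' : ~~ inr2 30 (idx o (2 ^+ k) c).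
  move: nk; rewrite !inr2_idx // Ek.
  by have -> : 30%:R * (2 * 2 ^+ k.-1) = 60%:R * 2 ^+ k.-1 :> R by ring.
have [|w [Sw cw]] := f4 k _ _ Pk nk'; first by rewrite k0.
have [e1 e2] := cell_dist (t0 k) (mem_cell o c (t0 k)) cw.
exists w => //; apply: le_lt_trans (d2_lt (ltW e1) (ltW e2)) _.
rewrite Ek; move: (t0 k.-1) mk; move: (2 ^+ k.-1) (supd c o) m1 => u s m1 u0 mk.
have h : 14 * u <= rho by lra.
nra.
Qed.

Lemma card_eq1P (A : set pt) : card_eq A 1 -> exists2 a, A a & forall b, A b -> b = a.
Proof.
case=> -[|a [|? ?]] [_ // _ ->]; exists a; first by rewrite /= inE.
by move=> b; rewrite /= inE => /eqP.
Qed.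

Lemma card_eq_set0 (A : set pt) : card_eq A 0 <-> A = set0.
Proof.
split; first by case=> -[|? ?] [_ // _ ->]; apply/seteqP; split.
by move=> ->; exists [::]; split=> //; apply/seteqP; split.
Qed.

Definition corner (u : R) : int := if 0 <= u then 14 else -15.

Lemma corner_near (u x : R) : `|u| <= 25 -> (corner u)%:~R <= x < (corner u + 1)%:~R ->
  `|u - x| <= 15 /\ (12 < `|u| -> `|u - x| <= 11).
Proof.
rewrite /corner !intrD !ler_norml lter_normr => /andP[u1 u2].
have E : (-15)%:~R = - 15 :> R by rewrite intrN.
have [u0|u0] := lerP 0 u; rewrite ?E => /andP[x1 x2]; (split; first lra).
  by move=> /orP[] h; lra.
by move=> /orP[] h; lra.
Qed.

(** Within 12 of the centre the central box is at most 13 away in each coordinate; otherwise the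
    corner on the same side is at most 15 away in one coordinate and 11 in the other. Both 13^2 +
    13^2 and 15^2 + 11^2 are below 361 = 19^2, which is the origin of the radius 19. *)
Lemma five_cover o c : supd c o <= 25 -> exists2 ij : int * int, ij \in five &
  forall w, cell o 1 ij w -> d2 c w < 361.
Proof.
move=> /supd_le[h1 h2].
pose u := c.1 - o.1; pose v := c.2 - o.2.
have fin ij (a b : R) : a ^+ 2 + b ^+ 2 < 361 ->
   (forall w, cell o 1 ij w -> `|u - (w.1 - o.1)| <= a /\ `|v - (w.2 - o.2)| <= b) ->
   forall w, cell o 1 ij w -> d2 c w < 361.
  move=> ab H w /H[e1 e2]; apply: le_lt_trans ab; apply: d2_lt.
    by apply: le_trans e1; rewrite /u opprB addrA subrK.
  by apply: le_trans e2; rewrite /v opprB addrA subrK.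
have rel ij w : cell o 1 ij w -> ij.1%:~R <= w.1 - o.1 < (ij.1 + 1)%:~R /\ ij.2%:~R <= w.2 - o.2 < (ij.2 + 1)%:~R.
  by rewrite /cell /= !mulr1 => -[/andP[a1 a2] /andP[b1 b2]]; rewrite !lerBrDl !ltrBlDl a1 a2 b1 b2.
have c5 : (corner u, corner v) \in five.
  by rewrite /corner !inE; case: ifP => _; case: ifP.
have [hu|hu] := lerP `|u| 12; first have [hv|hv] := lerP `|v| 12.
- exists (0, 0); rewrite ?inE //; apply: (fin _ 13 13); first lra.
  move=> w /rel /= [/andP[a1 a2] /andP[b1 b2]]; move: hu hv a1 a2 b1 b2.
  by rewrite !ler_norml => /andP[p1 p2] /andP[p3 p4] a1 a2 b1 b2; split; lra.
- exists (corner u, corner v) => //; apply: (fin _ 15 11); first lra.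
  move=> w /rel /= [a b]; split; first by case: (corner_near h1 a).
  by case: (corner_near h2 b) => _; apply.
- exists (corner u, corner v) => //; apply: (fin _ 11 15); first lra.
  move=> w /rel /= [a b]; split; last by case: (corner_near h2 b).
  by case: (corner_near h1 a) => _; apply.
Qed.

(** Moves a coordinate into the ring of occupied unit boxes. The shift 14 = 39 - 25 points outwards;
    the shift by 1 inwards avoids leaving the half-open square of radius 60. *)
Lemma push (u : R) : 25 < `|u| <= 60 -> exists e : R, `|e| <= 14 /\ ((- 39 <= u + e < 39) = false) /\ - 60 <= u + e < 60.
Proof.
rewrite lter_normr => /andP[/orP[] h]; rewrite ler_norml => /andP[h1 h2].
  by exists (if u < 40 then 14 else -1); case: ifP => [|/negbT]; rewrite -?leNgt => h3;
    (split; [rewrite ler_norml; lra|split; [by apply/negP => /andP[]; lra|lra]]).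
by exists (if u < -40 then 1 else -14); case: ifP => [|/negbT]; rewrite -?leNgt => h3;
    (split; [rewrite ler_norml; lra|split; [by apply/negP => /andP[]; lra|lra]]).
Qed.

Lemma theta_near K o S c : Theta K o S -> inr2 60 (idx o 1 c) ->
  exists2 w, S w & d2 c w < 361.
Proof.
move=> [f1 f2 f3 f4] nr.
have lt01 : 0 < 1 :> R by [].
have [c25|] := lerP (supd c o) 25.
  have [ij ij5 H] := five_cover c25.
  have [w [Sw cw] _] := card_eq1P (f1 _ ij5).
  by exists w => //; apply: H.
rewrite /supd lt_max => far.
suff [c' [h1 h2 h3]] : exists c', [/\ `|c.1 - c'.1| + `|c.2 - c'.2| <= 14, inr2 60 (idx o 1 c') & ~~ inr2 39 (idx o 1 c')].
  have [w [Sw cw]] := f3 _ h2 h3; exists w => //.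
  have [e1 e2] := cell_dist lt01 (mem_cell o c' lt01) cw.
  have E1 : `|c.1 - w.1| <= `|c.1 - c'.1| + 1 by apply: near_trans (lexx _) (ltW e1).
  have E2 : `|c.2 - w.2| <= `|c.2 - c'.2| + 1 by apply: near_trans (lexx _) (ltW e2).
  apply: le_lt_trans (d2_lt E1 E2) _.
  have n1 := normr_ge0 (c.1 - c'.1); have n2 := normr_ge0 (c.2 - c'.2).
  move: h1 n1 n2; move: `|c.1 - c'.1| `|c.2 - c'.2| => a b; nra.
move: nr; rewrite inr2_idx // !mulr1 => /andP[/andP[a1 a2] /andP[b1 b2]].
have n60 (x : R) : - 60%:R <= x -> x < 60%:R -> `|x| <= 60 by move=> *; rewrite ler_norml; lra.
case/orP: far => far.
  have [|e [e1 [e2 e3]]] := @push (c.1 - o.1); first by rewrite far n60.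
  exists (c.1 + e, c.2); rewrite !inr2_idx //= !mulr1 (addrAC c.1) e2 subrr normr0 addr0.
  by rewrite opprD addrA subrr sub0r normrN e3 b1 b2.
have [|e [e1 [e2 e3]]] := @push (c.2 - o.2); first by rewrite far n60.
exists (c.1, c.2 + e); rewrite !inr2_idx //= !mulr1 (addrAC c.2) e2 subrr normr0 add0r andbF.
by rewrite opprD addrA subrr sub0r normrN e3 a1 a2.
Qed.

Lemma theta_disc K o S c (rho : R) : Theta K o S -> 19 <= rho ->
  supd c o <= 4 * rho + 1 -> supd c o < 60 * 2 ^+ K -> exists2 w, S w & d2 c w < rho ^+ 2.
Proof.
move=> th r19 h1 h2; have [nr|nr] := boolP (inr2 60 (idx o 1 c)); last exact: theta_far nr h2.
have [w Sw dw] := theta_near th nr; exists w => //; apply: lt_le_trans dw _; nra.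
Qed.
End Cells.

Definition opposite (i j : int * int) :=
  let L := [:: ((14, 14), (-15, -15)); ((-15, 14), (14, -15))] : seq ((int * int) * (int * int)) in
  ((i, j) \in L) || ((j, i) \in L).

(** Four corners form two diagonals, so three distinct corners contain a diagonal. *)
Lemma corner_pigeonhole i j k : i \in behead five -> j \in behead five -> k \in behead five ->
  i != j -> i != k -> j != k -> [|| opposite i j, opposite i k | opposite j k].
Proof.
pose P i j k := [&& i != j, i != k & j != k] ==> [|| opposite i j, opposite i k | opposite j k].
have H : all (fun i => all (fun j => all (P i j) (behead five)) (behead five)) (behead five) by vm_compute.
move=> hi hj hk n1 n2 n3; have := allP (allP (allP H _ hi) _ hj) _ hk.
by rewrite /P n1 n2 n3.
Qed.

(** * Cores, and triangles over the centre of a blocking configuration *)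

Section Block.
Variable R : realType.
Local Notation pt := (pt2 R).
Implicit Types (S : set pt) (o c p q r z : pt).

Fixpoint core S k : set pt := if k is k'.+1 then
  [set x | core S k' x /\ exists s : seq pt, [/\ uniq s, size s = 6%N &
     forall y, y \in s -> core S k' y /\ adjp S x y]] else S.

Lemma core_decr S k l : (k <= l)%N -> core S l `<=` core S k.
Proof.
move=> /subnK <-; elim: (l - k)%N => [//|n IH] x; rewrite addSn => -[/IH].
exact.
Qed.
Lemma core_sub S k : core S k `<=` S. Proof. exact: (@core_decr S 0 k (leq0n k)). Qed.

Variables (K : nat) (o : pt) (S : set pt).
Hypothesis th : Theta K o S.
Hypothesis K_gt0 : (0 < K)%N.

Lemma supd_tri a b c (x y : R) : supd a b <= x -> supd b c <= y -> supd a c <= x + y.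
Proof.
by move=> /supd_le[h1 h2] /supd_le[h3 h4]; apply/supd_le; split; [exact: near_trans h1 h3|exact: near_trans h2 h4].
Qed.

Lemma sqr_le (t L : R) : 0 <= L -> t ^+ 2 <= L ^+ 2 -> `|t| <= L.
Proof. by move=> L0 H; rewrite -(@ler_pXn2r _ 2) ?nnegrE ?normr_ge0 ?real_normK ?num_real. Qed.

Lemma d2_supd_le a b (L : R) : 0 <= L -> d2 a b <= L ^+ 2 -> supd a b <= L.
Proof.
move=> L0 H; apply/supd_le; split; apply: sqr_le => //; apply: le_trans H; rewrite /d2 ?lerDl ?lerDr sqr_ge0 //.
Qed.

Lemma two_pow_ge2 : 2 <= 2 ^+ K :> R.
Proof. by rewrite -(prednK K_gt0) exprS ler_peMr // exprn_ege1 // ler1n. Qed.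

(** Such an edge carries an empty disc of radius rho through u, centred within 4 rho + 1 of o, and
    [theta_disc] finds a point of S in it. For rho = 19 this bounds the edges near o by 38. *)
Lemma theta_long_edge u v (rho : R) : adjp S u v -> 19 <= rho -> 4 * rho ^+ 2 <= d2 u v ->
  supd u o <= 3 * rho + 1 -> 4 * rho + 1 < 60 * 2 ^+ K -> False.
Proof.
move=> a r19 dl h hK; have r0 : 0 < rho by lra.
have [c [dc Hc]] := adjp_empty_disc a r0 dl.
have h1 : supd c o <= 4 * rho + 1.
  have h2 : supd c u <= rho by apply: d2_supd_le; [lra|rewrite dc].
  by have h3 := supd_tri h2 h; apply: le_trans h3 _; lra.
have [w Sw] := theta_disc th r19 h1 (le_lt_trans h1 hK).
by rewrite ltNge Hc.
Qed.

Lemma cell0_supd ij p : cell o 1 ij p -> ij = (0, 0) -> supd p o <= 1.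
Proof.
move=> cp E; move: cp; rewrite E /cell /= => -[/andP[a1 a2] /andP[b1 b2]].
rewrite !add0r !mulr1 mulr0z !addr0 mulr1z in a1 a2 b1 b2.
by apply/supd_le; rewrite !ler_norml; lra.
Qed.

Lemma hole_five p : S p -> `|p.1 - o.1| < 39 -> `|p.2 - o.2| < 39 -> idx o 1 p \in five.
Proof.
move=> Sp h1 h2; case: th => _ f2 _ _.
apply/negPn/negP => n5.
have : inr2 39 (idx o 1 p).
  by apply: inr2_near => //; rewrite mulr1; apply/supd_lt.
move=> /f2 /(_ n5) /card_eq_set0; apply/eqP/set0P; exists p; split=> //.
exact: mem_cell.
Qed.

Lemma five_uniq p q : S p -> S q -> idx o 1 p \in five -> idx o 1 p = idx o 1 q -> p = q.
Proof.
case: th => f1 _ _ _ Sp Sq /f1 /card_eq1P[w _ Hw] E.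
have cp : cell o 1 (idx o 1 p) p by exact: mem_cell.
have cq : cell o 1 (idx o 1 p) q by rewrite E; exact: mem_cell.
by rewrite (Hw p (conj Sp cp)) (Hw q (conj Sq cq)).
Qed.

(** Edges at the centre are shorter than 38 and so end in the hole of radius 39, which contains only
    the five points. *)
Lemma center_nbrs q y : cell o 1 (0, 0) q -> adjp S q y -> idx o 1 y \in behead five.
Proof.
move=> cq a; have [Sq Sy] := adjp_mem a.
have q1 := cell0_supd cq erefl.
have K1 := two_pow_ge2.
have [far|near] := lerP (4 * 19 ^+ 2) (d2 q y).
  by case: (theta_long_edge a (lexx _) far); [apply: le_trans q1 _; lra| lra].
have n38 : d2 y q < 38 ^+ 2.
  by rewrite d2C; apply: lt_le_trans near _; lra.
have L38 : (0 : R) < 38 by [].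
have [h1 h2] := d2_sup L38 n38.
have [g1 g2] := (supd_le q o 1).1 q1.
have i5 : idx o 1 y \in five.
  apply: hole_five => //.
    by apply: le_lt_trans (ler_distD q.1 _ _) _; lra.
  by apply: le_lt_trans (ler_distD q.2 _ _) _; lra.
move: (i5); rewrite inE => /orP[/eqP E|//]; exfalso.
have Eq : idx o 1 q = (0, 0) by apply/(cellP_idx _ _ _ (@ltr01 R)).
case: (a) => nqy _; apply: nqy; symmetry; apply: five_uniq => //.
by rewrite E Eq.
Qed.

Lemma center_core q : cell o 1 (0, 0) q -> ~ core S 1 q.
Proof.
move=> cq [Sq [s [us s6 Hs]]].
have U : uniq (map (idx o 1) s).
  rewrite map_inj_in_uniq // => a b /Hs[Sa /(center_nbrs cq) ia] /Hs[Sb /(center_nbrs cq) ib].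
  by apply: five_uniq => //; rewrite inE ia orbT.
have : (size (map (idx o 1) s) <= size (behead five))%N.
  by apply: uniq_leq_size => // i /mapP[a /Hs[_ /(center_nbrs cq) ia] ->].
by rewrite size_map s6.
Qed.

(** Opposite corner boxes are 28 apart in both coordinates, and 28^2 + 28^2 = 1568 exceeds 38^2 =
    1444. *)
Lemma corner_far p q i j : idx o 1 p = i -> idx o 1 q = j ->
  (i, j) \in [:: ((14, 14), (-15, -15)); ((-15, 14), (14, -15))] -> 38 ^+ 2 < d2 p q.
Proof.
move=> /cellP_idx cp /cellP_idx cq.
have {}cp := cp ltr01; have {}cq := cq ltr01.
rewrite !inE => /orP[] /eqP[Ei Ej]; move: cp cq; rewrite Ei Ej /cell /= !intrD !mulr1 => -[/andP[a1 a2] /andP[a3 a4]] [/andP[b1 b2] /andP[b3 b4]].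
  have h1 : 28 <= p.1 - q.1 by lra.
  have h2 : 28 <= p.2 - q.2 by lra.
  by rewrite /d2; nra.
have h1 : 28 <= q.1 - p.1 by lra.
have h2 : 28 <= p.2 - q.2 by lra.
by rewrite /d2; nra.
Qed.

Definition intri p q r z := exists a b c : R, [/\ 0 <= a /\ 0 <= b, 0 <= c, a + b + c = 1,
  z.1 = a * p.1 + b * q.1 + c * r.1 & z.2 = a * p.2 + b * q.2 + c * r.2].

Lemma intri_rot p q r z : intri p q r z -> intri q r p z.
Proof.
move=> [a [b [c [[a0 b0] c0 s e1 e2]]]]; exists b, c, a; split=> //.
- by rewrite -s; ring.
- by rewrite e1; ring.
- by rewrite e2; ring.
Qed.

Lemma intri_swap p q r z : intri p q r z -> intri q p r z.
Proof.
move=> [a [b [c [[a0 b0] c0 s e1 e2]]]]; exists b, a, c; split=> //.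
- by rewrite -s; ring.
- by rewrite e1; ring.
- by rewrite e2; ring.
Qed.

Lemma intri_supd p q r z (t : R) : intri p q r z -> supd p q <= t -> supd p r <= t -> supd p z <= t.
Proof.
move=> [a [b [c [[a0 b0] c0 s e1 e2]]]] /supd_le[h1 h2] /supd_le[h3 h4].
by apply/supd_le; rewrite e1 e2; split; apply: tri_le.
Qed.

(** Apply the exclusion of long edges with rho half the longest side t; as the triangle contains z,
    the vertex p is within t + 1 of o. *)
Lemma blocked_long p q r z : intri p q r z -> supd z o <= 1 ->
  adjp S p q -> adjp S p r -> adjp S q r ->
  d2 p q <= (8 * 2 ^+ K) ^+ 2 -> d2 p r <= d2 p q -> d2 q r <= d2 p q -> 38 ^+ 2 <= d2 p q -> False.
Proof.
move=> tr zo apq apr aqr short m1 m2 long.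
have K1 := two_pow_ge2.
pose t := Num.sqrt (d2 p q).
have t2 : t ^+ 2 = d2 p q by rewrite sqr_sqrtr ?d2_ge0.
have t0 : 0 <= t by exact: sqrtr_ge0.
have t38 : 38 <= t by rewrite -(@ler_pXn2r _ 2) ?nnegrE ?t2.
have tK : t <= 8 * 2 ^+ K.
  by rewrite -(@ler_pXn2r _ 2) ?nnegrE ?t2 //; nra.
apply: (@theta_long_edge p q (t / 2)) => //; try lra.
have h1 : supd p z <= t by apply: (intri_supd tr); apply: d2_supd_le => //; rewrite t2.
by apply: le_trans (supd_tri h1 zo) _; lra.
Qed.

(** All vertices lie in the hole of radius 39. The central point is not in core 1, so they are three
    distinct corners, two of them opposite and therefore more than 38 apart. *)
Lemma blocked_short p q r z : intri p q r z -> cell o 1 (0, 0) z -> z.2 = o.2 ->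
  core S 1 p -> core S 1 q -> core S 1 r ->
  adjp S p q -> adjp S p r -> adjp S q r ->
  d2 p q < 38 ^+ 2 -> d2 p r < 38 ^+ 2 -> d2 q r < 38 ^+ 2 -> False.
Proof.
move=> tr cz z2 cp cq cr apq apr aqr hpq hpr hqr.
have L38 : (0 : R) < 38 by [].
have zo1 : 0 <= z.1 - o.1 < 1.
  by move: cz; rewrite /cell /= !add0r !mulr1 mulr0z mulr1z addr0 => -[]; lra.
have key u v w : intri u v w z -> S u -> d2 u v < 38 ^+ 2 -> d2 u w < 38 ^+ 2 -> core S 1 u -> idx o 1 u \in behead five.
  move=> tu Su /(d2_sup L38)[a1 a2] /(d2_sup L38)[b1 b2] cu.
  have [e1 e2] : `|u.1 - z.1| <= 38 /\ `|u.2 - z.2| <= 38.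
    by apply/supd_le; apply: (intri_supd tu); apply/supd_le; split; apply: ltW.
  rewrite !ler_norml in e1 e2.
  have i5 : idx o 1 u \in five.
    by apply: hole_five => //; rewrite ltr_norml ?z2 in e2 *; lra.
  move: (i5); rewrite inE => /orP[/eqP E|//]; exfalso.
  by case: (@center_core u) => //; apply/cellP_idx.
have Sp := core_sub cp; have Sq := core_sub cq; have Sr := core_sub cr.
have tq := intri_swap tr; have tr' := intri_rot (intri_rot tr).
have ip := key p q r tr Sp hpq hpr cp.
have iq : idx o 1 q \in behead five by apply: (key q p r) => //; rewrite d2C.
have ir : idx o 1 r \in behead five by apply: (key r p q) => //; rewrite d2C.
have nE u v : adjp S u v -> idx o 1 u \in behead five -> idx o 1 u != idx o 1 v.
  move=> a iu; apply/eqP => E; have [Su Sv] := adjp_mem a; case: a => n _; apply: n.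
  by apply: five_uniq => //; rewrite inE iu orbT.
have := corner_pigeonhole ip iq ir (nE _ _ apq ip) (nE _ _ apr ip) (nE _ _ aqr iq).
have far u v : opposite (idx o 1 u) (idx o 1 v) -> 38 ^+ 2 < d2 u v.
  by case/orP => h; [apply: corner_far h|rewrite d2C; apply: corner_far h].
by case/or3P => /far; rewrite ltNge ltW.
Qed.

Theorem theta_blocked p q r z : intri p q r z -> cell o 1 (0, 0) z -> z.2 = o.2 ->
  core S 1 p -> core S 1 q -> core S 1 r ->
  adjp S p q -> adjp S p r -> adjp S q r ->
  d2 p q <= (8 * 2 ^+ K) ^+ 2 -> d2 p r <= (8 * 2 ^+ K) ^+ 2 -> d2 q r <= (8 * 2 ^+ K) ^+ 2 -> False.
Proof.
move=> tr cz z2 cp cq cr apq apr aqr spq spr sqr.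
have zo := cell0_supd cz erefl.
have aqp := adjpC apq; have arp := adjpC apr; have arq := adjpC aqr.
have [h|h] := ltP (Num.max (d2 p q) (Num.max (d2 p r) (d2 q r))) (38 ^+ 2).
  by move: h; rewrite !gt_max => /and3P[]; exact: (blocked_short tr).
have [m|m] := leP (d2 p r) (d2 p q); have [m'|m'] := leP (d2 q r) (d2 p q).
- apply: (blocked_long tr zo) => //.
  by move: h; rewrite !le_max => /or3P[]//; move=> h; apply: le_trans h _.
- apply: (blocked_long (intri_rot tr) zo) => //; try (by rewrite d2C ltW); try (by rewrite d2C; apply: le_trans m (ltW m')).
  move: h; rewrite !le_max => /or3P[]// h; first by apply: le_trans h (ltW m').
  by apply: le_trans h _; apply: le_trans m (ltW m').
- apply: (blocked_long (intri_swap (intri_rot (intri_rot tr))) zo) => //; rewrite ?(d2C r q); [exact: ltW|exact: le_trans m' (ltW m)|].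
  move: h; rewrite !le_max => /or3P[]// h; first by apply: le_trans h (ltW m).
  by apply: le_trans h _; apply: le_trans m' (ltW m).
- have [m2|m2] := leP (d2 q r) (d2 p r).
    apply: (blocked_long (intri_swap (intri_rot (intri_rot tr))) zo) => //; rewrite ?(d2C r q) //; first exact: ltW.
    by move: h; rewrite !le_max => /or3P[]// h; [apply: le_trans h (ltW m)|apply: le_trans h m2].
  apply: (blocked_long (intri_rot tr) zo) => //; rewrite ?(d2C q p) ?(d2C r p); try exact: ltW.
  by move: h; rewrite !le_max => /or3P[]// h; [apply: le_trans h (ltW m')|apply: le_trans h (ltW m2)].
Qed.
End Block.

(** * Growth of iterated cores *)

Definition zrange (n : nat) : seq int := [seq i%:Z - n%:Z | i <- iota 0 (2 * n)].
Lemma mem_zrange n i : (i \in zrange n) = inr n i.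
Proof.
rewrite /inr; apply/mapP/idP => [[k]|h].
  by rewrite mem_iota => h ->; lia.
by exists (absz (i + n%:Z)); [rewrite mem_iota|]; lia.
Qed.
Lemma size_zrange n : size (zrange n) = (2 * n)%N.
Proof. by rewrite size_map size_iota. Qed.

Definition zsquare n : seq (int * int) := [seq (i, j) | i <- zrange n, j <- zrange n].
Lemma mem_zsquare n ij : (ij \in zsquare n) = inr2 n ij.
Proof.
case: ij => i j; rewrite /inr2 -!mem_zrange /=; apply/allpairsP/andP => [[[a b] /= [ha hb [-> ->]]]//|[ha hb]].
by exists (i, j).
Qed.
Lemma size_zsquare n : size (zsquare n) = ((2 * n) * (2 * n))%N.
Proof. by rewrite size_allpairs size_zrange. Qed.

Section Grow.
Variable R : realType.
Local Notation pt := (pt2 R).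
Implicit Types (S : set pt) (o c p q r z : pt).

Definition org : pt := (0, 0).
(* the i-th candidate block of the w-th window in the vertical strip at abscissa j *)
Definition site (K T : nat) (j w : int) (i : nat) : pt :=
  (j%:~R, w%:~R * (T * (120 * 2 ^ K))%:R + (i * (120 * 2 ^ K))%:R).

(** The first clause makes edges short, the second bounds the number of points in a region, the
    third provides a blocking configuration above every vertex. A is a radius in units of length,
    hence the range 2 A for boxes of side 1/2. *)
Definition Env (K T m A : nat) S :=
  [/\ forall ij : int * int, inr2 A ij -> S `&` cell org (2 ^+ K) ij !=set0,
      forall ij : int * int, inr2 (2 * A) ij ->
        exists2 k, (k < m)%N & card_eq (S `&` cell org (1 / 2) ij) k &
      forall j w : int, inr A j -> inr A w -> exists2 i, (i < T)%N & Theta K (site K T j w i) S].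

Variables (K T m A : nat) (S : set pt).
Hypothesis K_gt0 : (0 < K)%N.
Hypothesis T_gt0 : (0 < T)%N.
Hypothesis Slf : locally_finite S.
Hypothesis SX : forall a b, S a -> S b -> a.1 = b.1 -> a = b.
Hypothesis env : Env K T m A S.

Let L0 : R := 8 * 2 ^+ K.

(** A longer edge would carry an empty disc of radius 4 2^K, which contains the occupied box of side
    2^K around its centre. *)
Lemma short_edge u v : adjp S u v -> supd u org + L0 <= A%:R -> d2 u v < L0 ^+ 2.
Proof.
move=> a uA; rewrite ltNge; apply/negP => long.
have t0 : 0 < 2 ^+ K :> R by rewrite exprn_gt0.
have r0 : 0 < 4 * 2 ^+ K :> R by lra.
have [|c [dc Hc]] := adjp_empty_disc a r0; first by apply: le_trans long; rewrite /L0; nra.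
have h1 : supd c u <= 4 * 2 ^+ K by apply: d2_supd_le; [lra|rewrite dc].
have h2 := supd_tri h1 (lexx (supd u org)).
have A0 : (0 : R) <= A%:R by [].
have K1 : 1 <= 2 ^+ K :> R by rewrite exprn_ege1 // ler1n.
have h3 : supd c org < A%:R * 2 ^+ K.
  apply: le_lt_trans h2 _; apply: (@lt_le_trans _ _ A%:R); first by rewrite /L0 in uA; lra.
  by rewrite ler_peMr.
case: env => e1 _ _; have [w [Sw cw]] := e1 _ (inr2_near t0 h3).
have [g1 g2] := cell_dist t0 (mem_cell org c t0) cw.
have := d2_lt (ltW g1) (ltW g2); have := Hc w Sw.
by move: (2 ^+ K) t0 => t t0; nra.
Qed.

Lemma card_cells (F : {fset pt}) (I : seq (int * int)) : (forall p, p \in F -> S p) ->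
  (forall p, p \in F -> idx org (1 / 2) p \in I) -> {in I, forall ij, inr2 (2 * A) ij} ->
  (#|` F| <= size I * m)%N.
Proof.
move=> FS; elim: I F FS => [|ij I IH] F FS FI Ir.
  case: (fset_0Vmem F) => [->|[p /FI]]; last by rewrite in_nil.
  by rewrite cardfs0.
pose G := [fset p in F | idx org (1 / 2) p == ij]%fset.
have h2 : (0 : R) < 1 / 2 by lra.
have GF : (G `<=` F)%fset by apply/fsubsetP => p; rewrite !inE => /andP[].
have cG : (#|` G| <= m)%N.
  case: env => _ e2 _; have [k km [s [us sk Es]]] := e2 ij (Ir ij (mem_head _ _)).
  apply: leq_trans (ltnW km); rewrite -sk; apply: uniq_leq_size; first exact: fset_uniq.
  move=> p pG; have : [set x | x \in s] p; last by [].
  rewrite -Es; move: pG; rewrite !inE => /andP[/FS Sp /eqP E]; split=> //.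
  by rewrite -E; apply: mem_cell.
have cD : (#|` (F `\` G)%fset| <= size I * m)%N.
  apply: IH => [p|p|j jI].
  - by rewrite inE => /andP[_ /FS].
  - rewrite !inE => /andP[h pF]; have := FI p pF; rewrite inE => /orP[/eqP E|//].
    by move: h; rewrite pF E eqxx.
  - by apply: Ir; rewrite inE jI orbT.
rewrite -(cardfsID G F) (fsetIidPr GF) /= mulSn; exact: leq_add.
Qed.

Lemma card_square (F : {fset pt}) : (forall p, p \in F -> S p /\ supd p org < A%:R) ->
  (#|` F| <= (4 * A) ^ 2 * m)%N.
Proof.
move=> FS; have h2 : (0 : R) < 1 / 2 by lra.
have := @card_cells F (zsquare (2 * A)) (fun p pF => proj1 (FS p pF)).
have -> : size (zsquare (2 * A)) = ((4 * A) ^ 2)%N by rewrite size_zsquare -mulnn; lia.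
move=> H; apply: H.
  move=> p /FS[_ h]; rewrite mem_zsquare; apply: inr2_near => //.
  by apply: lt_le_trans h _; rewrite natrM; lra.
by move=> ij; rewrite mem_zsquare.
Qed.

Lemma card_ball (F : {fset pt}) v (D : nat) : (forall p, p \in F -> S p /\ supd p org < A%:R) ->
  (forall p, p \in F -> supd p v <= D%:R) -> (#|` F| <= (4 * D + 4) ^ 2 * m)%N.
Proof.
move=> FS FD; have h2 : (0 : R) < 1 / 2 by lra.
pose b := idx org (1 / 2) v.
(* Distance D spans 2 D boxes of side 1/2; the summand 2 absorbs the rounding and the half-open
   range. *)
pose n := (2 * D + 2)%N.
pose I := [seq ij <- [seq (k.1 + b.1, k.2 + b.2) | k <- zsquare n] | inr2 (2 * A) ij].
have sI : (size I <= (4 * D + 4) ^ 2)%N.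
  by rewrite size_filter; apply: leq_trans (count_size _ _) _; rewrite size_map size_zsquare /n -mulnn; lia.
apply: leq_trans (leq_mul sI (leqnn m)).
apply: card_cells; first by move=> p /FS[].
  move=> p pF; have [_ hA] := FS p pF; rewrite mem_filter; apply/andP; split.
    by apply: inr2_near => //; apply: lt_le_trans hA _; rewrite natrM; lra.
  apply/mapP; exists ((idx org (1 / 2) p).1 - b.1, (idx org (1 / 2) p).2 - b.2); last first.
    by rewrite /= !subrK.
  rewrite mem_zsquare /inr2 /inr /=.
  have key (x y : R) : `|x - y| <= D%:R ->
      - n%:Z <= Num.floor ((x - 0) / (1 / 2)) - Num.floor ((y - 0) / (1 / 2)) < n%:Z.
    rewrite ler_norml !subr0 => /andP[d1 d2'].
    have E t : t / (1 / 2) = 2 * t :> R by field.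
    rewrite !E.
    have /andP[a1 a2] := floor_itv (2 * x); have /andP[b1 b2] := floor_itv (2 * y).
    have En : n%:~R = 2 * D%:R + 2 :> R by rewrite -pmulrn natrD natrM.
    rewrite !intrD in a2 b2.
    rewrite -(ler_int R) -(ltr_int R) intrB intrN En.
    by apply/andP; split; lra.
  by have /supd_le[g1 g2] := FD p pF; rewrite !key.
by move=> ij; rewrite mem_filter => /andP[].
Qed.

Lemma mem_site_cell j w i (c : pt) (x0 : R) : Num.floor c.1 = j -> c.1 < x0 < (j + 1)%:~R ->
  cell (site K T j w i) 1 (0, 0) (x0, (site K T j w i).2).
Proof.
move=> <- /andP[h1 h2]; rewrite /cell /= !add0r !mulr1 mulr0z mulr1z !addr0 lexx ltrDl ltr01; split=> //.
rewrite intrD in h2; rewrite h2 andbT.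
by apply: le_trans (floor_le c.1) (ltW h1).
Qed.

Let H : nat := (T * (120 * 2 ^ K))%N.
(** The bound of [card_ball] at distance 4 H, within which [arcs_core] finds a bad vertex. *)
Definition nbhd_card : nat := ((4 * (4 * H) + 4) ^ 2 * m)%N.

Lemma L0_H : L0 <= H%:R.
Proof.
rewrite /L0 /H !natrM natrX.
have t0 : 0 < 2 ^+ K :> R by rewrite exprn_gt0.
have : (1 : R) <= T%:R by rewrite ler1n.
by move: (2 ^+ K) t0 (T%:R : R) => t t0 T' T1; nra.
Qed.

(** Over every c there is a blocking configuration at height between H and 3 H. Triangles of C do
    not meet its bottom side, so a bad vertex lies within 3 H + 4 L0 <= 4 H of c. *)
Lemma arcs_core (C : {fset pt}) : (forall p, p \in C -> core S 1 p) ->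
  (forall p, p \in C -> supd p org + L0 + 3 <= A%:R) ->
  (nbhd_card * arcs S C C + 2 * #|` C| <= 6 * nbhd_card * #|` C|)%N.
Proof.
move=> CS CA.
have L00 : 0 < L0 by rewrite /L0 mulr_gt0 // exprn_gt0.
have LH := L0_H.
have CSS p : p \in C -> S p by move=> /CS /core_sub.
have dX : distinctX C by move=> a b /CSS Sa /CSS Sb; apply: SX.
have CA' p : p \in C -> S p /\ supd p org < A%:R.
  by move=> pC; split; [exact: CSS|have := CA p pC; lra].
pose near (c v : C) := supd (val c) (val v) <= (4 * H)%:R.
apply: (@arcs_near R S C dX nbhd_card near).
  move=> v.
  pose F := [fset p in C | supd p (val v) <= (4 * H)%:R]%fset.
  apply: (@leq_trans #|` F|).
    rewrite cardE -(size_map val); apply: uniq_leq_size.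
      by rewrite map_inj_uniq ?enum_uniq //; exact: val_inj.
    move=> p /mapP[c]; rewrite mem_enum inE => h ->.
    by rewrite !inE; apply/andP; split; [exact: valP|exact: h].
  apply: (@card_ball F (val v)) => p; rewrite !inE => /andP[] //.
  by move=> /CA'.
move=> c; have cC : val c \in C by apply: valP.
(* The strip at j contains the vertical lines just right of c, and the shift by 2 keeps the window
   at least H above c. *)
pose j := Num.floor (val c).1; pose w := Num.floor ((val c).2 / H%:R) + 2.
have H0 : (0 : R) < H%:R by lra.
have cA := CA _ cC.
have /supd_lt[] : supd (val c) org < A%:R by lra.
rewrite !subr0 => c1 c2.
have jA : inr A j.
  rewrite /j -[(val c).1]divr1 inr_floor // mulr1.
  by rewrite ltr_norml in c1; case/andP: c1 => a b; rewrite b ltW.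
have H1 : 1 <= H%:R :> R by rewrite ler1n -(ltr_nat R).
have wA : inr A w.
  rewrite /inr /w -(ler_int R) -(ltr_int R) intrD intrN.
  have /andP[f1 f2] := floor_itv ((val c).2 / H%:R).
  rewrite intrD in f2.
  have g : `|(val c).2 / H%:R| <= A%:R - 3.
    rewrite normrM normfV (ger0_norm (ltW H0)) ler_pdivrMr //.
    have /supd_le[_ h2] : supd (val c) org <= A%:R - 3 by lra.
    rewrite subr0 in h2.
    have A3 : 0 <= A%:R - 3 :> R by apply: le_trans h2; exact: normr_ge0.
    by apply: le_trans h2 _; rewrite ler_peMr.
  rewrite ler_norml in g.
  set u := (val c).2 / H%:R in f1 f2 g *; set f : R := (Num.floor u)%:~R in f1 f2 *.
  clearbody u f; case/andP: g => g1 g2.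
  by apply/andP; split; lra.
case: env => _ _ e3; have [i iT th] := e3 j w jA wA.
pose o := site K T j w i.
have y0 : (val c).2 + H%:R <= o.2 <= (val c).2 + 3 * H%:R.
  have /andP[f1 f2] := floor_itv ((val c).2 / H%:R).
  have E : (val c).2 = (val c).2 / H%:R * H%:R by rewrite divfK // gt_eqF.
  have iH : (i * (120 * 2 ^ K))%:R <= H%:R :> R by rewrite ler_nat /H leq_mul2r (ltnW iT) orbT.
  have i0 : 0 <= (i * (120 * 2 ^ K))%:R :> R by [].
  rewrite /o /site /= -/H /w intrD.
  rewrite intrD in f2.
  set u := (val c).2 / H%:R in f1 f2 *; set f : R := (Num.floor u)%:~R in f1 f2 *.
  set s : R := (i * (120 * 2 ^ K))%:R in iH i0 *; set h : R := H%:R in iH H0 E *.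
  rewrite -/u in E; clearbody u f s h.
  have p1 : h * f <= h * u by rewrite ler_pM2l.
  have p2 : h * u < h * (f + 1) by rewrite ltr_pM2l.
  have E' : (val c).2 = h * u by rewrite E mulrC.
  rewrite E'; have -> : 2%:~R = 2 :> R by [].
  by apply/andP; split; lra.
have sh (a b : C) : adjb S a b -> d2 (val a) (val b) < L0 ^+ 2.
  by move=> /asboolP ab; apply: short_edge => //; have := CA _ (valP a); lra.
have de0 : 0 < (j + 1)%:~R - (val c).1 by rewrite subr_gt0; case/andP: (floor_itv (val c).1).
have y0' : (val c).2 + L0 <= o.2 <= (val c).2 + 3 * H%:R.
  by case/andP: y0 => a b; rewrite b andbT; apply: le_trans a; rewrite lerD2l.
have [|v vn bv] := defect_near dX L00 sh y0' de0.
  move=> x0 hx p q r /asboolP pq /asboolP qr /asboolP pr tr.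
  have CSp (u : C) := CS _ (valP u).
  apply: (theta_blocked th K_gt0 (z := (x0, o.2)) tr) => //.
  - by apply: (@mem_site_cell j w i (val c)) => //; move: hx; rewrite addrC subrK.
  - by apply/ltW/sh/asboolP.
  - by apply/ltW/sh/asboolP.
  - by apply/ltW/sh/asboolP.
exists v => //; apply: le_trans vn _; rewrite natrM.
have L8 : 4 * L0 <= H%:R.
  rewrite /L0 /H !natrM natrX.
  have t0 : 0 < 2 ^+ K :> R by rewrite exprn_gt0.
  have : (1 : R) <= T%:R by rewrite ler1n.
  by move: (2 ^+ K) t0 (T%:R : R) => t t0 T' T1; nra.
by lra.
Qed.
End Grow.

(** * Exponential growth against quadratic volume *)

Section NoCore.
Variable R : realType.
Local Notation pt := (pt2 R).
Local Notation org := (org R).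
Variables (K T m A n : nat) (S : set pt) (y : pt).
Hypothesis K_gt0 : (0 < K)%N.
Hypothesis T_gt0 : (0 < T)%N.
Hypothesis Slf : locally_finite S.
Hypothesis SX : forall a b, S a -> S b -> a.1 = b.1 -> a = b.
Hypothesis env : Env K T m A S.
Let L0 : R := 8 * 2 ^+ K.
Let N := nbhd_card K T m.
(** Room for the ball of radius n L0 around y, one further edge and the margin 3 of [arcs_core]. *)
Hypothesis yA : supd y org + (n.+1)%:R * L0 + 3 <= A%:R.
Hypothesis big : ((3 * N) ^ n * ((4 * A) ^ 2 * m) < (3 * N + 1) ^ n)%N.

Let Wset k : set pt := core S (n - k) `&` [set p | supd p y <= k%:R * L0].
Let W k : {fset pt} := fset_set (Wset k).

Lemma L00 : 0 < L0. Proof. by rewrite /L0 mulr_gt0 // exprn_gt0. Qed.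

Lemma supd_org p k : (k <= n)%N -> supd p y <= k%:R * L0 -> supd p org + L0 + 3 <= A%:R.
Proof.
move=> kn h; have h2 := supd_tri h (lexx (supd y org)).
have : k%:R * L0 <= n%:R * L0 by rewrite ler_pM2r ?L00 // ler_nat.
have := yA; rewrite -(addn1 n) natrD mulrDl mul1r; have := L00; lra.
Qed.

Lemma Wfin k : finite_set (Wset k).
Proof.
apply: (@sub_finite_set _ _ (S `&` [set p | `|p.1 - y.1| <= k%:R * L0 /\ `|p.2 - y.2| <= k%:R * L0])).
  by move=> p [/core_sub Sp /= /supd_le].
apply: Slf; exists (Num.max (`|y.1| + k%:R * L0) (`|y.2| + k%:R * L0)) => p [h1 h2].
rewrite !le_max; split; apply/orP; [left|right].
  by rewrite -{1}(subrK y.1 p.1) addrC; apply: le_trans (ler_normD _ _) _; rewrite lerD2l.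
by rewrite -{1}(subrK y.2 p.2) addrC; apply: le_trans (ler_normD _ _) _; rewrite lerD2l.
Qed.

Lemma memW k p : (p \in W k) <-> Wset k p.
Proof. by rewrite /W in_fset_set; [split; [move/set_mem|move/mem_set]|exact: Wfin]. Qed.

Lemma deg_ge (C : {fset pt}) (s : seq pt) x : uniq s -> (forall b, b \in s -> b \in C /\ adjp S x b) ->
  (size s <= deg S C x)%N.
Proof.
move=> us Hs; rewrite /deg.
rewrite (bigID (mem s)) /=.
apply: leq_trans (leq_addr _ _).
rewrite -sum1_size -(big_filter _ (mem s)).
have P : perm_eq [seq b <- C | b \in s] s.
  apply: uniq_perm => //; first by rewrite filter_uniq ?fset_uniq.
  by move=> b; rewrite mem_filter; case: (boolP (b \in s)) => //= /Hs[].
rewrite (perm_big _ P) /= big_seq [leqRHS]big_seq; apply: leq_sum => b /Hs[_ ab].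
by rewrite /adjnat; have -> : `[< adjp S x b >] = true by apply/asboolP.
Qed.

Lemma W_growth k : (k < n)%N -> ((3 * N + 1) * #|` W k| <= 3 * N * #|` W k.+1|)%N.
Proof.
move=> kn; apply: (@arcs_growth R S).
- by move=> a b /memW[/core_sub Sa _] /memW[/core_sub Sb _]; apply: SX.
- apply/fsubsetP => p /memW[cp /= h]; apply/memW; split.
    by apply: core_decr cp; lia.
  by apply: le_trans h _; rewrite /= ler_pM2r ?L00 // ler_nat.
- move=> c /memW[cc /= hc].
  have En : (n - k = (n - k.+1).+1)%N by lia.
  move: cc; rewrite En => -[cc [s [us sz Hs]]]; rewrite -sz.
  apply: deg_ge => // b /Hs[cb ab]; split=> //; apply/memW; split=> //=.
  have sb : d2 c b < L0 ^+ 2.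
    apply: (short_edge env) => //.
    by have := supd_org (ltnW kn) hc; rewrite -/L0; lra.
  have h1 : supd b c <= L0 by apply: d2_supd_le; [exact: ltW L00|rewrite d2C ltW].
  by apply: le_trans (supd_tri h1 hc) _; rewrite -(addn1 k) natrD mulrDl mul1r addrC.
- apply: (arcs_core K_gt0 T_gt0 SX env).
    by move=> p /memW[cp _]; apply: core_decr cp; lia.
  by move=> p /memW[_ /= h]; apply: supd_org h; lia.
Qed.

Theorem no_core : ~ core S n y.
Proof.
move=> cy.
have W0 : (0 < #|` W 0|)%N.
  rewrite cardfs_gt0; apply/fset0Pn; exists y; apply/memW; split; first by rewrite subn0.
  by rewrite /= mul0r; apply/supd_le; rewrite !subrr normr0.
have step k : (k <= n)%N -> ((3 * N + 1) ^ k <= (3 * N) ^ k * #|` W k|)%N.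
  elim: k => [|k IH] kn; first by rewrite !expn0 mul1n.
  rewrite !expnS -mulnA mulnCA; apply: (@leq_trans ((3 * N + 1) * ((3 * N) ^ k * #|` W k|))).
    by rewrite leq_mul2l (IH (ltnW kn)) orbT.
  rewrite mulnCA; apply: leq_trans (leq_mul (leqnn _) (W_growth kn)) _.
  by rewrite mulnCA.
have := step n (leqnn n); rewrite leqNgt => /negP; apply.
apply: leq_ltn_trans big; rewrite leq_mul2l; apply/orP; right.
apply: (card_square K_gt0 T_gt0 env) => p /memW[/core_sub Sp /= h]; split=> //.
by have := supd_org (leqnn n) h; have := L00; lra.
Qed.
End NoCore.

(** * Poisson counts *)

Section Poisson.
Variable R : realType.
Local Notation pt := (pt2 R).
Local Notation M := (Mspace R).

Definition good (B : set pt) := measurable B /\ Defs.bounded_set B.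
Definition vol (B : set pt) : R := fine (leb2 B).

(* [Some k] requires exactly k points, [None] at least one *)
Definition ok (s : option nat) (A : set pt) : Prop :=
  if s is Some k then card_eq A k else A !=set0.
Definition pr (s : option nat) (B : set pt) : R :=
  if s is Some k then poisson_mass (vol B) k else 1 - poisson_mass (vol B) 0.

Lemma measurable_count B k : good B -> measurable (count_event B k : set M).
Proof.
move=> [mB bB]; rewrite /measurable /=; apply: sub_sigma_algebra.
by exists B, k.
Qed.

Lemma hit_event B : [set S : M | ok None (S `&` B)] = ~` (count_event B 0).
Proof.
apply/seteqP; split => S /=; first by move=> /set0P/eqP h /card_eq_set0.
by move=> h; apply/set0P/eqP => E; apply: h; apply/card_eq_set0.
Qed.

Lemma measurable_ok B s : good B -> measurable ([set S : M | ok s (S `&` B)]).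
Proof.
case: s => [k|] gB; first exact: measurable_count.
by rewrite hit_event; apply: measurableC; apply: measurable_count.
Qed.

Section Family.
Variables (I : finType) (B : I -> set pt).
Definition ev (D : {set I}) (sp : I -> option nat) : set M :=
  [set S : M | forall i, i \in D -> ok (sp i) (S `&` B i)].

Hypothesis gB : forall i, good (B i).
Hypothesis dB : forall i j, i != j -> B i `&` B j = set0.

Lemma measurable_ev D sp : measurable (ev D sp).
Proof.
have -> : ev D sp = \big[setI/setT]_(i in D) [set S : M | ok (sp i) (S `&` B i)].
  apply/seteqP; split => S.
    by move=> H; elim/big_ind: _ => // i /H.
  move=> H i iD; move: H; rewrite (bigD1 i) //=.
  by case.
apply: bigsetI_measurable => i _; exact: measurable_ok.
Qed.

Variable P : probability M R.
Hypothesis HP : poisson_law P.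

Lemma probD (A C : set M) a c : measurable A -> measurable C -> C `<=` A ->
  P A = a%:E -> P C = c%:E -> P (A `\` C) = (a - c)%:E.
Proof.
move=> mA mC CA PA PC; rewrite measureD //; last by apply: (le_lt_trans (probability_le1 P mA)); rewrite ltry.
by rewrite (setIidr CA); transitivity (P A - P C)%E => //; rewrite PA PC EFinB.
Qed.

Lemma exact_law (D : {set I}) (k : I -> nat) :
  P (ev D (fun i => Some (k i))) = (\prod_(i in D) pr (Some (k i)) (B i))%:E.
Proof.
have := @HP #|D| (fun j => B (enum_val j)) (fun j => k (enum_val j)).
move=> H; rewrite (_ : ev _ _ = [set S : M | forall j : 'I_#|D|, card_eq (S `&` B (enum_val j)) (k (enum_val j))]).
  rewrite H.
  - by rewrite [in RHS]big_enum_val.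
  - by move=> j; exact: gB.
  - by move=> j j' n; apply: dB; rewrite (inj_eq enum_val_inj).
apply/seteqP; split => S /= h; first by move=> j; apply: (h (enum_val j)); exact: enum_valP.
by move=> i iD; have := h (enum_rank_in iD i); rewrite enum_rankK_in.
Qed.

(** Induction on the number of boxes that must be hit: hitting i0 is the difference between no
    condition on i0 and exactly zero points in it, and both of these have one such box less. *)
Lemma ev_law (D : {set I}) (sp : I -> option nat) :
  P (ev D sp) = (\prod_(i in D) pr (sp i) (B i))%:E.
Proof.
have [n] := ubnP #|[set i in D | sp i == None]%SET|; elim: n D sp => // n IH D sp lt_n.
have [i0 i0D|none] := pickP [pred i in D | sp i == None]; last first.
  pose k i := odflt 0%N (sp i).
  have E i : i \in D -> sp i = Some (k i).
    by move=> iD; have := none i; rewrite /= iD /k; case: (sp i).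
  rewrite (_ : ev D sp = ev D (fun i => Some (k i))).
    by rewrite exact_law; congr EFin; apply: eq_bigr => i /E ->.
  by apply/seteqP; split => S H i iD; have := H i iD; rewrite (E i iD).
case/andP: i0D => i0D /eqP sp0.
pose sp' i := if i == i0 then Some 0%N else sp i.
have Esp' i : i \in D :\ i0 -> sp' i = sp i by rewrite !inE /sp' => /andP[/negbTE ->].
have -> : ev D sp = ev (D :\ i0) sp `\` ev D sp'.
  apply/seteqP; split => S.
    move=> H; split; first by move=> i; rewrite !inE => /andP[_ /H].
    move=> H'; have := H i0 i0D; have := H' i0 i0D.
    by rewrite /sp' eqxx sp0 /= => /card_eq_set0 -> [].
  case=> H1 H2 i iD; have [->|ni] := eqVneq i i0; last by apply: H1; rewrite !inE ni.
  rewrite sp0 /=; apply/set0P/eqP => E; apply: H2 => j jD.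
  have [->|nj] := eqVneq j i0; first by rewrite /sp' eqxx /=; apply/card_eq_set0.
  by rewrite Esp' ?inE ?nj //; apply: H1; rewrite !inE nj.
rewrite (@probD _ _ (\prod_(i in D :\ i0) pr (sp i) (B i)) (\prod_(i in D) pr (sp' i) (B i))).
- congr EFin; rewrite [RHS](big_setD1 i0) //= [X in _ - X](big_setD1 i0) //=.
  have Eb : \prod_(i in D :\ i0) pr (sp' i) (B i) = \prod_(i in D :\ i0) pr (sp i) (B i).
    by apply: eq_bigr => i /Esp' ->.
  by rewrite Eb sp0 /sp' eqxx /=; ring.
- exact: measurable_ev.
- exact: measurable_ev.
- by move=> S H i iD; rewrite -Esp' //; apply: H; move: iD; rewrite !inE => /andP[].
- apply: IH; rewrite -ltnS; apply: leq_trans lt_n; rewrite ltnS; apply: proper_card.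
  apply/properP; split; first by apply/fintype.subsetP => i; rewrite !inE => /andP[/andP[_ ->] ->].
  by exists i0; rewrite !inE ?i0D ?sp0 ?eqxx.
- apply: IH; rewrite -ltnS; apply: leq_trans lt_n; rewrite ltnS; apply: proper_card.
  apply/properP; split.
    apply/fintype.subsetP => i; rewrite !inE /sp'; by case: (eqVneq i i0) => [_ /andP[]|].
  by exists i0; rewrite !inE ?i0D ?sp0 ?eqxx //= /sp' eqxx.
Qed.
End Family.

Section Groups.
Variables (J C : finType) (B : J * C -> set pt) (sp : J * C -> option nat).
Hypothesis gB : forall i, good (B i).
Hypothesis dB : forall i j, i != j -> B i `&` B j = set0.
Variable P : probability M R.
Hypothesis HP : poisson_law P.

Definition gev (j : J) : set M := [set S : M | forall c, ok (sp (j, c)) (S `&` B (j, c))].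
Definition gpr (j : J) : R := \prod_c pr (sp (j, c)) (B (j, c)).

Lemma gevE j : gev j = ev B [set i | i.1 == j]%SET sp.
Proof.
apply/seteqP; split => S H; first by move=> [j' c]; rewrite inE /= => /eqP ->; apply: H.
by move=> c; apply: H; rewrite inE.
Qed.

Lemma measurable_gev j : measurable (gev j).
Proof. by rewrite gevE; apply: measurable_ev. Qed.

(** A group stands for one candidate with all its boxes. Failure at j0 is the difference between no
    condition and success at j0, so failures of many candidates become independent without a general
    theory of independence. *)
Lemma group_law (D1 D2 : {set J}) : (forall j, j \in D1 -> j \notin D2) ->
  P [set S : M | (forall j, j \in D1 -> gev j S) /\ (forall j, j \in D2 -> ~ gev j S)] =
  ((\prod_(j in D1) gpr j) * \prod_(j in D2) (1 - gpr j))%:E.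
Proof.
have mE (D D' : {set J}) : measurable [set S : M | (forall j, j \in D -> gev j S) /\ (forall j, j \in D' -> ~ gev j S)].
  rewrite (_ : [set S | _] = \big[setI/setT]_(j in D) gev j `&` \big[setI/setT]_(j in D') ~` gev j).
    by apply: measurableI; apply: bigsetI_measurable => j _; [|apply: measurableC]; exact: measurable_gev.
  apply/seteqP; split => S [H1 H2].
    by split; elim/big_ind: _.
  by split=> j jD; [move: H1|move: H2]; rewrite (bigD1 j) //= => -[].
have [n] := ubnP #|D2|; elim: n D1 D2 => // n IH D1 D2 lt_n dis.
have [D20|[j0 j0D]] := set_0Vmem D2.
  rewrite D20 big_set0 mulr1.
  rewrite (_ : [set S : M | _] = ev B [set i | i.1 \in D1]%SET sp).
    rewrite (ev_law gB dB HP); congr EFin.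
    rewrite /gpr (pair_big (fun j => j \in D1) xpredT (fun j c => pr (sp (j, c)) (B (j, c)))) /=.
    by apply: eq_big => -[j c]; rewrite ?inE ?andbT.
  apply/seteqP; split => S.
    by case=> H _ [j c]; rewrite inE /= => /H; apply.
  by move=> H; split=> j; rewrite ?inE // => jD c; apply: H; rewrite inE.
have j0D1 : j0 \notin D1 by apply/negP => /dis; rewrite j0D.
pose EE (D D' : {set J}) : set M := [set S : M | (forall j, j \in D -> gev j S) /\ (forall j, j \in D' -> ~ gev j S)].
have EEq : EE D1 D2 = EE D1 (D2 :\ j0) `\` EE (j0 |: D1)%SET (D2 :\ j0).
  apply/seteqP; split => S.
    case=> H1 H2; split.
      by split=> // j; rewrite !inE => /andP[_ /H2].
    by case=> H3 _; apply: (H2 j0 j0D); apply: H3; rewrite !inE eqxx.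
  case=> -[H1 H2] H3; split=> // j jD gj.
  have [E|nj] := eqVneq j j0; last by apply: (H2 j) => //; rewrite !inE nj.
  apply: H3; split=> // i; rewrite !inE => /orP[/eqP ->|/H1 //].
  by rewrite -E.
have card_lt : (#|D2 :\ j0| < n)%N.
  by rewrite -ltnS; apply: leq_trans lt_n; rewrite ltnS proper_card // properD1.
have dis' j : j \in D1 -> j \notin D2 :\ j0.
  by move=> /dis; rewrite !inE negb_and => ->; rewrite orbT.
have dis2 j : j \in (j0 |: D1)%SET -> j \notin D2 :\ j0.
  by rewrite !inE => /orP[/eqP ->|/dis']; rewrite ?eqxx // !inE.
rewrite -/(EE D1 D2) EEq (@probD _ _ _ (_) _ _ _ _ (IH D1 _ card_lt dis') (IH _ _ card_lt dis2)).
- congr EFin; rewrite big_setU1 //= [X in _ = _ * X](big_setD1 j0) //=; ring.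
- exact: mE.
- exact: mE.
- by move=> S [H1 H2]; split=> // j jD; apply: H1; rewrite !inE jD orbT.
Qed.
End Groups.
End Poisson.

(** * Bounds on outer probability *)

Section Small.
Variables (d : measure_display) (T : measurableType d) (R : realType) (P : probability T R).

(* bounds on the outer probability *)
Definition small (E : set T) (e : R) := exists D, [/\ measurable D, E `<=` D & (P D <= e%:E)%E].

Lemma small_mono E E' e e' : small E' e' -> E `<=` E' -> e' <= e -> small E e.
Proof.
move=> [D [mD sD pD]] s le; exists D; split=> //; first exact: subset_trans s sD.
by apply: le_trans pD _; rewrite lee_fin.
Qed.

Lemma small_measurable E e : measurable E -> (P E <= e%:E)%E -> small E e.
Proof. by move=> mE pE; exists E; split=> // x. Qed.

Lemma smallU E E' e e' : small E e -> small E' e' -> small (E `|` E') (e + e').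
Proof.
move=> [D [mD sD pD]] [D' [mD' sD' pD']]; exists (D `|` D'); split.
- exact: measurableU.
- exact: setUSS.
- apply: (@le_trans _ _ (P D + P D')%E); first exact: measureU2.
  by rewrite EFinD leeD.
Qed.

Lemma small_set0 : small set0 0.
Proof. by exists set0; split=> //; rewrite measure0. Qed.

Lemma small_bigU (I : eqType) (s : seq I) (E : I -> set T) e : (forall i, i \in s -> small (E i) e) ->
  small [set x | exists2 i, i \in s & E i x] ((size s)%:R * e).
Proof.
elim: s => [|i s IH] H.
  by rewrite mul0r; apply: small_mono small_set0 _ _ => // x [].
have -> : (size (i :: s))%:R * e = e + (size s)%:R * e by rewrite /= -natr1 mulrDl mul1r addrC.
apply: small_mono (smallU (H i (mem_head _ _)) (IH _)) _ (lexx _).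
  by move=> j js; apply: H; rewrite inE js orbT.
by move=> x [j]; rewrite inE => /orP[/eqP ->|js Ej]; [left|right; exists j].
Qed.

Lemma small_negligible E : (forall e, 0 < e -> small E e) -> P.-negligible E.
Proof.
move=> H.
have Hn n : exists D, [/\ measurable D, E `<=` D & (P D <= (n.+1%:R^-1)%:E)%E].
  by apply: H; rewrite invr_gt0.
have [D HD] := choice Hn.
have mI : measurable (\bigcap_n D n) by apply: bigcapT_measurable => n; case: (HD n).
exists (\bigcap_n D n); split.
- exact: mI.
- apply/eqP; rewrite eq_le measure_ge0 andbT; apply/lee_addgt0Pr => e e0; rewrite add0e.
  have [n ne] : exists n : nat, n.+1%:R^-1 <= e.
    exists (Num.bound e^-1); rewrite invf_ple ?posrE ?ltr0n //.
    apply: ltW; apply: lt_trans (archi_boundP _) _; first by rewrite invr_ge0 ltW.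
    by rewrite ltr_nat.
  have [mD _ pD] := HD n.
  apply: (@le_trans _ _ (P (D n))).
    by apply: le_measure; [exact/mem_set|exact/mem_set|move=> x; apply].
  by apply: le_trans pD _; rewrite lee_fin.
- by move=> x Ex n _; case: (HD n) => _ s _; apply: s.
Qed.
End Small.

(** * Areas of rectangles and boxes *)

Section Volume.
Variable R : realType.
Local Notation pt := (pt2 R).

Lemma measurable_rect (i j : interval R) : measurable ([set` i] `*` [set` j] : set pt).
Proof. by apply: measurableX; exact: measurable_itv. Qed.

Lemma vol_rect (a b c d : R) : a <= b -> c <= d ->
  leb2 ([set` `[a, b[] `*` [set` `[c, d[]) = ((b - a) * (d - c))%:E.
Proof.
move=> ab cd; rewrite /leb2 product_measure1E //=; try exact: measurable_itv.
have E x y : x <= y -> lebesgue_measure ([set` `[x, y[] : set R) = (y - x)%:E.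
  move=> xy; rewrite lebesgue_measure_itv /= lte_fin; case: ltP => [//|yx].
  by have -> : y = x by [apply/le_anti; rewrite xy yx]; rewrite subrr.
by rewrite (E a b ab) (E c d cd).
Qed.

Lemma cellE (o : pt) (t : R) ij : cell o t ij =
  [set` `[o.1 + ij.1%:~R * t, o.1 + (ij.1 + 1)%:~R * t[] `*` [set` `[o.2 + ij.2%:~R * t, o.2 + (ij.2 + 1)%:~R * t[].
Proof. by apply/seteqP; split => -[x y]; rewrite /cell /= !in_itv. Qed.

Lemma good_cell (o : pt) (t : R) ij : 0 <= t -> good (cell o t ij).
Proof.
move=> t0; split; first by rewrite cellE; apply: measurable_rect.
exists (Num.max (`|o.1 + ij.1%:~R * t| + t) (`|o.2 + ij.2%:~R * t| + t)) => p /=.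
have E (a x : R) (k : int) : a + k%:~R * t <= x < a + (k + 1)%:~R * t -> `|x| <= `|a + k%:~R * t| + t.
  rewrite intrD mulrDl mul1r addrA => /andP[h1 h2].
  by rewrite -{1}(subrK (a + k%:~R * t) x) addrC; apply: le_trans (ler_normD _ _) _; rewrite lerD2l ger0_norm; lra.
by rewrite /cell /= !le_max => -[/E -> /E ->]; rewrite orbT.
Qed.

Lemma vol_cell (o : pt) (t : R) ij : 0 <= t -> vol (cell o t ij) = t ^+ 2.
Proof.
move=> t0; rewrite /vol cellE.
have E (a : R) (k : int) : a + k%:~R * t <= a + (k + 1)%:~R * t.
  by rewrite lerD2l ler_wpM2r // ler_int lerDl.
rewrite (vol_rect (E _ _) (E _ _)) /= !intrD; ring.
Qed.

Lemma vol_ge0 (B : set pt) : 0 <= vol B.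
Proof. by rewrite /vol fine_ge0. Qed.
End Volume.

(** * The number of points in one set *)

Section Count.
Variable R : realType.
Local Notation pt := (pt2 R).
Local Notation M := (Mspace R).
Variable P : probability M R.
Hypothesis HP : poisson_law P.

Lemma card_eq_uniq (A : set pt) k l : card_eq A k -> card_eq A l -> k = l.
Proof.
move=> [s [us <- E]] [s' [us' <- E']]; apply/perm_size/uniq_perm => // x.
apply/idP/idP => xs.
  by have : [set x | x \in s] x by []; rewrite -E E'.
by have : [set x | x \in s'] x by []; rewrite -E' E.
Qed.

Lemma count_law (B : set pt) s : good B -> P [set S : M | ok s (S `&` B)] = (pr s B)%:E.
Proof.
move=> gB.
have := @ev_law R _ (fun _ : unit => B) (fun _ => gB) _ P HP [set tt]%SET (fun _ => s).
rewrite big_set1 => <-; last by case=> -[].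
congr (P _); apply/seteqP; split => S /=; first by move=> H i _.
by apply; rewrite inE.
Qed.

Lemma measurable_lt (B : set pt) m : good B ->
  measurable [set S : M | exists2 k, (k < m)%N & card_eq (S `&` B) k].
Proof.
move=> gB; rewrite (_ : [set S | _] = \bigcup_(k in `I_m) [set S : M | ok (Some k) (S `&` B)]).
  by apply: bigcup_measurable => k _; apply: measurable_ok.
by apply/seteqP; split => S [k]; exists k.
Qed.

Lemma count_lt_law (B : set pt) m : good B ->
  P [set S : M | exists2 k, (k < m)%N & card_eq (S `&` B) k] = (\sum_(0 <= k < m) poisson_mass (vol B) k)%:E.
Proof.
move=> gB; elim: m => [|m IH].
  rewrite big_geq // (_ : [set S | _] = set0) ?measure0 //.
  by apply/seteqP; split => S // [].
rewrite big_nat_recr //= EFinD -IH -(count_law (Some m) gB) -measureU.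
- congr (P _); apply/seteqP; split => S.
    by case=> k; rewrite ltnS leq_eqVlt => /orP[/eqP ->|km] c; [right|left; exists k].
  by case=> [[k km c]|c]; [exists k => //; apply: ltnW|exists m].
- exact: measurable_lt.
- exact: measurable_ok.
- by apply/seteqP; split => S // -[[k km c] /= c']; move: km; rewrite (card_eq_uniq c c') ltnn.
Qed.

Lemma pmf_sum l m : \sum_(0 <= k < m) poisson_mass l k = expR (- l) * series (exp_coeff l) m :> R.
Proof.
rewrite /series /= big_distrr /=; apply: eq_bigr => k _.
by rewrite /poisson_mass /exp_coeff /= mulrC.
Qed.

Lemma small_ge (B : set pt) m : good B ->
  small P [set S : M | forall k, (k < m)%N -> ~ card_eq (S `&` B) k]
    (1 - expR (- vol B) * series (exp_coeff (vol B)) m).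
Proof.
move=> gB; apply: small_measurable.
  rewrite (_ : [set S | _] = ~` [set S : M | exists2 k, (k < m)%N & card_eq (S `&` B) k]).
    by apply: measurableC; apply: measurable_lt.
  by apply/seteqP; split => S /= H; [case=> k km; apply: H|move=> k km c; apply: H; exists k].
rewrite (_ : [set S | _] = ~` [set S : M | exists2 k, (k < m)%N & card_eq (S `&` B) k]).
  by rewrite probability_setC; [rewrite count_lt_law // pmf_sum|apply: measurable_lt].
by apply/seteqP; split => S /= H; [case=> k km; apply: H|move=> k km c; apply: H; exists k].
Qed.

(** The right-hand side is nonincreasing in m because l^m + 2 l^(m+1) <= 2 l^m, and it dominates all
    later partial sums. *)
Lemma series_exp_tail (l : R) m : 0 <= l <= 1 / 4 -> expR l <= series (exp_coeff l) m + 2 * l ^+ m.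
Proof.
move=> /andP[l0 l1]; apply: limr_le; first exact: is_cvg_series_exp_coeff.
have step n : series (exp_coeff l) n.+1 + 2 * l ^+ n.+1 <= series (exp_coeff l) n + 2 * l ^+ n.
  rewrite /series /= big_nat_recr //= -addrA lerD2l /exp_coeff /= exprS.
  have p0 : 0 <= l ^+ n by rewrite exprn_ge0.
  have : l ^+ n / n`!%:R <= l ^+ n.
    by rewrite ler_pdivrMr ?ltr0n ?fact_gt0 // ler_peMr // ler1n fact_gt0.
  by nra.
exists m => // n /= mn; rewrite -(subnK mn) addnC.
have : series (exp_coeff l) (m + (n - m))%N + 2 * l ^+ (m + (n - m)) <= series (exp_coeff l) m + 2 * l ^+ m.
  by elim: (n - m)%N => [|k IH]; rewrite ?addn0 // addnS; apply: le_trans (step _) IH.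
by have : 0 <= l ^+ (m + (n - m)) by [rewrite exprn_ge0]; lra.
Qed.

Lemma small_crowded (B : set pt) m : good B -> vol B = 1 / 4 ->
  small P [set S : M | forall k, (k < m)%N -> ~ card_eq (S `&` B) k] (2 * (1 / 4) ^+ m).
Proof.
move=> gB vB; apply: small_mono (small_ge m gB) _ _ => //; rewrite vB.
have := @series_exp_tail (1 / 4) m.
set s := series _ _; set x := (1 / 4) ^+ m => H.
have e0 := expR_gt0 (- (1 / 4) : R); have e1 : expR (- (1 / 4)) * expR (1 / 4) = 1 :> R.
  by rewrite -expRD addNr expR0.
have x0 : 0 <= x by rewrite exprn_ge0 //; lra.
have e2 : expR (- (1 / 4)) <= 1 :> R by rewrite -[leRHS]expR0 ler_expR; lra.
have {}H : expR (1 / 4) <= s + 2 * x by apply: H; lra.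
by nra.
Qed.

(** [poisson_law] gives the probabilities of finite counts only; that they exhaust the total mass is
    the convergence of the exponential series. *)
Lemma negligible_infinite (B : set pt) : good B ->
  P.-negligible [set S : M | forall k, ~ card_eq (S `&` B) k].
Proof.
move=> gB; apply: small_negligible => e e0.
set l := vol B.
have cv : series (exp_coeff l) @ \oo --> expR l by exact: is_cvg_series_exp_coeff.
have e0' : 0 < e * expR l by rewrite mulr_gt0 // expR_gt0.
have [m _ Hm] := (cvgrPdist_le _ _).1 cv _ e0'.
apply: small_mono (small_ge m gB) _ _; first by move=> S H k _; apply: H.
have := Hm m (leqnn m); rewrite /= ler_norml => /andP[_ h].
have e1 : expR (- l) * expR l = 1 by rewrite -expRD addNr expR0.
have p := expR_gt0 (- l); have q := expR_gt0 l.
rewrite -/l; have -> : 1 - expR (- l) * series (exp_coeff l) m =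
  expR (- l) * (expR l - series (exp_coeff l) m) by rewrite mulrBr e1.
by apply: (@le_trans _ _ (expR (- l) * (e * expR l))); [rewrite ler_pM2l|rewrite mulrCA e1 mulr1].
Qed.

End Count.

(** * Null events: infinite counts and coincidences *)

Section Null.
Variable R : realType.
Local Notation pt := (pt2 R).
Local Notation M := (Mspace R).
Local Notation org := (org R).
Variable P : probability M R.
Hypothesis HP : poisson_law P.

Lemma leb2_le (A B : set pt) : measurable A -> measurable B -> A `<=` B -> (leb2 A <= leb2 B)%E.
Proof. by move=> mA mB AB; rewrite /leb2; apply: le_measure => //; exact/mem_set. Qed.

Lemma leb2_ge0 (A : set pt) : (0 <= leb2 A)%E. Proof. exact: measure_ge0. Qed.

Lemma leb2_fin (A : set pt) : good A -> leb2 A \is a fin_num.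
Proof.
move=> [mA [r Ar]]; rewrite ge0_fin_numE ?leb2_ge0 //.
pose r' := Num.max r 0 + 1.
have h : r < r' /\ 0 <= r' by rewrite /r'; split; [rewrite ltr_pwDr // le_max lexx|rewrite addr_ge0 // le_max lexx orbT].
apply: (@le_lt_trans _ _ (leb2 ([set` `[- r', r'[] `*` [set` `[- r', r'[]))).
  apply: leb2_le => //; first exact: measurable_rect.
  by move=> x /Ar [h1 h2]; split; rewrite /= in_itv /=; move: h1 h2; rewrite !ler_norml; lra.
by rewrite vol_rect ?ltry //; lra.
Qed.

Lemma vol_le (A B : set pt) : good A -> good B -> A `<=` B -> vol A <= vol B.
Proof.
move=> gA gB AB; rewrite /vol fine_le ?leb2_fin //.
by apply: leb2_le => //; [case: gA|case: gB].
Qed.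

Lemma negligible_countU (I : countType) (E : I -> set M) :
  (forall i, P.-negligible (E i)) -> P.-negligible [set S | exists i, E i S].
Proof.
move=> H; pose F n := if (choice.unpickle n : option I) is Some i then E i else set0.
apply: (@negligibleS _ _ _ _ (\bigcup_n F n)).
  by move=> S [i Ei]; exists (choice.pickle i) => //; rewrite /F choice.pickleK.
apply: negligible_bigcup => n; rewrite /F; case: (choice.unpickle n : option I) => [i|]; first exact: H.
exact: negligible_set0.
Qed.

Lemma card_eq_finite (A : set pt) k : card_eq A k -> finite_set A.
Proof. by case=> s [_ _ ->]; exact: finite_seq. Qed.

Lemma locally_finite_cells (S : set pt) :
  locally_finite S <-> forall ij, exists k, card_eq (S `&` cell org 1 ij) k.
Proof.
split=> [lf ij|fin B [r Br]].
  have [|s Es] := (finite_seqP _).1 (lf (cell org 1 ij) _); first by case: (@good_cell R org 1 ij).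
  exists (size (undup s)), (undup s); split; rewrite ?undup_uniq // Es.
  by apply/seteqP; split=> x /=; rewrite mem_undup.
pose n := Num.bound (Num.max r 0 + 1).
apply: (@sub_finite_set _ _ (\bigcup_(ij in [set` zsquare n]) (S `&` cell org 1 ij))).
  move=> p [Sp /Br[h1 h2]]; exists (idx org 1 p); last by split=> //; exact: mem_cell.
  rewrite /= mem_zsquare; apply: inr2_near => //; rewrite mulr1.
  apply/supd_lt; rewrite !subr0.
  have r0 : r <= Num.max r 0 by rewrite le_max lexx.
  have nb : Num.max r 0 + 1 < n%:R.
    by apply: archi_boundP; rewrite addr_ge0 // le_max lexx orbT.
  by split; lra.
apply: bigcup_finite => [|ij _]; first exact: finite_seq.
by have [k ck] := fin ij; exact: card_eq_finite ck.
Qed.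

Lemma negligible_not_lf : P.-negligible [set S : M | ~ locally_finite S].
Proof.
apply: (@negligibleS _ _ _ _ [set S : M | exists ij : int * int, forall k, ~ card_eq (S `&` cell org 1 ij) k]).
  move=> S /= nlf; apply: contrapT => H; apply: nlf; apply/locally_finite_cells => ij.
  by apply: contrapT => nk; apply: H; exists ij => k ck; apply: nk; exists k.
apply: negligible_countU => ij; apply: negligible_infinite => //; exact: good_cell.
Qed.

Section Anchors.
Variables (n : nat) (Z : ('I_n -> pt) -> set pt).

(* n points of S in distinct cells leave room for a further point of S only in a small set *)
Lemma anchor_bound (N : nat) (b : 'I_n -> int * int) (A : set pt) : (0 < N)%N -> injective b -> good A ->
  small P [set S : M | (forall i, S `&` cell org (N%:R^-1) (b i) !=set0) /\
     (exists v, [/\ S v, A v & forall i, ~ cell org (N%:R^-1) (b i) v])]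
    ((N%:R^-1) ^+ (2 * n) * vol A).
Proof.
move=> N0 bI gA; set e : R := N%:R^-1.
have e0 : 0 < e by rewrite invr_gt0 ltr0n.
pose Cs i := cell org e (b i).
have gC i : good (Cs i) by apply: good_cell; exact: ltW.
pose A' := A `\` \bigcup_(i in [set: 'I_n]) Cs i.
have mU : measurable (\bigcup_(i in [set: 'I_n]) Cs i).
  by apply: fin_bigcup_measurable => // i _; case: (gC i).
have gA' : good A'.
  case: gA => mA [r Ar]; split; first exact: measurableD.
  by exists r => x [/Ar].
pose B (o : 'I_n.+1) := if unlift ord0 o is Some i then Cs i else A'.
have gB o : good (B o) by rewrite /B; case: (unlift ord0 o).
have dB o o' : o != o' -> B o `&` B o' = set0.
  rewrite /B; case: unliftP => [i|] ->; case: unliftP => [j|] -> //= nij; apply/seteqP; split => // p.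
  - move=> [/(cellP_idx _ _ _ e0) h1 /(cellP_idx _ _ _ e0) h2].
    by move: nij; rewrite (bI i j) ?eqxx // -h1 -h2.
  - by case=> h1 [_ h2]; apply: h2; exists i.
  - by case=> [[_ h2] h1]; apply: h2; exists j.
apply: small_mono (@small_measurable _ _ _ P (ev B [set: 'I_n.+1]%SET (fun=> None)) _ _ _) _ (lexx _).
- exact: measurable_ev.
- rewrite (ev_law gB dB HP) lee_fin /=.
  have le1 (D : set pt) : 0 <= pr None D <= vol D.
    rewrite /pr /poisson_mass expr0 fact0 divr1 mul1r.
    have := expR_ge1Dx (- vol D).
    have : expR (- vol D) <= 1 by rewrite -[leRHS]expR0 ler_expR oppr_le0 vol_ge0.
    by move=> h1 h2; apply/andP; split; lra.
  rewrite (eq_bigl xpredT); last by move=> o; rewrite inE.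
  rewrite big_ord_recl {1}/B unlift_none mulrC.
  apply: ler_pM; first by apply: prodr_ge0 => i _; case/andP: (le1 (B (lift ord0 i))).
  + by case/andP: (le1 A').
  + rewrite exprM; have -> : (e ^+ 2) ^+ n = \prod_(i < n) e ^+ 2 by rewrite prodr_const card_ord.
    apply: ler_prod => i _; rewrite /B liftK.
    by rewrite -(vol_cell org (b i) (ltW e0)); exact: le1.
  + case/andP: (le1 A') => _ h; apply: le_trans h _.
    by apply: vol_le => //; exact: subDsetl.
- move=> S [H1 [v [Sv Av Nv]]] o _ /=; rewrite /B; case: unliftP => [i|] _; first exact: H1.
  by exists v; split=> //; split=> // -[i _]; apply: Nv.
Qed.

Hypothesis Zsmall : forall (q : nat) (e : R), 0 < e -> exists N0 : nat, forall N, (N0 <= N)%N -> (0 < N)%N ->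
  forall b : 'I_n -> int * int, (forall i, inr2 (q * N) (b i)) -> exists A, [/\ good A, vol A <= e &
    forall a v, (forall i, cell org (N%:R^-1) (b i) (a i)) -> supd v org < q%:R -> Z a v -> A v].

(** A union bound over boxes of side 1/N. There are (2 q N)^(2 n) ways to place n anchors, and a
    given set of n boxes is occupied with probability at most N^(-2 n), so the union costs only (2
    q)^(2 n) while the area left for v is arbitrarily small. Separation by 1/(p+1) puts the points
    into distinct boxes. *)
Lemma negligible_coincidence : P.-negligible [set S : M | exists a v,
  [/\ forall i, S (a i), S v, injective a, forall i, a i <> v & Z a v]].
Proof.
pose E (qp : nat * nat) := [set S : M | exists a v,
  [/\ forall i, S (a i) /\ supd (a i) org < qp.1%:R, S v /\ supd v org < qp.1%:R,
   forall i j, i != j -> qp.2.+1%:R^-1 <= supd (a i) (a j), forall i, qp.2.+1%:R^-1 <= supd (a i) v & Z a v]].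
apply: (@negligibleS _ _ _ _ [set S : M | exists qp, E qp S]).
  move=> S [a [v [Sa Sv ai av Zav]]].
  pose bnd (s : seq R) := \big[Num.max/0]_(x <- s) x.
  have bndP s x : x \in s -> x <= bnd s.
    by move=> xs; rewrite /bnd; elim: s xs => // y s IH; rewrite inE big_cons le_max => /orP[/eqP ->|/IH ->]; rewrite ?lexx ?orbT.
  have bnd0 s : 0 <= bnd s.
    by rewrite /bnd; elim: s => [|y s IH]; rewrite ?big_nil // big_cons le_max IH orbT.
  pose s1 := supd v org :: [seq supd (a i) org | i <- enum 'I_n].
  pose s2 := [seq (supd (a i) v)^-1 | i <- enum 'I_n] ++ [seq (supd (a i) (a j))^-1 | i <- enum 'I_n, j <- enum 'I_n].
  have supd_gt0 x y : x <> y -> 0 < supd x y.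
    move=> xy; rewrite ltNge; apply/negP => /supd_le[]; rewrite !normr_le0 !subr_eq0 => /eqP h1 /eqP h2.
    by apply: xy; case: x y h1 h2 => x1 x2 [y1 y2] /= -> ->.
  have ub (x : R) : 0 <= x -> x < (Num.bound x).+1%:R.
    by move=> x0; apply: lt_trans (archi_boundP x0) _; rewrite ltr_nat.
  exists ((Num.bound (bnd s1)).+1, Num.bound (bnd s2)); exists a, v; split=> //=.
  - move=> i; split=> //; apply: le_lt_trans (ub _ (bnd0 s1)); apply: bndP.
    by rewrite inE; apply/orP; right; apply: map_f; rewrite mem_enum.
  - by split=> //; apply: le_lt_trans (ub _ (bnd0 s1)); apply: bndP; rewrite inE eqxx.
  - move=> i j nij; have h : a i <> a j by move=> /ai E'; rewrite E' eqxx in nij.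
    rewrite invf_ple ?posrE ?supd_gt0 ?ltr0n //; apply: ltW; apply: le_lt_trans (ub _ (bnd0 s2)); apply: bndP.
    by rewrite mem_cat; apply/orP; right; apply/allpairsP; exists (i, j); rewrite !mem_enum.
  - move=> i.
    rewrite invf_ple ?posrE ?supd_gt0 ?ltr0n //; apply: ltW; apply: le_lt_trans (ub _ (bnd0 s2)); apply: bndP.
    by rewrite mem_cat; apply/orP; left; apply: map_f; rewrite mem_enum.
apply: negligible_countU => -[q p]; apply: small_negligible => e e0.
(* Absorbs the cost (2 q)^(2 n) of the union bound; the summand 1 keeps the denominator positive for
   q = 0. *)
pose e' := e / ((2 * q)%:R ^+ 2 ^+ n + 1).
have d0 : 0 < (2 * q)%:R ^+ 2 ^+ n + 1 :> R by rewrite ltr_wpDl // !exprn_ge0.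
have e'0 : 0 < e' by rewrite divr_gt0.
have [N0 HN] := Zsmall q e'0.
pose N := maxn N0 p.+1.
have Ngt : (0 < N)%N by rewrite /N leq_max orbT.
have {}HN := HN N (leq_maxl _ _) Ngt.
set t : R := N%:R^-1 in HN.
have t0 : 0 < t by rewrite invr_gt0 ltr0n.
have tp : t <= p.+1%:R^-1 by rewrite lef_pV2 ?posrE ?ltr0n // ler_nat leq_maxr.
pose X := (2 * (q * N))%N.
pose dec (k : 'I_X) : int := k%:Z - (q * N)%:Z.
pose decf (f : {ffun 'I_n -> 'I_X * 'I_X}) i : int * int := (dec (f i).1, dec (f i).2).
have dec_inr k : inr (q * N) (dec k) by rewrite /inr /dec; have := ltn_ord k; rewrite /X; lia.
have decf_inr f i : inr2 (q * N) (decf f i) by rewrite /inr2 /decf !dec_inr.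
have enc z : inr (q * N) z -> exists k, dec k = z.
  move=> hz; have hk : (absz (z + (q * N)%N%:Z)%R < X)%N by move: hz; rewrite /inr /X; lia.
  by exists (Ordinal hk); rewrite /dec /=; move: hz; rewrite /inr; lia.
pose F f := [set S : M | injective (decf f) /\ exists a v,
   [/\ forall i, S (a i) /\ cell org t (decf f i) (a i), S v, forall i, ~ cell org t (decf f i) v, supd v org < q%:R & Z a v]].
have Fs f : f \in enum {ffun 'I_n -> 'I_X * 'I_X} -> small P (F f) (t ^+ (2 * n) * e').
  move=> _; have [A [gA vA HA]] := HN (decf f) (decf_inr f).
  case: (pselect (injective (decf f))) => [inj|ninj]; last first.
    apply: small_mono (small_set0 P) _ _; first by move=> S [].
    by rewrite mulr_ge0 ?exprn_ge0 // ltW.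
  apply: small_mono (anchor_bound Ngt inj gA) _ _.
    move=> S [_ [a [v [Sa Sv nv qv Zav]]]]; split.
      by move=> i; exists (a i).
    exists v; split=> //; apply: (HA a) => // i; by case: (Sa i).
  by rewrite ler_pM2l // exprn_gt0.
have := small_bigU Fs; set E0 := [set S | _] => sE.
apply: small_mono sE _ _.
  move=> S [a [v /= [Sa [Sv qv] sep1 sep2 Zav]]].
  have ex i : exists k : 'I_X * 'I_X, (dec k.1, dec k.2) = idx org t (a i).
    have : inr2 (q * N) (idx org t (a i)).
      apply: inr2_near => //; rewrite natrM /t mulfK ?gt_eqF ?ltr0n //; by case: (Sa i).
    by case/andP => /enc[k1 E1] /enc[k2 E2]; exists (k1, k2); rewrite /= E1 E2.
  have [f Hf] := fin_all_exists ex.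
  have E1 i : decf (finfun f) i = idx org t (a i) by rewrite /decf ffunE Hf.
  have same x y : idx org t x = idx org t y -> supd x y < p.+1%:R^-1.
    move=> Exy; apply/supd_lt; have cx := mem_cell org x t0; have cy := mem_cell org y t0.
    rewrite -Exy in cy; have [h1 h2] := cell_dist t0 cx cy.
    by split; apply: lt_le_trans tp.
  exists (finfun f); first by rewrite mem_enum.
  split.
    move=> i j; rewrite !E1 => /same h; apply/eqP/negPn/negP => /sep1.
    by rewrite leNgt h.
  exists a, v; split=> //.
  - by move=> i; split; [case: (Sa i)|rewrite E1; exact: mem_cell].
  - move=> i /(cellP_idx _ _ _ t0); rewrite E1 => /esym/same h.
    by have := sep2 i; rewrite leNgt h.
rewrite -cardE card_ffun card_prod !card_ord.
have -> : ((X * X) ^ n = ((2 * q) ^ 2) ^ n * (N ^ (2 * n)))%N.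
  have EX : X = (2 * q * N)%N by rewrite /X mulnA.
  by rewrite EX mulnn (expnMn _ N) expnMn -!expnM.
rewrite natrM !natrX -mulrA (mulrA (N%:R ^+ (2 * n))) /t -exprMn mulfV ?gt_eqF ?ltr0n // expr1n mul1r.
rewrite /e' mulrA ler_pdivrMr // mulrC ler_pM2l // -natrX lerDl //.
Qed.
End Anchors.
End Null.

(** * Coincidences of distances *)

Section Annulus.
Variable R : realType.
Local Notation pt := (pt2 R).

Lemma measurable_d2 : measurable_fun setT (fun p : pt * pt => d2 p.1 p.2).
Proof.
have m1 : measurable_fun setT (fun p : pt * pt => p.1.1 - p.2.1).
  apply: measurable_funB.
    exact: (measurableT_comp (@measurable_fst _ _ R R) (@measurable_fst _ _ pt pt)).
  exact: (measurableT_comp (@measurable_fst _ _ R R) (@measurable_snd _ _ pt pt)).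
have m2 : measurable_fun setT (fun p : pt * pt => p.1.2 - p.2.2).
  apply: measurable_funB.
    exact: (measurableT_comp (@measurable_snd _ _ R R) (@measurable_fst _ _ pt pt)).
  exact: (measurableT_comp (@measurable_snd _ _ R R) (@measurable_snd _ _ pt pt)).
apply: (eq_measurable_fun (fun p : pt * pt => (p.1.1 - p.2.1) * (p.1.1 - p.2.1) + (p.1.2 - p.2.2) * (p.1.2 - p.2.2))).
  by move=> p _; rewrite /d2 !expr2.
by apply: measurable_funD; apply: measurable_funM.
Qed.

Lemma measurable_d2c c : measurable_fun setT (fun v : pt => d2 v c).
Proof.
have mp : measurable_fun setT (fun v : pt => (v, c)) by apply: measurable_fun_pair.
exact: (measurableT_comp measurable_d2 mp).
Qed.

Definition annulus (q : nat) (c : pt) (s w : R) : set pt :=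
  ([set` `[- q%:R, q%:R[] `*` [set` `[- q%:R, q%:R[]) `&` [set v | s - w <= d2 v c <= s + w].

Lemma good_annulus q c s w : good (annulus q c s w).
Proof.
split.
  apply: measurableI; first exact: measurable_rect.
  rewrite -[X in measurable X]setTI.
  have -> : [set v | s - w <= d2 v c <= s + w] = (fun v => d2 v c) @^-1` [set` `[s - w, s + w]].
    by apply/seteqP; split => v; rewrite /= in_itv.
  by apply: measurable_d2c => //; exact: measurable_itv.
exists q%:R => v [[]]; rewrite /= !in_itv /= => /andP[a b] /andP[d e] _.
by rewrite !ler_norml a d !ltW.
Qed.

Lemma sqrt_window (al w t : R) : 0 <= w -> al <= t ^+ 2 <= al + w ->
  Num.sqrt (Num.max al 0) <= `|t| <= Num.sqrt (Num.max al 0) + Num.sqrt w.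
Proof.
move=> w0 /andP[h1 h2]; set r := Num.sqrt _.
have m0 : 0 <= Num.max al 0 by rewrite le_max lexx orbT.
have r2 : r ^+ 2 = Num.max al 0 by rewrite sqr_sqrtr.
have r0 : 0 <= r by exact: sqrtr_ge0.
have u0 : 0 <= Num.sqrt w by exact: sqrtr_ge0.
have u2 : Num.sqrt w ^+ 2 = w by rewrite sqr_sqrtr.
have t2 : `|t| ^+ 2 = t ^+ 2 by rewrite real_normK ?num_real.
apply/andP; split.
  rewrite -(@ler_pXn2r _ 2) ?nnegrE ?normr_ge0 // t2 r2 ge_max h1; exact: sqr_ge0.
rewrite -(@ler_pXn2r _ 2) ?nnegrE ?normr_ge0 ?addr_ge0 // t2.
have al1 : al <= Num.max al 0 by rewrite le_max lexx.
have : 0 <= r * Num.sqrt w by rewrite mulr_ge0.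
by rewrite sqrrD r2 u2; lra.
Qed.

Definition window (c al w : R) : set R := [set t : R | al <= (t - c) ^+ 2 <= al + w].

(** The window lies in two intervals of length sqrt w, by sqrt (a + w) <= sqrt a + sqrt w with a the
    positive part of al. *)
Lemma lebesgue_window c al w : 0 <= w -> measurable (window c al w) ->
  (lebesgue_measure (window c al w) <= (2 * Num.sqrt w)%:E)%E.
Proof.
move=> w0 mW; set r := Num.sqrt (Num.max al 0); set u := Num.sqrt w.
have u0 : 0 <= u by exact: sqrtr_ge0.
pose I1 : set R := [set` `[c + r, c + r + u]]; pose I2 : set R := [set` `[c - r - u, c - r]].
have E (x : R) : lebesgue_measure ([set` `[x, x + u]] : set R) = u%:E.
  rewrite lebesgue_measure_itv /= lte_fin ltrDl; case: ltP => [_|h]; first by rewrite -EFinB addrAC subrr add0r.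
  by have -> : u = 0 by [apply/le_anti; rewrite h u0].
have E1 : lebesgue_measure I1 = u%:E by exact: E.
have E2 : lebesgue_measure I2 = u%:E.
  by rewrite /I2; have {2}-> : c - r = c - r - u + u by [rewrite subrK]; exact: E.
have mI1 : measurable I1 by exact: measurable_itv.
have mI2 : measurable I2 by exact: measurable_itv.
apply: (@le_trans _ _ (lebesgue_measure (I1 `|` I2))).
  apply: le_measure; [exact/mem_set|by apply/mem_set; exact: measurableU|].
  move=> t /= h; have := sqrt_window w0 h; rewrite -/r -/u /= => /andP[a b].
  have [tc|tc] := lerP 0 (t - c).
    by left; rewrite /I1 /= in_itv /=; rewrite ger0_norm // in a b; apply/andP; split; lra.
  by right; rewrite /I2 /= in_itv /=; rewrite ltr0_norm // in a b; apply/andP; split; lra.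
apply: (@le_trans _ _ (lebesgue_measure I1 + lebesgue_measure I2)%E); first exact: measureU2.
by rewrite E1 E2 -EFinD lee_fin; lra.
Qed.

(** Integration over vertical sections, each contained in a window. The bound is uniform in c and s,
    as the union over all anchor boxes requires. *)
Lemma vol_annulus q c s w : 0 <= w -> vol (annulus q c s w) <= 4 * q%:R * Num.sqrt (2 * w).
Proof.
move=> w0; have gA := good_annulus q c s w; case: (gA) => mA _.
have q0 : 0 <= q%:R :> R by [].
suff H : (leb2 (annulus q c s w) <= (4 * q%:R * Num.sqrt (2 * w))%:E)%E.
  by rewrite /vol -lee_fin fineK // leb2_fin.
pose D : set R := [set` `[- q%:R, q%:R[].
have mD : measurable D by exact: measurable_itv.
pose f := lebesgue_measure \o xsection (annulus q c s w).
have mf : measurable_fun setT f by exact: measurable_fun_xsection.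
have f0 x : (0 <= f x)%E by exact: measure_ge0.
have fD x : D x -> (f x <= (2 * Num.sqrt (2 * w))%:E)%E.
  move=> Dx.
  pose al := s - w - (x - c.1) ^+ 2.
  have mW : measurable (window c.2 al (2 * w)).
    rewrite -[X in measurable X]setTI.
    have -> : window c.2 al (2 * w) =
       (fun t : R => (t - c.2) * (t - c.2)) @^-1` [set` `[al, al + 2 * w]].
      by apply/seteqP; split => t; rewrite /window /= in_itv /= expr2.
    have mm : measurable_fun setT (fun t : R => (t - c.2) * (t - c.2)).
      by apply: measurable_funM; apply: measurable_funB.
    by apply: mm => //; exact: measurable_itv.
  apply: le_trans (lebesgue_window _ mW); last by lra.
  apply: le_measure; [by apply/mem_set; exact: measurable_xsection|exact/mem_set|].
  move=> t; rewrite /xsection /= => /set_mem [_ /=]; rewrite /d2 /= /al => /andP[h1 h2].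
  by apply/andP; split; lra.
have fE : f = f \_ D.
  apply/funext => x; rewrite /patch; case: ifPn => // /negP nD.
  rewrite /f /=; suff -> : xsection (annulus q c s w) x = set0 by rewrite measure0.
  apply/seteqP; split => // t; rewrite /xsection /= => /set_mem [[/= Dx _] _].
  by apply: nD; apply/mem_set.
have -> : leb2 (annulus q c s w) = (\int[lebesgue_measure]_x f x)%E by [].
rewrite fE -integral_mkcond.
apply: (@le_trans _ _ (\int[lebesgue_measure]_(x in D) cst (2 * Num.sqrt (2 * w))%:E x)%E).
  apply: ge0_le_integral => //.
  exact: measurable_funTS.
rewrite integral_cst //.
have ED : lebesgue_measure D = (2 * q%:R)%:E.
  rewrite /D lebesgue_measure_itv /= lte_fin; case: ltP => h.
    by rewrite -EFinB opprK -mulr2n mulr_natl.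
  by congr EFin; lra.
apply: (@le_trans _ _ ((2 * Num.sqrt (2 * w))%:E * (2 * q%:R)%:E)%E); first by rewrite -ED.
rewrite -EFinM lee_fin.
by have := sqrtr_ge0 (2 * w); nra.
Qed.
End Annulus.

(** * Genericity of distances and abscissas *)

Section Generic.
Variable R : realType.
Local Notation pt := (pt2 R).
Local Notation M := (Mspace R).
Local Notation org := (org R).

Lemma sqr_shift (v a c q t : R) : `|v| <= q -> `|a| <= q -> `|c| <= q -> `|a - c| <= t ->
  `|(v - a) ^+ 2 - (v - c) ^+ 2| <= 4 * q * t.
Proof.
move=> v1 a1 c1 ac.
have -> : (v - a) ^+ 2 - (v - c) ^+ 2 = (2 * v - a - c) * (c - a) by ring.
rewrite normrM distrC in ac *; apply: ler_pM => //; rewrite ?normr_ge0 //.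
by move: v1 a1 c1; rewrite !ler_norml => /andP[? ?] /andP[? ?] /andP[? ?]; apply/andP; split; lra.
Qed.

Lemma d2_shift (v a c : pt) (q t : R) : supd v org <= q -> supd a org <= q -> supd c org <= q -> supd a c <= t ->
  `|d2 v a - d2 v c| <= 8 * q * t.
Proof.
move=> /supd_le[v1 v2] /supd_le[a1 a2] /supd_le[c1 c2] /supd_le[t1 t2].
rewrite /= !subr0 in v1 v2 a1 a2 c1 c2.
have := sqr_shift v1 a1 c1 t1; have := sqr_shift v2 a2 c2 t2.
by rewrite /d2 !ler_norml => /andP[h1 h2] /andP[h3 h4]; apply/andP; split; lra.
Qed.

Definition grid_corner (N : nat) (b : int * int) : pt := (b.1%:~R / N%:R, b.2%:~R / N%:R).

Lemma grid_corner_near (q N : nat) b (a : pt) : (0 < N)%N -> inr2 (q * N) b -> cell org N%:R^-1 b a ->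
  [/\ supd (grid_corner N b) org <= q%:R, supd a org <= q%:R & supd a (grid_corner N b) <= N%:R^-1].
Proof.
move=> N0 /andP[b1 b2] [a1 a2]; have N0' : 0 < N%:R :> R by rewrite ltr0n.
have E (x : int) (y : R) : inr (q * N) x -> 0 + x%:~R * N%:R^-1 <= y < 0 + (x + 1)%:~R * N%:R^-1 ->
  [/\ `|x%:~R / N%:R| <= q%:R :> R, `|y| <= q%:R & `|y - x%:~R / N%:R| <= N%:R^-1].
  move=> /andP[h1 h2]; rewrite !add0r intrD mulrDl mul1r => /andP[y1 y2].
  have x1 : - q%:R <= x%:~R / N%:R :> R.
    rewrite ler_pdivlMr // mulNr -natrM -(@ler_int R) in h1 *; by rewrite rmorphN /= in h1.
  have x2 : x%:~R / N%:R + N%:R^-1 <= q%:R :> R.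
    have h3 : x + 1 <= (q * N)%:Z by rewrite lezD1.
    by rewrite -{2}[N%:R^-1]mul1r -mulrDl ler_pdivrMr // -natrM -(@ler_int R) intrD in h3 *.
  have i0 : 0 < N%:R^-1 :> R by rewrite invr_gt0.
  by rewrite !ler_norml; split; apply/andP; split; lra.
have [p1 p2 p3] := E _ _ b1 a1; have [p4 p5 p6] := E _ _ b2 a2.
by split; apply/supd_le; rewrite /= ?subr0.
Qed.

Lemma bound_inv (x e : R) : 0 <= x -> 0 < e -> exists N0, forall N, (N0 <= N)%N -> (0 < N)%N -> x / N%:R <= e.
Proof.
move=> x0 e0; exists (Num.bound (x / e)) => N NN N0.
rewrite ler_pdivrMr ?ltr0n // mulrC -ler_pdivrMr //; apply: ltW.
by apply: lt_le_trans (archi_boundP _) _; rewrite ?ler_nat // divr_ge0 // ltW.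
Qed.

Variable P : probability M R.
Hypothesis HP : poisson_law P.

Lemma negligible_dist n (i j k : 'I_n) : P.-negligible [set S : M | exists a v,
  [/\ forall i, S (a i), S v, injective a, forall i, a i <> v & d2 (a i) (a j) = d2 (a k) v]].
Proof.
apply: (@negligible_coincidence R P HP n (fun a v => d2 (a i) (a j) = d2 (a k) v)).
move=> q e e0; have q0 : 0 <= q%:R :> R by [].
pose e' : R := e / (4 * q%:R + 1).
have e'0 : 0 < e' by rewrite divr_gt0 //; lra.
have [N0 HN] : exists N0, forall N, (N0 <= N)%N -> (0 < N)%N -> (48 * q%:R) / N%:R <= e' ^+ 2.
  by apply: bound_inv; [lra|rewrite exprn_gt0].
exists N0 => N NN Np b hb; have {HN} := HN N NN Np; set t : R := N%:R^-1 => ht.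
have t0 : 0 < t by rewrite invr_gt0 ltr0n.
pose c i := grid_corner N (b i).
(* Moving each of the three anchors to the corner of its box changes a squared distance by at most 8
   q t, hence the width 24 q t. *)
exists (annulus q (c k) (d2 (c i) (c j)) (24 * q%:R * t)); split.
- exact: good_annulus.
- apply: le_trans (vol_annulus _ _ _ _) _; first by rewrite !mulr_ge0 // ltW.
  have -> : 2 * (24 * q%:R * t) = 48 * q%:R * t by ring.
  have : Num.sqrt (48 * q%:R * t) <= e'.
    by rewrite -[leRHS]ger0_norm ?(ltW e'0) // -sqrtr_sqr ler_wsqrtr.
  set z := Num.sqrt _ => ze; apply: (@le_trans _ _ (4 * q%:R * e')); first by rewrite ler_wpM2l //; lra.
  rewrite /e' mulrA ler_pdivrMr; last by lra.
  by rewrite mulrC ler_wpM2l ?(ltW e0) //; lra.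
- move=> a v ca vq E.
  have H l := grid_corner_near Np (hb l) (ca l).
  have [ci ai ti] := H i; have [cj aj tj] := H j; have [ck ak tk] := H k.
  have vq' := ltW vq.
  split; first by move/supd_lt: vq; rewrite /= !subr0 !ltr_norml !in_itv /= => -[/andP[h1 h2] /andP[h3 h4]]; rewrite !ltW ?h2 ?h4.
  have s1 := d2_shift vq' ak ck tk; have s2 := d2_shift ai aj cj tj; have s3 := d2_shift cj ai ci ti.
  move: s1 s2 s3; rewrite -/t -/(c i) -/(c j) -/(c k) /= (d2C v (a k)) -E (d2C (c j) (a i)) (d2C (c j) (c i)) !ler_norml.
  by move=> /andP[h1 h2] /andP[h3 h4] /andP[h5 h6]; apply/andP; split; lra.
Qed.

(** The box of a single anchor confines v to a strip of width 1/N. The charging argument relies on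
    distinct abscissas. *)
Lemma negligible_sameX : P.-negligible [set S : M | exists a v, [/\ S a, S v, a <> v & a.1 = v.1]].
Proof.
apply: (@negligibleS _ _ _ _ [set S : M | exists (a : 'I_1 -> pt) v,
  [/\ forall i, S (a i), S v, injective a, forall i, a i <> v & (a ord0).1 = v.1]]).
  move=> S [a [v [Sa Sv av E]]]; exists (fun=> a), v; split=> //.
  by move=> i j _; rewrite !ord1.
apply: (@negligible_coincidence R P HP 1 (fun a v => (a ord0).1 = v.1)).
move=> q e e0; have q0 : 0 <= q%:R :> R by [].
have [N0 HN] : exists N0, forall N, (N0 <= N)%N -> (0 < N)%N -> (2 * q%:R) / N%:R <= e.
  by apply: bound_inv; [lra|].
exists N0 => N NN Np b hb; have {HN} := HN N NN Np; set t : R := N%:R^-1 => ht.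
have t0 : 0 < t by rewrite invr_gt0 ltr0n.
pose x : R := (b ord0).1%:~R * t.
exists ([set` `[x, x + t[] `*` [set` `[- q%:R, q%:R[]); split.
- split; first exact: measurable_rect.
  exists (`|x| + t + q%:R) => -[u v] [] /=; rewrite !in_itv /= => /andP[h1 h2] /andP[h3 h4].
  have := ler_norm x; have := ler_norm (- x); rewrite normrN => a1 a2.
  by rewrite !ler_norml; split; apply/andP; split; lra.
- rewrite /vol vol_rect /=; [|lra|lra].
  by have -> : (x + t - x) * (q%:R - - q%:R) = 2 * q%:R * t by ring.
- move=> a v /(_ ord0)[/andP[h1 h2] _] /supd_lt[_]; rewrite /= subr0 ltr_norml => /andP[h3 h4] E.
  split; last by rewrite /= in_itv /= h4 ltW.
  by move: h1 h2; rewrite intrD mulrDl mul1r /= !add0r in_itv /= -E => -> ->.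
Qed.
End Generic.

(** * Frequency of blocking configurations *)

Section Exp.
Variable R : realType.

Lemma expR1_ge2 : 2 <= expR 1 :> R.
Proof. by have := expR_ge1Dx (1 : R); rewrite (_ : 1 + 1 = 2 :> R). Qed.

Lemma expRN1_ge : 1 / 4 <= expR (- 1) :> R.
Proof.
have := expR_ge1Dx (- (1 / 2) : R); set a := expR _ => ha.
have -> : expR (- 1) = a * a :> R by rewrite /a -expRD; congr expR; lra.
by nra.
Qed.

Lemma expRN_le (v : R) : 1 <= v -> expR (- v) <= 1 / 2.
Proof.
move=> v1; apply: (@le_trans _ _ (expR (- 1))); first by rewrite ler_expR; lra.
have e1 : expR (- 1) * expR 1 = 1 :> R by rewrite -expRD addNr expR0.
by have := expR1_ge2; have := expR_gt0 (- 1 : R); nra.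
Qed.

Lemma expRN_pow (n : nat) : expR (- n%:R) <= (1 / 2) ^+ n :> R.
Proof.
have -> : - n%:R = n%:R * (- 1) :> R by rewrite mulrN1.
rewrite expRM_natl lerXn2r ?nnegrE ?expR_ge0 //.
exact: expRN_le.
Qed.
End Exp.

(** * The probability of a blocking configuration *)

Section Theta.
Variable R : realType.
Local Notation pt := (pt2 R).
Local Notation M := (Mspace R).
Variables (K T : nat) (j w : int).
Local Notation C := ('I_K.+1 * ('I_120 * 'I_120))%type.

Definition dec (ab : 'I_120 * 'I_120) : int * int := (ab.1%:Z - 60%:Z, ab.2%:Z - 60%:Z).

(** One family for all candidates, scales and boxes. At positive scales the inner boxes are replaced
    by the empty set, on which the requirement of no point has probability 1. *)
Definition tbox (x : 'I_T * C) : set pt :=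
  if (val x.2.1 == 0%N) || ~~ inr2 30 (dec x.2.2)
  then cell (site R K T j w x.1) (2 ^+ x.2.1) (dec x.2.2) else set0.

Definition tspec (x : 'I_T * C) : option nat :=
  if val x.2.1 == 0%N then
    if dec x.2.2 \in five then Some 1%N else if inr2 39 (dec x.2.2) then Some 0%N else None
  else if inr2 30 (dec x.2.2) then Some 0%N else None.

Lemma dec_inr ab : inr2 60 (dec ab).
Proof. by case: ab => a b; rewrite /dec /inr2 /inr /=; have := ltn_ord a; have := ltn_ord b; lia. Qed.

Lemma dec_surj z : inr2 60 z -> exists ab, dec ab = z.
Proof.
case: z => x y; rewrite /inr2 /inr /= => h.
have hx : (absz (x + 60%N%:Z)%R < 120)%N by move: h; lia.
have hy : (absz (y + 60%N%:Z)%R < 120)%N by move: h; lia.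
by exists (Ordinal hx, Ordinal hy); rewrite /dec /=; move: h => h; congr pair; lia.
Qed.

Lemma pow2_gt0 k : 0 < 2 ^+ k :> R. Proof. by rewrite exprn_gt0. Qed.

Lemma good_tbox x : good (tbox x).
Proof.
rewrite /tbox; case: ifP => _; first by apply: good_cell; rewrite exprn_ge0.
by split=> //; exists 0.
Qed.

Definition inbox o (r : R) (p : pt) := (- r <= p.1 - o.1 < r) && (- r <= p.2 - o.2 < r).

Lemma inbox_le o r r' p : r <= r' -> inbox o r p -> inbox o r' p.
Proof. by move=> h /andP[/andP[a b] /andP[c d]]; apply/andP; split; apply/andP; split; lra. Qed.

Lemma tbox_in (x : 'I_T * C) p : tbox x p -> inbox (site R K T j w x.1) (60 * 2 ^+ x.2.1) p.
Proof.
rewrite /tbox; case: ifP => // _ /(cellP_idx _ _ _ (pow2_gt0 _)) E.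
by have := dec_inr x.2.2; rewrite -E inr2_idx ?pow2_gt0.
Qed.

Lemma tbox_out (x : 'I_T * C) p : (0 < x.2.1)%N -> tbox x p -> ~~ inbox (site R K T j w x.1) (30 * 2 ^+ x.2.1) p.
Proof.
rewrite /tbox lt0n => /negbTE ->; case: ifP => //= H /(cellP_idx _ _ _ (pow2_gt0 _)) E.
by move: H; rewrite -E inr2_idx ?pow2_gt0.
Qed.

(** The inner radius 30 2^k of the ring at scale k is the outer radius 60 2^(k-1) of the scale
    below, and candidates are 120 2^K apart. Disjointness is what makes the requirements
    independent. *)
Lemma tbox_disj x y : x != y -> tbox x `&` tbox y = set0.
Proof.
move=> nxy; apply/seteqP; split=> // p [px py]; move: nxy => /eqP; apply.
have leK (z : 'I_T * C) : 60 * 2 ^+ z.2.1 <= 60 * 2 ^+ K :> R.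
  by rewrite ler_pM2l // ler_weXn2l ?ler1n // -ltnS.
have E1 : x.1 = y.1.
  have := inbox_le (leK x) (tbox_in px); have := inbox_le (leK y) (tbox_in py).
  rewrite /inbox /site /= !natrM !natrX => /andP[_ /andP[a1 a2]] /andP[_ /andP[b1 b2]].
  have t0 := pow2_gt0 K; move: a1 a2 b1 b2 t0; set t := 2 ^+ K; set c := w%:~R * _.
  move=> a1 a2 b1 b2 t0.
  have h1 : x.1%:R < y.1%:R + 1 :> R by rewrite -(ltr_pM2r t0); lra.
  have h2 : y.1%:R < x.1%:R + 1 :> R by rewrite -(ltr_pM2r t0); lra.
  apply: ord_inj; apply/eqP; move: h1 h2; rewrite !natr1 !ltr_nat !ltnS => h1 h2.
  by rewrite eqn_leq h1 h2.
have lt_scale (u v : 'I_T * C) : u.1 = v.1 -> tbox u p -> tbox v p -> ~ (u.2.1 < v.2.1)%N.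
  move=> E pu pv lt; have v0 : (0 < v.2.1)%N by apply: leq_ltn_trans lt.
  have /negP := tbox_out v0 pv; apply; rewrite -E; apply: inbox_le (tbox_in pu).
  have -> : 60 * 2 ^+ u.2.1 = 30 * 2 ^+ (u.2.1.+1) :> R by rewrite exprS mulrA; congr (_ * _); lra.
  by rewrite ler_pM2l // ler_weXn2l ?ler1n.
have E2 : x.2.1 = y.2.1.
  apply: ord_inj; have [h|h|//] := ltngtP x.2.1 y.2.1; first by case: (lt_scale _ _ E1 px py h).
  by case: (lt_scale _ _ (esym E1) py px h).
have E3 : dec x.2.2 = dec y.2.2.
  move: px py; rewrite /tbox E1 E2; case: ifP => // _ /(cellP_idx _ _ _ (pow2_gt0 _)) <-.
  by case: ifP => // _ /(cellP_idx _ _ _ (pow2_gt0 _)) <-.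
case: x y E1 E2 E3 {px py} => x1 [x2 [x3 x4]] [y1 [y2 [y3 y4]]] /= -> -> [E3 E4].
by have -> : x3 = y3 by [apply: ord_inj; lia]; have -> : x4 = y4 by [apply: ord_inj; lia].
Qed.

Lemma tbox_theta i S : gev tbox tspec i S -> Theta K (site R K T j w i) S.
Proof.
move=> H.
have H0 z : inr2 60 z -> ok (if z \in five then Some 1%N else if inr2 39 z then Some 0%N else None)
    (S `&` cell (site R K T j w i) 1 z).
  by move=> /dec_surj[ab <-]; have := H (ord0, ab); rewrite /tbox /tspec /= expr0.
split.
- move=> c c5; have : inr2 60 c by move: c5; rewrite !inE => /or4P[/eqP->|/eqP->|/eqP->|/orP[/eqP->|/eqP->]].
  by move/H0; rewrite c5.
- move=> c c39 c5; have : inr2 60 c by move: c39; rewrite /inr2 /inr; lia.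
  by move/H0; rewrite (negbTE c5) c39.
- move=> c c60 c39; have := H0 c c60; rewrite (negbTE c39); case: ifP => // c5.
  by move: c5 c39; rewrite !inE => /or4P[/eqP->|/eqP->|/eqP->|/orP[/eqP->|/eqP->]].
- move=> k c /andP[k0 kK] /dec_surj[ab <-] n30.
  have kK' : (k < K.+1)%N by [].
  have := H (Ordinal kK', ab); rewrite /tbox /tspec /= (negbTE n30) orbT.
  by rewrite eqn0Ngt k0.
Qed.

Lemma pmf0 (v : R) : poisson_mass v 0 = expR (- v).
Proof. by rewrite /poisson_mass expr0 fact0 divr1 mul1r. Qed.
Lemma pmf1 : poisson_mass 1 1 = expR (- 1) :> R.
Proof. by rewrite /poisson_mass expr1 divr1 mul1r. Qed.

Lemma expRN1_bounds : 1 / 4 <= expR (- (1 : R)) <= 1 / 2.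
Proof. by rewrite expRN1_ge expRN_le. Qed.

Lemma tpr_ge x : 1 / 4 <= pr (tspec x) (tbox x) <= 1.
Proof.
have /andP[e1 e2] := expRN1_bounds.
have v1 d : vol (cell (site R K T j w x.1) (2 ^+ 0) d) = 1 by rewrite vol_cell expr0 ?expr1n.
rewrite /tspec /tbox; case: eqP => [->|_] /=.
  case: ifP => _; [|case: ifP => _]; rewrite /pr v1 ?pmf1 ?pmf0; move: (expR (- 1)) e1 e2 => z h1 h2;
    apply/andP; split; lra.
case: ifP => h; rewrite ?h /= pmf0.
  by rewrite /vol (_ : leb2 set0 = 0%E) /= ?oppr0 ?expR0 ?lexx ?andbT; [lra|exact: measure0].
rewrite vol_cell ?exprn_ge0 //.
have t1 : 1 <= 2 ^+ x.2.1 :> R by rewrite exprn_ege1 // ler1n.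
have h1 : 1 <= (2 ^+ x.2.1) ^+ 2 :> R by rewrite exprn_ege1.
have := expRN_le h1; have := expR_ge0 (- (2 ^+ x.2.1) ^+ 2 : R).
by move: (expR _) => z h2 h3; apply/andP; split; lra.
Qed.

Lemma tgpr_ge i : (1 / 4) ^+ #|{: C}| <= gpr tbox tspec i <= 1.
Proof.
rewrite /gpr; apply/andP; split.
  rewrite -prodr_const; apply: ler_prod => c _.
  by have /andP[-> _] := tpr_ge (i, c); rewrite andbT; lra.
by apply: prodr_ile1 => c _; have /andP[h ->] := tpr_ge (i, c); rewrite andbT; apply: le_trans h; lra.
Qed.

Variable P : probability M R.
Hypothesis HP : poisson_law P.

(** A candidate succeeds with probability at least p = 4^(- #|C|), and T = q / p, so all fail with
    probability at most (1 - p)^T <= exp (- q). *)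
Lemma small_no_theta q : T = (4 ^ #|{: C}| * q)%N ->
  small P [set S : M | ~ exists2 i, (i < T)%N & Theta K (site R K T j w i) S] ((1 / 2) ^+ q).
Proof.
move=> TE.
have := @group_law R _ _ tbox tspec good_tbox tbox_disj P HP finset.set0 [set: 'I_T]%SET.
set X := [set S | _] => L.
have mX : measurable X.
  rewrite (_ : X = \bigcap_(i in [set: 'I_T]) ~` gev tbox tspec i).
    by apply: fin_bigcap_measurable => // i _; apply: measurableC; apply: measurable_gev good_tbox _.
  by apply/seteqP; split => S; [case=> _ H i _; apply: H; rewrite inE|move=> H; split=> [i|i _]; [rewrite inE|exact: H]].
apply: small_mono (small_measurable mX _) _ (lexx _); last first.
  move=> S /= N; split=> [i|i _ g]; first by rewrite inE.
  by apply: N; exists i => //; apply: tbox_theta.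
rewrite L; last by move=> i; rewrite inE.
rewrite lee_fin big_set0 mul1r.
apply: (@le_trans _ _ (\prod_(i in [set: 'I_T]%SET) expR (- ((1 / 4) ^+ #|{: C}|)))).
  apply: ler_prod => i _; have /andP[h1 h2] := tgpr_ge i.
  move: (gpr _ _ _) h1 h2 => g; move: (_ ^+ _) => p h1 h2.
  by apply/andP; split; [|have := expR_ge1Dx (- p)]; lra.
rewrite prodr_const cardsT card_ord -expRM_natl mulrN TE natrM natrX.
rewrite mulrAC -exprMn (_ : 4 * (1 / 4) = 1 :> R); last by lra.
by rewrite expr1n mul1r expRN_pow.
Qed.
End Theta.

(** * Choice of depth and width at scale K *)

Section Params.
Local Open Scope nat_scope.

(** Bernoulli's inequality (1 + 1/a)^k >= 1 + k/a, cleared of denominators. *)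
Lemma bernoulli a k : a ^ k * (a + k) <= (a + 1) ^ k * a.
Proof.
elim: k => [|k IH]; first by rewrite !expn0 addn0.
have h : a ^ k.+1 * (a + k.+1) <= (a + 1) * (a ^ k * (a + k)).
  by rewrite expnS; move: (a ^ k) => z; nia.
by apply: leq_trans h _; rewrite expnS -mulnA leq_mul2l IH orbT.
Qed.

Lemma double_pow a : 0 < a -> 2 * a ^ a <= (a + 1) ^ a.
Proof. by move=> a0; rewrite -(leq_pmul2r a0); have := bernoulli a a; move: (a ^ a) (_ ^ a) => x y; nia. Qed.

(** Growth by 1 + 1/a doubles within a steps, so a b steps overtake X; with a = 3 [ncard K] and b =
    2^K this is the choice of [depth]. *)
Lemma growth_factor a b X : 0 < a -> X < 2 ^ b -> a ^ (a * b) * X < (a + 1) ^ (a * b).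
Proof.
move=> a0 h; apply: (@leq_trans (a ^ (a * b) * 2 ^ b)); first by rewrite ltn_pmul2l // expn_gt0 a0.
rewrite !expnM -expnMn mulnC; case: b {h} => [|b]; first by rewrite !expn0.
by rewrite leq_exp2r // double_pow.
Qed.

(* a window of [sites K] candidates contains no blocking configuration with probability at most
   exp(- 2^K); [depth] and [width] are then large enough for [no_core] *)
Definition cells (K : nat) := #|{: 'I_K.+1 * ('I_120 * 'I_120)}|.
Definition sites K := 4 ^ cells K * 2 ^ K.
Definition ncard K := nbhd_card K (sites K) (2 ^ K).
Definition depth K := 3 * ncard K * 2 ^ K.
Definition width K := depth K * 2 ^ (K + 7).

Definition perCell := #|{: 'I_120 * 'I_120}|.
Lemma cellsE K : cells K = K.+1 * perCell.
Proof. by rewrite /cells /perCell card_prod card_ord. Qed.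

Lemma sitesE K : sites K = 2 ^ (2 * (K.+1 * perCell) + K).
Proof. by rewrite /sites cellsE expnD (expnM 2 2). Qed.

Lemma sites_gt0 K : 0 < sites K. Proof. by rewrite sitesE expn_gt0. Qed.

Lemma ncard_gt0 K : 0 < ncard K.
Proof. by rewrite /ncard /nbhd_card muln_gt0 !expn_gt0 addn_gt0 orbT. Qed.

Lemma ncard_le K : ncard K <= 2 ^ (24 + 5 * K + 4 * (K.+1 * perCell)).
Proof.
rewrite /ncard /nbhd_card sitesE; set e := K.+1 * perCell.
set h := 2 ^ (7 + 2 * K + 2 * e).
have H : 2 ^ (2 * e + K) * (120 * 2 ^ K) <= h.
  rewrite mulnCA -expnD /h (_ : 7 + 2 * K + 2 * e = 7 + (2 * e + K + K)); last by lia.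
  by rewrite [2 ^ (7 + _)]expnD leq_mul2r orbT.
have h0 : 0 < h by rewrite expn_gt0.
have H2 : 4 * (4 * (2 ^ (2 * e + K) * (120 * 2 ^ K))) + 4 <= 2 ^ 5 * h.
  move: H; set z := _ * (120 * _); rewrite (_ : 2 ^ 5 = 32) //; lia.
apply: (@leq_trans ((2 ^ 5 * h) ^ 2 * 2 ^ K)); first by rewrite leq_mul2r leq_exp2r // H2 orbT.
by rewrite /h -expnD -expnM -expnD leq_exp2l //; lia.
Qed.

Lemma width_le K : (4 * width K) ^ 2 * 4 ^ K <= 2 ^ (70 + 16 * K + 8 * (K.+1 * perCell)).
Proof.
have L := ncard_le K; set e := K.+1 * perCell in L *.
have H : 4 * width K <= 2 ^ (35 + 7 * K + 4 * e).
  rewrite /width /depth.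
  apply: (@leq_trans (2 ^ 2 * (2 ^ 2 * 2 ^ (24 + 5 * K + 4 * e) * 2 ^ K * 2 ^ (K + 7)))).
    by do 3 (apply: leq_mul => //); apply: leq_mul.
  by rewrite -!expnD leq_exp2l //; lia.
apply: (@leq_trans ((2 ^ (35 + 7 * K + 4 * e)) ^ 2 * 4 ^ K)); first by rewrite leq_mul2r leq_exp2r // H orbT.
by rewrite (_ : 4 = 2 ^ 2) // -!expnM -expnD leq_exp2l //; lia.
Qed.

Lemma sqr_le_pow2 k : 4 <= k -> k * k <= 2 ^ k.
Proof.
elim: k => // k IH; rewrite leq_eqVlt => /orP[/eqP <-//|]; rewrite ltnS => k4.
by have := IH k4; rewrite expnS; nia.
Qed.

(** The number of boxes of a candidate is linear in K because its rings are dyadic; hence [width K]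
    is 2^O(K), against a doubly exponential right-hand side. *)
Lemma good_scale K0 : exists K, [/\ K0 <= K, 0 < K & (4 * width K) ^ 2 * 4 ^ K < 2 ^ 2 ^ K].
Proof.
pose K := K0 + 16 * perCell + 200; exists K; split; [by rewrite /K; lia|by rewrite /K; lia|].
apply: leq_ltn_trans (width_le K) _; rewrite ltn_exp2l //.
have K4 : 4 <= K by rewrite /K; lia.
apply: leq_trans (sqr_le_pow2 K4).
have : 16 * perCell + 200 <= K by rewrite /K -addnA leq_addl.
by move: K perCell {K4} => K q; nia.
Qed.
End Params.

(** * Good environments at infinitely many scales *)

Section Tame.
Local Open Scope ring_scope.
Variable R : realType.
Local Notation pt := (pt2 R).
Local Notation M := (Mspace R).
Local Notation org := (org R).
Variable P : probability M R.
Hypothesis HP : poisson_law P.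

Definition GoodEnv K (S : set pt) := Env K (sites K) (2 ^ K) (width K) S.

(** The union bound over all requirements gives 40 A^2 x, and the hypothesis says that 16 A^2 4^K x
    is at most 1. *)
Lemma small_not_env K : (0 < K)%N -> ((4 * width K) ^ 2 * 4 ^ K < 2 ^ 2 ^ K)%N ->
  small P [set S : M | ~ GoodEnv K S] (3 / 2 ^+ K).
Proof.
move=> K0 HK; set A := width K; set x : R := (1 / 2) ^+ (2 ^ K).
have x0 : 0 <= x by rewrite exprn_ge0.
pose E1 := [set S : M | exists2 ij, ij \in zsquare A & ~ (S `&` cell org (2 ^+ K) ij !=set0)].
pose E2 := [set S : M | exists2 ij, ij \in zsquare (2 * A) &
  forall k, (k < 2 ^ K)%N -> ~ card_eq (S `&` cell org (1 / 2) ij) k].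
pose E3 := [set S : M | exists2 jw, jw \in zsquare A &
  ~ exists2 i, (i < sites K)%N & Theta K (site R K (sites K) jw.1 jw.2 i) S].
have s1 : small P E1 (((2 * A) * (2 * A))%:R * x).
  rewrite -size_zsquare; apply: small_bigU => ij _.
  have gc : good (cell org (2 ^+ K) ij) by apply: good_cell; rewrite exprn_ge0.
  have E : [set S : M | ~ (S `&` cell org (2 ^+ K) ij !=set0)] = [set S : M | ok (Some 0%N) (S `&` cell org (2 ^+ K) ij)].
    apply/seteqP; split => S /=; first by move=> h; apply/card_eq_set0; apply/eqP/negPn/negP => /set0P.
    by move=> /card_eq_set0 -> [].
  apply: (@small_measurable _ _ _ _ [set S : M | ~ (S `&` cell org (2 ^+ K) ij !=set0)]).
    by rewrite E; exact: measurable_ok.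
  rewrite E (count_law HP) // /pr pmf0 vol_cell ?exprn_ge0 // lee_fin.
  apply: le_trans (expRN_pow R (2 ^ K)); rewrite ler_expR lerN2 natrX expr2.
  by rewrite ler_peMl ?exprn_ge0 // exprn_ege1 // ler1n.
have s2 : small P E2 (((2 * (2 * A)) * (2 * (2 * A)))%:R * (2 * x)).
  rewrite -size_zsquare; apply: small_bigU => ij _.
  have gc : good (cell org (1 / 2) ij) by apply: good_cell.
  apply: small_mono (small_crowded HP (2 ^ K) gc _) _ _ => //; first by rewrite vol_cell //; lra.
  rewrite ler_pM2l // /x lerXn2r ?nnegrE //; lra.
have s3 : small P E3 (((2 * A) * (2 * A))%:R * x).
  rewrite -size_zsquare; apply: small_bigU => -[j w] _.
  exact: small_no_theta HP _ _.
apply: small_mono (smallU (smallU s1 s2) s3) _ _.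
  move=> S /= nE; apply: contrapT => H; apply: nE; split.
  - move=> ij h; apply: contrapT => n; apply: H; left; left; exists ij => //.
    by rewrite mem_zsquare.
  - move=> ij h; apply: contrapT => n; apply: H; left; right; exists ij; first by rewrite mem_zsquare.
    by move=> k km c; apply: n; exists k.
  - move=> j w hj hw; apply: contrapT => n; apply: H; right; exists (j, w) => //.
    by rewrite mem_zsquare /inr2 hj hw.
have HA : ((4 * A) ^ 2)%:R * x * 4 ^+ K <= 1.
  rewrite mulrAC -natrX -natrM /x div1r exprVn ler_pdivrMr ?exprn_gt0 // mul1r -natrX ler_nat.
  exact: ltnW.
clearbody A; have t0 : 0 < 2 ^+ K :> R by rewrite exprn_gt0.
have t1 : 1 <= 2 ^+ K :> R by rewrite exprn_ege1 // ler1n.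
have E4 : 4 ^+ K = 2 ^+ K * 2 ^+ K :> R by rewrite -exprMn; congr (_ ^+ _); lra.
rewrite ler_pdivlMr // !natrM; move: HA; rewrite natrX natrM E4.
have a0 : 0 <= A%:R :> R by [].
set y := A%:R ^+ 2 * x * 2 ^+ K.
have y0 : 0 <= y by rewrite !mulr_ge0 ?exprn_ge0 // ltW.
move=> HA; have {HA}: 16 * (y * 2 ^+ K) <= 1 by apply: le_trans HA; rewrite /y le_eqVlt; apply/orP; left; apply/eqP; ring.
have : y <= y * 2 ^+ K by rewrite ler_peMr.
move=> h1 h2; apply: (@le_trans _ _ (40 * y)); last by lra.
by rewrite /y le_eqVlt; apply/orP; left; apply/eqP; ring.
Qed.

(** For fixed K0 the event is contained in the failure at a single scale K, which can be taken
    arbitrarily large; no relation between different scales enters. *)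
Lemma env_infinitely_often : P.-negligible [set S : M | exists K0, forall K, (K0 <= K)%N -> (0 < K)%N ->
  ((4 * width K) ^ 2 * 4 ^ K < 2 ^ 2 ^ K)%N -> ~ GoodEnv K S].
Proof.
apply: negligible_countU => K0; apply: small_negligible => e e0.
have [K [h1 h2 h3]] := good_scale (maxn K0 (Num.bound (3 / e))).
apply: small_mono (small_not_env h2 h3) _ _.
  by move=> S H; apply: H => //; apply: leq_trans h1; rewrite leq_maxl.
rewrite ler_pdivrMr ?exprn_gt0 // mulrC -ler_pdivrMr //.
have : (Num.bound (3 / e) <= K)%N by apply: leq_trans h1; rewrite leq_maxr.
rewrite -(ler_nat R) => h4; apply: ltW; apply: lt_le_trans (archi_boundP _) _; first by rewrite divr_ge0 // ltW.
by apply: le_trans h4 _; rewrite -natrX ler_nat ltnW // ltn_expl.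
Qed.

End Tame.

(** * Tame configurations *)

Section Tame.
Variable R : realType.
Local Notation pt := (pt2 R).
Local Notation M := (Mspace R).
Local Notation org := (org R).

Definition generic (S : set pt) := forall x u y v, S x -> S u -> S y -> S v -> x <> u -> y <> v ->
  d2 x u = d2 y v -> (x = y /\ u = v) \/ (x = v /\ u = y).

(** All that the coloring uses of the Poisson process. A dependency chain from a point within L has
    at most 6 n steps of length at most 8 L, hence the radius. The remote u provides a distance that
    tells a point from its neighbours. *)
Definition tame (S : set pt) := [/\ locally_finite S, generic S & forall r : R, exists L n,
  [/\ r <= L, 0 < L,
    forall u v, adjp S u v -> supd u org <= L + (6 * n)%:R * (8 * L) -> supd v u <= 8 * L,
    forall y, supd y org <= L + (6 * n)%:R * (8 * L) -> ~ core S n y &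
    exists2 u, S u & forall x, supd x org <= L -> x <> u /\ ~ adjp S x u]].

Lemma room_arith (s L n : R) : 1 <= n -> 2 <= L -> s <= L + 6 * n * (8 * L) ->
  s + (n + 1) * (8 * L) + 3 <= 128 * (n * L).
Proof. by move=> n1 L2 h; have : 0 <= (n - 1) * L by [rewrite mulr_ge0; lra]; nra. Qed.

Lemma inr2_20 W : (20 < W)%N -> inr2 W (Posz 20, Posz 0).
Proof. by rewrite /inr2 /inr /=; lia. Qed.

(** The radius L + 48 n L, enlarged by what [no_core] needs around each point, stays below 128 n L,
    which is [width K]. *)
Lemma env_tame (S : set pt) K : locally_finite S -> (forall a b, S a -> S b -> a.1 = b.1 -> a = b) ->
  (0 < K)%N -> ((4 * width K) ^ 2 * 4 ^ K < 2 ^ 2 ^ K)%N -> GoodEnv K S ->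
  let L := 2 ^+ K : R in let n := depth K in
  [/\ forall u v, adjp S u v -> supd u org <= L + (6 * n)%:R * (8 * L) -> supd v u <= 8 * L,
    forall y, supd y org <= L + (6 * n)%:R * (8 * L) -> ~ core S n y &
    exists2 u, S u & forall x, supd x org <= L -> x <> u /\ ~ adjp S x u].
Proof.
move=> lf SX K0 HK env L n.
have L1 : 2 <= L by rewrite /L -(prednK K0) exprS ler_peMr // exprn_ege1 // ler1n.
have n0 : (0 < n)%N by rewrite /n /depth 2!muln_gt0 ncard_gt0 expn_gt0.
have n1 : 1 <= n%:R :> R by rewrite ler1n.
have WE : (width K)%:R = 128 * (n%:R * L) :> R.
  have E (a b : nat) : (a * 2 ^ (b + 7))%N%:R = 128 * (a%:R * 2 ^+ b) :> R.
    by rewrite expnD (_ : (2 ^ 7)%N = 128%N) // mulnA natrM natrM natrX; ring.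
  exact: E.
have nL : L <= n%:R * L by rewrite ler_peMl //; lra.
have room u : supd u org <= L + (6 * n)%:R * (8 * L) -> supd u org + n.+1%:R * (8 * L) + 3 <= (width K)%:R.
  rewrite WE -[n.+1%:R]natr1 (natrM R 6 n); exact: (room_arith n1 L1).
have s0 := sites_gt0 K.
have short u v : adjp S u v -> supd u org <= L + (6 * n)%:R * (8 * L) -> supd v u <= 8 * L.
  move=> uv hu; have h := room u hu.
  have h2 : supd u org + 8 * L <= (width K)%:R.
    have : 0 <= n%:R * (8 * L) by rewrite mulr_ge0 //; lra.
    by move: h; rewrite -[n.+1%:R]natr1 mulrDl; lra.
  have [a b] : `|u.1 - v.1| < 8 * L /\ `|u.2 - v.2| < 8 * L.
    by apply: d2_sup; [lra|exact: (short_edge env uv h2)].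
  by apply/supd_le; rewrite distrC (ltW a) distrC (ltW b).
split=> //.
- move=> y hy; apply: (no_core K0 s0 lf SX env) (room y hy) _.
  rewrite /n /depth; apply: growth_factor; first by rewrite muln_gt0 ncard_gt0.
  apply: leq_ltn_trans HK; rewrite leq_mul2l; apply/orP; right.
  by rewrite leq_exp2r.
- case: env => e1 _ _.
  have A20 : (20 < width K)%N.
    rewrite /width expnD mulnCA -/n; have : (0 < 2 ^ K)%N by rewrite expn_gt0.
    by rewrite (_ : (2 ^ 7)%N = 128%N) //; nia.
  (* A point at abscissa at least 20 L is out of reach of edges of length 8 L issuing from the
     square of radius L. *)
  have [|u [Su [/andP[u1 _] _]]] := e1 (Posz 20, Posz 0).
    exact: inr2_20.
  rewrite /= add0r -/L in u1.
  have {u1} far : forall x, supd x org <= L -> 8 * L < supd u x.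
    move=> x /supd_le[x1 _]; rewrite ltNge; apply/negP => /supd_le[h _].
    by move: x1 h; rewrite /= subr0 !ler_norml => /andP[_ h1] /andP[_ h2]; lra.
  exists u => // x hx; have hu := far x hx; split.
    move=> E; move: hu; rewrite E ltNge; case/negP; apply/supd_le.
    by rewrite !subrr normr0; split; lra.
  move=> a; move: hu; rewrite ltNge; case/negP; apply: short a _.
  by apply: le_trans hx _; rewrite lerDl !mulr_ge0 //; lra.
Qed.

Variable P : probability M R.
Hypothesis HP : poisson_law P.

(** Two different pairs at equal distance either share one point, which is [Z2], or consist of four
    distinct points, which is [Z3]. *)
Lemma negligible_not_generic : P.-negligible [set S : M | ~ generic S].
Proof.
pose Z2 := [set S : M | exists (a : 'I_2 -> pt) v,
  [/\ forall i, S (a i), S v, injective a, forall i, a i <> v & d2 (a ord0) (a ord_max) = d2 (a ord0) v]].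
pose Z3 := [set S : M | exists (a : 'I_3 -> pt) v,
  [/\ forall i, S (a i), S v, injective a, forall i, a i <> v &
    d2 (a ord0) (a (inord 1)) = d2 (a ord_max) v]].
have N2 : P.-negligible Z2 by exact: negligible_dist.
have N3 : P.-negligible Z3 by exact: negligible_dist.
apply: (negligibleS _ (negligibleU N2 N3)) => S /= ng.
apply: contrapT => nZ; apply: ng => x u y v Sx Su Sy Sv xu yv E.
have iso a b c : S a -> S b -> S c -> a <> b -> a <> c -> d2 a b = d2 a c -> b = c.
  move=> Sa Sb Sc ab ac Ed; apply: contrapT => bc; apply: nZ; left.
  exists (fun i : 'I_2 => if i == ord0 then a else b), c; split=> //.
  - by move=> i; case: ifP.
  - by move=> [[|[|//]] hi] [[|[|//]] hj] //= H; apply: ord_inj => //=; case: ab.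
  - by move=> i; case: ifP.
have [xy|xy] := pselect (x = y); first by left; split=> //; subst y; exact: (iso x).
have [xv|xv] := pselect (x = v); first by right; split=> //; subst v; apply: (iso x) => //; rewrite E d2C.
have [uy|uy] := pselect (u = y).
  by exfalso; subst u; apply: xv; apply: (iso y x v Sy Sx Sv (fun h => xu (esym h)) yv); rewrite d2C.
have [uv|uv] := pselect (u = v).
  by exfalso; subst u; apply: xy; apply: (iso v x y Sv Sx Sy (fun h => xu (esym h)) (fun h => yv (esym h))); rewrite d2C E d2C.
exfalso; apply: nZ; right.
exists (fun i : 'I_3 => if val i == 0%N then x else if val i == 1%N then u else y), v; split=> //.
- by move=> i; case: ifP => // _; case: ifP.
- by move=> [[|[|[|//]]] hi] [[|[|[|//]]] hj] //= H; apply: ord_inj => //=; exfalso; auto.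
- by move=> i; case: ifP => // _; case: ifP.
- by rewrite /= inordK.
Qed.

Lemma negligible_not_tame : P.-negligible [set S : M | ~ tame S].
Proof.
apply: (negligibleS _ (negligibleU (negligibleU (negligible_not_lf HP) negligible_not_generic)
  (negligibleU (negligible_sameX HP) (env_infinitely_often HP)))).
move=> S /= nt; apply: contrapT => H; apply: nt.
have lf : locally_finite S by apply: contrapT => n; apply: H; left; left.
split=> //; first by apply: contrapT => n; apply: H; left; right.
have SX a b : S a -> S b -> a.1 = b.1 -> a = b.
  by move=> Sa Sb E; apply: contrapT => n; apply: H; right; left; exists a, b.
move=> r; apply: contrapT => nr; apply: H; right; right; exists (Num.bound r) => K hK K0 HK env.
apply: nr; exists (2 ^+ K), (depth K); have [h1 h2 h3] := env_tame lf SX K0 HK env.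
split; [|by rewrite exprn_gt0|exact: h1|exact: h2|exact: h3].
have [r0|r0] := lerP 0 r; last by apply: le_trans (ltW r0) _; rewrite exprn_ge0.
apply: ltW; apply: lt_le_trans (archi_boundP r0) _.
by rewrite -natrX ler_nat (leq_trans hK) // ltnW // ltn_expl.
Qed.
End Tame.

(** * The coloring *)

Section Greedy.
Local Open Scope nat_scope.
Variables (T : choiceType) (prec : T -> T -> Prop).

(* [stage t i x]: x receives colour i, the least one unused by its predecessors, within t rounds *)
Fixpoint stage (t i : nat) (x : T) : Prop := if t is t'.+1 then
  [/\ forall y, prec y x -> exists j, stage t' j y,
      forall y, prec y x -> ~ stage t' i y &
      forall j, j < i -> exists2 y, prec y x & stage t' j y] else False.

(** Meaningful for every relation: a point with an infinite descending chain below it gets no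
    colour. The countable induction, in place of well-founded recursion, makes the relation
    measurable and compatible with bijections. *)
Definition greedy i x := exists t, stage t i x.

Lemma stage_inj t i j x : stage t i x -> stage t j x -> i = j.
Proof.
case: t => // t [_ a1 b1] [_ a2 b2]; have [h|h|//] := ltngtP i j.
  by have [y p s] := b2 i h; case: (a1 y p).
by have [y p s] := b1 j h; case: (a2 y p).
Qed.

Lemma stageS t i x : stage t i x -> stage t.+1 i x.
Proof.
elim: t i x => // t IH i x [h1 h2 h3]; split.
- by move=> y /h1[j /IH]; exists j.
- move=> y p s; have [j sj] := h1 y p; have sj' := IH _ _ sj.
  by apply: (h2 y p); rewrite -(stage_inj sj' s).
- by move=> j /h3[y p s]; exists y => //; apply: IH.
Qed.

Lemma stage_le t t' i x : t <= t' -> stage t i x -> stage t' i x.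
Proof. by move=> /subnK <- s; elim: (t' - t) => // n IH; rewrite addSn; apply: stageS. Qed.

Lemma greedy_inj i j x : greedy i x -> greedy j x -> i = j.
Proof.
move=> [t s] [t' s']; apply: (@stage_inj (maxn t t') _ _ x).
  by apply: stage_le s; rewrite leq_maxl.
by apply: stage_le s'; rewrite leq_maxr.
Qed.

Lemma greedy_prec i x y : greedy i x -> prec y x -> ~ greedy i y.
Proof.
move=> [[//|t] [h1 h2 _]] p gy; have [j sj] := h1 y p.
by apply: (h2 y p); rewrite (greedy_inj gy (ex_intro _ t sj)).
Qed.

(** Every colour below i occurs on a predecessor, and predecessors of different colours are
    distinct. *)
Lemma greedy_lt m i x : greedy i x ->
  ~ (exists s : seq T, [/\ uniq s, size s = m & forall y, y \in s -> prec y x]) -> i < m.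
Proof.
move=> [[//|t] [h1 h2 h3]] n; rewrite ltnNge; apply/negP => mi; apply: n.
have H k : k <= m -> exists s : seq T, [/\ uniq s, size s = k &
    forall y, y \in s -> prec y x /\ exists2 j, j < k & stage t j y].
  elim: k => [|k IH] km; first by exists [::].
  have [s [us ss Hs]] := IH (ltnW km); have [y p sy] := h3 k (leq_trans km mi).
  exists (y :: s); split=> /=.
  - rewrite us andbT; apply/negP => /Hs[_ [j jk sj]].
    by move: jk; rewrite (stage_inj sj sy) ltnn.
  - by rewrite ss.
  - move=> z; rewrite inE => /orP[/eqP ->|/Hs[pz [j jk sj]]]; first by split=> //; exists k.
    by split=> //; exists j => //; apply: leqW.
by have [s [us ss Hs]] := H m (leqnn m); exists s; split=> // y /Hs[].
Qed.

Lemma stage_ex (s : seq T) : (forall y, y \in s -> exists i, greedy i y) ->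
  exists t, forall y, y \in s -> exists i, stage t i y.
Proof.
elim: s => [|x s IH] H; first by exists 0.
have [t Ht] : exists t, forall y, y \in s -> exists i, stage t i y.
  by apply: IH => y ys; apply: H; rewrite inE ys orbT.
have [i [t' st']] := H x (mem_head _ _).
exists (maxn t t') => y; rewrite inE => /orP[/eqP ->|/Ht[j sj]].
  by exists i; apply: stage_le st'; rewrite leq_maxr.
by exists j; apply: stage_le sj; rewrite leq_maxl.
Qed.

Lemma least (Q : nat -> Prop) : (exists i, Q i) -> exists i, Q i /\ forall j, j < i -> ~ Q j.
Proof.
move=> ex; have ex' : exists i, `[< Q i >] by case: ex => i /asboolP Qi; exists i.
exists (ex_minn ex'); case: ex_minnP => i /asboolP Qi H; split=> // j ji /asboolP Qj.
by have := H j Qj; rewrite leqNgt ji.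
Qed.

(** Finiteness enters twice: for a number of rounds common to all predecessors, and for a colour
    that none of them has. *)
Lemma greedy_ex x : (forall z, finite_set [set y | prec y z]) -> Acc prec x -> exists i, greedy i x.
Proof.
move=> fin; elim=> {}x _ IH.
have [s Es] := (finite_seqP _).1 (fin x).
have memE y : prec y x <-> y \in s by split=> [p|ys]; [have : [set` s] y by rewrite -Es|have : [set y | prec y x] y by rewrite Es].
have [t Ht] : exists t, forall y, y \in s -> exists i, stage t i y.
  by apply: stage_ex => y /memE /IH.
have [c Hc] : exists c : T -> nat, forall y, y \in s -> stage t (c y) y.
  have H0 y : exists i, y \in s -> stage t i y.
    by have [ys|ys] := boolP (y \in s); [have [i si] := Ht y ys; exists i|exists 0].
  by have [c Hc] := choice H0; exists c.
have [] := @least (fun i => forall y, prec y x -> ~ stage t i y).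
  exists (\max_(y <- s) c y).+1 => y /memE ys sy.
  have := @leq_bigmax_seq _ s xpredT c y ys isT.
  by rewrite (stage_inj (Hc y ys) sy) ltnn.
move=> i [Hi Hlt]; exists i, t.+1; split=> //.
  by move=> y /memE ys; apply: Ht.
move=> j /Hlt H; apply: contrapT => n; apply: H => y p s'.
by apply: n; exists y.
Qed.
End Greedy.

(** * Labels and the two greedy rounds *)

Section Coloring.
Variable R : realType.
Local Notation pt := (pt2 R).
Local Notation org := (org R).
Implicit Types (S : set pt) (x y u v : pt).

(** Enumerates the rational intervals; a number that codes no pair yields an empty interval. *)
Definition itvl (i : nat) : rat * rat := odflt (0, 0) (choice.unpickle i).

(* the distances realised from x, probed along the rational intervals *)
Definition hasd S i x := exists u, [/\ S u, x <> u & ratr (itvl i).1 < d2 x u < ratr (itvl i).2].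
(** Two adjacent points cannot both be separated by the same interval; the least separating interval
    therefore serves as a label. *)
Definition sep S i x := hasd S i x /\ forall y, adjp S x y -> ~ hasd S i y.
Definition lab S i x := sep S i x /\ forall j, (j < i)%N -> ~ sep S j x.
(** Equality of stages, in a form that also makes sense for points that never leave the cores. *)
Definition same S x y := forall n, core S n x <-> core S n y.
Definition prec1 S y x := [/\ adjp S x y, same S x y &
  exists i j, [/\ (i < j)%N, lab S i y & lab S j x]].
Definition prec2 S y x := adjp S x y /\ ((exists n, core S n y /\ ~ core S n x) \/
  (same S x y /\ exists i j, [/\ (i < j)%N, greedy (prec1 S) i y & greedy (prec1 S) j x])).

Lemma lab_inj S i j x : lab S i x -> lab S j x -> i = j.
Proof.
move=> [a1 b1] [a2 b2]; have [h|h|//] := ltngtP i j; first by case: (b2 i h).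
by case: (b1 j h).
Qed.

Lemma lab_adj S i x y : adjp S x y -> lab S i x -> ~ lab S i y.
Proof. by move=> a [[_ h] _] [[h' _] _]; apply: (h y). Qed.

(** Labels decrease along [prec1]. They are unbounded, though, so the second round is ordered by the
    six values of the first one and not by labels. *)
Lemma acc_prec1 S x : Acc (prec1 S) x.
Proof.
have H i : forall z j, (j < i)%N -> lab S j z -> Acc (prec1 S) z.
  elim: i => [z j|i IH z j ji lz]; first by rewrite ltn0.
  constructor => y [_ _ [k [l [kl ly lz']]]].
  apply: (IH y k) ly; rewrite (lab_inj lz lz') in ji; exact: (leq_trans kl ji).
constructor => y [_ _ [i [j [_ ly _]]]].
exact: (H i.+1 y i).
Qed.

Lemma finite_box S r : locally_finite S -> finite_set (S `&` [set v | supd v org <= r]).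
Proof.
move=> lf; apply: lf; exists r => v /= /supd_le[].
by rewrite /= !subr0.
Qed.

Lemma gap (s : R) (l : seq R) : s \notin l -> exists2 e, 0 < e & forall d, d \in l -> e <= `|d - s|.
Proof.
elim: l => [|a l IH]; first by exists 1.
rewrite inE negb_or => /andP[sa /IH[e e0 He]].
exists (Num.min e `|a - s|); first by rewrite lt_min e0 normr_gt0 subr_eq0 eq_sym.
move=> d; rewrite inE ge_min => /orP[/eqP ->|/He ->//]; by rewrite lexx orbT.
Qed.

Section Tame.
Variable S : set pt.
Hypothesis St : tame S.

Let lf : locally_finite S. Proof. by case: St. Qed.

Lemma nbrs_finite x : finite_set [set y | adjp S x y].
Proof.
have [Sx|nSx] := pselect (S x); last first.
  by apply: (sub_finite_set _ (finite_set0 _)) => y a; case: nSx; case: (adjp_mem a).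
have [_ _ /(_ (supd x org))[L [n [xL L0 short _ _]]]] := St.
apply: (sub_finite_set _ (finite_box (supd x org + 8 * L) lf)) => y /= a.
split; first by case: (adjp_mem a).
have h : supd y x <= 8 * L.
  by apply: short a _; apply: le_trans xL _; rewrite lerDl !mulr_ge0 // ltW // mulr_gt0.
by have := supd_tri h (lexx (supd x org)); rewrite addrC.
Qed.

Lemma level x : S x -> exists n, core S n x /\ ~ core S n.+1 x.
Proof.
move=> Sx; have [_ _ /(_ (supd x org))[L [n [xL L0 _ nc _]]]] := St.
have [] := @least (fun n => ~ core S n x).
  exists n; apply: nc; apply: le_trans xL _; rewrite lerDl !mulr_ge0 // ltW // mulr_gt0 //.
move=> [|m] [h1 h2]; first by case: h1.
exists m; split; last exact: h1.
by apply: contrapT; apply: h2.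
Qed.

Lemma core_le n m x : core S n x -> ~ core S m x -> (n < m)%N.
Proof. by move=> h1 h2; rewrite ltnNge; apply/negP => /core_decr/(_ _ h1). Qed.

(** Let s be the squared distance from x to a point u neither equal nor adjacent to x. By genericity
    no neighbour of x realises s, and by local finiteness a rational interval around s avoids
    everything that the neighbours realise. *)
Lemma lab_ex x : S x -> exists i, lab S i x.
Proof.
move=> Sx; apply: least.
have [_ gen /(_ (supd x org))[L [n [xL L0 short _ [u Su /(_ x xL)[xu nxu]]]]]] := St.
set s := d2 x u.
have [ly Ely] := (finite_seqP _).1 (nbrs_finite x).
have [lw Elw] := (finite_seqP _).1 (finite_box (supd x org + 8 * L + (s + 2)) lf).
have s0 : 0 < s.
  by rewrite lt0r d2_ge0 andbT; apply/eqP => /d2_eq0.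
have [|e e0 He] := @gap s [seq d2 y v | y <- ly, v <- lw].
  apply/negP => /allpairsP[[y v] /= [yl vl E]].
  have a : adjp S x y by have : [set` ly] y by []; rewrite -Ely.
  have [Sv _] : (S `&` [set v | supd v org <= supd x org + 8 * L + (s + 2)]) v by rewrite Elw.
  have [_ Sy] := adjp_mem a.
  have yv : y <> v by move=> yv; move: s0; rewrite E yv d2xx ltxx.
  have [[xy _]|[xv uy]] := gen _ _ _ _ Sx Su Sy Sv xu yv E; first by case: a.
  by apply: nxu; rewrite uy.
have [p] : exists p, ratr p \in `]Num.max (s - e) 0, s[.
  by apply: rat_in_itvoo; rewrite gt_max s0 gtrBl e0.
(* The cap s + 1 confines every competing v to the finite box [lw]. *)
have [q] : exists q, ratr q \in `]s, Num.min (s + e) (s + 1)[.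
  by apply: rat_in_itvoo; rewrite lt_min !ltrDl e0 ltr01.
rewrite !in_itv /= lt_min gt_max => /andP[q1 /andP[q2 q3]] /andP[/andP[p1 p2] p3].
exists (choice.pickle (p, q)).
have E : itvl (choice.pickle (p, q)) = (p, q) by rewrite /itvl choice.pickleK.
rewrite /sep /hasd E /=; split; first by exists u; rewrite p3 q1.
move=> y a [v [Sv yv /andP[h1 h2]]].
have yl : y \in ly by have : [set y | adjp S x y] y by []; rewrite Ely.
have hyx : supd y x <= 8 * L.
  by apply: short a _; apply: le_trans xL _; rewrite lerDl !mulr_ge0 // ltW // mulr_gt0.
have hvy : supd v y <= s + 2.
  apply: d2_supd_le; first by lra.
  by rewrite d2C; nra.
have vl : v \in lw.
  have : (S `&` [set v | supd v org <= supd x org + 8 * L + (s + 2)]) v.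
    split=> //=; have := supd_tri hvy (supd_tri hyx (lexx (supd x org))); lra.
  by rewrite Elw.
have := He (d2 y v); rewrite allpairs_f // => /(_ isT).
by rewrite ler_normr => /orP[]; lra.
Qed.

Lemma finite_prec1 x : finite_set [set y | prec1 S y x].
Proof. by apply: (sub_finite_set _ (nbrs_finite x)) => y [a _ _]. Qed.
Lemma finite_prec2 x : finite_set [set y | prec2 S y x].
Proof. by apply: (sub_finite_set _ (nbrs_finite x)) => y [a _]. Qed.

(** Serves both rounds: a point of core n outside core n+1 has at most five neighbours in core n. *)
Lemma few_prec (prec : pt -> pt -> Prop) x : S x ->
  (forall y n, prec y x -> core S n x -> ~ core S n.+1 x -> adjp S x y /\ core S n y) ->
  ~ (exists s : seq pt, [/\ uniq s, size s = 6%N & forall y, y \in s -> prec y x]).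
Proof.
move=> Sx H [s [us ss Hs]]; have [n [h1 h2]] := level Sx.
apply: (h2); split; first exact: h1.
by exists s; split=> // y /Hs/H/(_ h1 h2)[].
Qed.

Lemma greedy1_ex x : exists i, greedy (prec1 S) i x.
Proof. by apply: greedy_ex (@acc_prec1 S x); exact: finite_prec1. Qed.

Lemma greedy1_lt i x : S x -> greedy (prec1 S) i x -> (i < 6)%N.
Proof.
move=> Sx g; apply: (greedy_lt g); apply: few_prec => // y n [a e _] c _.
by split=> //; apply/(e n).
Qed.

(* a step of prec2 raises 6 * level + (5 - greedy value), so a long chain ends in a deep core *)
Lemma acc_prec2 x : S x -> Acc (prec2 S) x.
Proof.
move=> Sx; have [_ _ /(_ (supd x org))[L [n [xL L0 short nc _]]]] := St.
pose pot k y := exists l i, [/\ core S l y, greedy (prec1 S) i y, (i < 6)%N & (k + i <= 6 * l + 5)%N].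
have L8 : 0 < 8 * L by rewrite mulr_gt0.
have mono k : (k <= 6 * n)%N -> L + k%:R * (8 * L) <= L + (6 * n)%:R * (8 * L).
  by move=> h; rewrite lerD2l ler_pM2r // ler_nat.
have H d : forall k y, (k + d = 6 * n)%N -> supd y org <= L + k%:R * (8 * L) -> pot k y -> Acc (prec2 S) y.
  elim: d => [|d IH] k y kd yk [l [i [cl gi i6 hk]]].
    rewrite addn0 in kd; case: (nc y); first by rewrite -kd.
    by apply: core_decr cl; lia.
  constructor=> z pz; have yb := le_trans yk (mono k ltac:(lia)).
  apply: (IH k.+1); first by lia.
    have h := short _ _ (proj1 pz) yb.
    by have := supd_tri h yk; rewrite -natr1 mulrDl mul1r; lra.
  have [a [[m [cz ncy]]|[e [i' [j' [ij gz gy]]]]]] := pz.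
    have [j gj] := greedy1_ex z; have [_ Sz] := adjp_mem a; have j6 := greedy1_lt Sz gj.
    by have lm := core_le cl ncy; exists m, j; split=> //; lia.
  exists l, i'; have E := greedy_inj gi gy; split=> //; [by apply/(e l)|lia|lia].
have [i gi] := greedy1_ex x; have i6 := greedy1_lt Sx gi.
apply: (H (6 * n)%N 0%N) => //; first by rewrite mul0r addr0.
by exists 0%N, i; split=> //; lia.
Qed.

Lemma greedy2_ex x : S x -> exists2 i, (i < 6)%N & greedy (prec2 S) i x.
Proof.
move=> Sx; have [i g] := greedy_ex finite_prec2 (acc_prec2 Sx); exists i => //.
apply: (greedy_lt g); apply: few_prec => // y n [a [[m [cy ncx]]|[e _]]] c nc.
  by split=> //; apply: core_decr cy; apply: ltnW; apply: core_le c ncx.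
by split=> //; apply/(e n).
Qed.

(** Cores are nested, so different stages compare. For equal stages the labels of neighbours differ,
    one point precedes the other in the first round, and so their first values differ. *)
Lemma prec2_total x y : adjp S x y -> prec2 S x y \/ prec2 S y x.
Proof.
move=> a; have a' := adjpC a; have [Sx Sy] := adjp_mem a.
have [e|ne] := pselect (same S x y); last first.
  apply: contrapT => N; apply: ne => n; split=> c; apply: contrapT => nc; apply: N.
    by left; split=> //; left; exists n.
  by right; split=> //; left; exists n.
have e' : same S y x by move=> n; split=> /e.
have [i gi] := greedy1_ex x; have [j gj] := greedy1_ex y.
have [h|h|E] := ltngtP i j.
- by left; split=> //; right; split=> //; exists i, j.
- by right; split=> //; right; split=> //; exists j, i.
exfalso; subst j; have [k lk] := lab_ex Sx; have [l ll] := lab_ex Sy.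
have [h|h|E] := ltngtP k l.
- by apply: (greedy_prec gj _ gi); split=> //; exists k, l.
- by apply: (greedy_prec gi _ gj); split=> //; exists l, k.
by subst l; apply: (lab_adj a lk).
Qed.
End Tame.

(** Empty unless S is locally finite, which keeps the map measurable on all of [Mspace]. *)
Definition coloring S (i : 'I_6) : set pt := [set x | [/\ locally_finite S, S x & greedy (prec2 S) i x]].

Lemma coloring_lf S i : locally_finite S -> locally_finite (coloring S i).
Proof. by move=> lf B /lf; apply: sub_finite_set => x [[_ Sx _] Bx]. Qed.

Lemma coloring_proper S : tame S -> proper_coloring S (coloring S).
Proof.
move=> St; have [lf _ _] := St; split.
- move=> x; split=> [Sx|[i []]//].
  by have [i i6 g] := greedy2_ex St Sx; exists (Ordinal i6).
- move=> i j ij; apply/seteqP; split=> // x [[_ _ gi] [_ _ gj]].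
  by move: ij => /eqP; apply; apply: ord_inj; apply: greedy_inj gi gj.
- move=> i x y xy [_ _ gx] [_ _ gy] a.
  have [p|p] := prec2_total St (conj xy a).
    exact: (greedy_prec gy p gx).
  exact: (greedy_prec gx p gy).
Qed.
End Coloring.

(** * Equivariance *)

Lemma stage_transfer (T U : choiceType) (g : T -> U) (p : T -> T -> Prop) (p' : U -> U -> Prop) :
  (forall z, exists x, g x = z) -> (forall x y, p' (g x) (g y) <-> p x y) ->
  forall t i x, stage p' t i (g x) <-> stage p t i x.
Proof.
move=> surj H; elim=> // t IH i x; split=> -[h1 h2 h3]; split.
- by move=> y /H/h1[j /IH]; exists j.
- by move=> y /H q /IH; apply: h2.
- by move=> j /h3[z]; have [y <-] := surj z; move=> /H q /IH s; exists y.
- by move=> z; have [y <-] := surj z; move=> /H/h1[j /IH]; exists j.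
- by move=> z; have [y <-] := surj z; move=> /H q /IH; apply: h2.
- by move=> j /h3[y /H q /IH s]; exists (g y).
Qed.

Lemma greedy_transfer (T U : choiceType) (g : T -> U) (p : T -> T -> Prop) (p' : U -> U -> Prop) :
  (forall z, exists x, g x = z) -> (forall x y, p' (g x) (g y) <-> p x y) ->
  forall i x, greedy p' i (g x) <-> greedy p i x.
Proof.
by move=> surj H i x; split=> -[t s]; exists t; move: s => /(stage_transfer surj H).
Qed.

Section Isometry.
Variable R : realType.
Local Notation pt := (pt2 R).
Variable g : pt -> pt.
Hypothesis isog : is_isometry g.

Lemma iso_d2 x y : d2 (g x) (g y) = d2 x y.
Proof.
by have := isog x y; rewrite /edist -/(d2 _ _) -/(d2 x y) => /(congr1 (fun z => z ^+ 2)); rewrite !sqr_sqrtr ?d2_ge0.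
Qed.

Lemma iso_inj : injective g.
Proof. by move=> x y E; apply: d2_eq0; rewrite -iso_d2 E d2xx. Qed.

Lemma orthonormal_inj (a1 a2 b1 b2 w1 w2 : R) :
  a1 ^+ 2 + a2 ^+ 2 = 1 -> b1 ^+ 2 + b2 ^+ 2 = 1 -> a1 * b1 + a2 * b2 = 0 ->
  w1 * a1 + w2 * a2 = 0 -> w1 * b1 + w2 * b2 = 0 -> w1 = 0 /\ w2 = 0.
Proof.
move=> a b ab wa wb.
have D : (a1 * b2 - a2 * b1) ^+ 2 = 1.
  transitivity ((a1 ^+ 2 + a2 ^+ 2) * (b1 ^+ 2 + b2 ^+ 2) - (a1 * b1 + a2 * b2) ^+ 2); first by ring.
  by rewrite a b ab; ring.
have D0 : a1 * b2 - a2 * b1 != 0 by apply/eqP => E; move: D; rewrite E expr0n /= => /eqP; rewrite eq_sym oner_eq0.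
have E1 : w1 * (a1 * b2 - a2 * b1) = 0.
  transitivity ((w1 * a1 + w2 * a2) * b2 - (w1 * b1 + w2 * b2) * a2); first by ring.
  by rewrite wa wb; ring.
have E2 : w2 * (a1 * b2 - a2 * b1) = 0.
  transitivity ((w1 * b1 + w2 * b2) * a1 - (w1 * a1 + w2 * a2) * b1); first by ring.
  by rewrite wa wb; ring.
by split; apply: (mulIf D0); rewrite mul0r.
Qed.

(** [is_isometry] only preserves distances. The images of the unit vectors form an orthonormal frame
    at the image of the origin; the point whose coordinates are those of z in this frame is sent to
    z, as the scalar products with the frame agree. *)
Lemma iso_surj z : exists x, g x = z.
Proof.
pose c := g (0, 0); pose a1 := (g (1, 0)).1 - c.1; pose a2 := (g (1, 0)).2 - c.2.
pose b1 := (g (0, 1)).1 - c.1; pose b2 := (g (0, 1)).2 - c.2.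
pose x := ((z.1 - c.1) * a1 + (z.2 - c.2) * a2, (z.1 - c.1) * b1 + (z.2 - c.2) * b2).
exists x.
have Ha := iso_d2 (1, 0) (0, 0); have Hb := iso_d2 (0, 1) (0, 0).
have Hab := iso_d2 (1, 0) (0, 1).
have X0 := iso_d2 x (0, 0); have Xa := iso_d2 x (1, 0); have Xb := iso_d2 x (0, 1).
have [] := @orthonormal_inj a1 a2 b1 b2 ((g x).1 - z.1) ((g x).2 - z.2).
- by move: Ha; rewrite /d2 -/c /= /a1 /a2; lra.
- by move: Hb; rewrite /d2 -/c /= /b1 /b2; lra.
- move: Ha Hb Hab; rewrite /d2 -/c /a1 /a2 /b1 /b2; case: (g (1, 0)) => p1 p2; case: (g (0, 1)) => q1 q2.
  by case: (c) => c1 c2 /= h1 h2 h3; lra.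
- have : x.1 = (z.1 - c.1) * a1 + (z.2 - c.2) * a2 by [].
  move: Ha X0 Xa; rewrite /d2 -/c /a1 /a2; case: (g (1, 0)) => p1 p2; case: (g x) => q1 q2; case: (c) => c1 c2.
  by case: (x) => x1 x2 /= h1 h2 h3 h4; lra.
- have : x.2 = (z.1 - c.1) * b1 + (z.2 - c.2) * b2 by [].
  move: Hb X0 Xb; rewrite /d2 -/c /b1 /b2; case: (g (0, 1)) => p1 p2; case: (g x) => q1 q2; case: (c) => c1 c2.
  by case: (x) => x1 x2 /= h1 h2 h3 h4; lra.
by move=> /eqP + /eqP; rewrite !subr_eq0; case: (g x) => q1 q2 /= /eqP -> /eqP ->; case: (z).
Qed.

Variable S : set pt.
Local Notation gS := (g @` S).

Lemma img_mem x : gS (g x) <-> S x.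
Proof. by split=> [[y Sy /iso_inj <-]|Sx]; [|exists x]. Qed.

Lemma img_nearest2 x y z : nearest2 gS (g x) (g y) (g z) <-> nearest2 S x y z.
Proof.
split=> H w; first by move=> /img_mem/H; rewrite !iso_d2.
by move=> [v Sv <-]; rewrite !iso_d2; apply: H.
Qed.

Lemma img_adjp x y : adjp gS (g x) (g y) <-> adjp S x y.
Proof.
split=> /adjpP[n Sx Sy [z1 [z2 [n12 h1 h2]]]]; apply/adjpP; split.
- by move=> E; apply: n; rewrite E.
- by apply/img_mem.
- by apply/img_mem.
- have [w1 E1] := iso_surj z1; have [w2 E2] := iso_surj z2; subst z1 z2.
  by exists w1, w2; split; [move=> E; apply: n12; rewrite E|apply/img_nearest2|apply/img_nearest2].
- by move=> /iso_inj.
- by apply/img_mem.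
- by apply/img_mem.
- by exists (g z1), (g z2); split; [move=> /iso_inj|apply/img_nearest2|apply/img_nearest2].
Qed.

Lemma img_core n x : core gS n (g x) <-> core S n x.
Proof.
elim: n x => [|n IH] x; first exact: img_mem.
split=> -[c [s [us ss Hs]]]; split; try exact/IH.
- have [h Hh] := choice iso_surj.
  exists (map h s); rewrite size_map map_inj_uniq ?ss; last by move=> u v E; rewrite -(Hh u) E Hh.
  split=> // y /mapP[z /Hs[cz az] ->]; split; [apply/IH|apply/img_adjp]; by rewrite Hh.
- exists (map g s); rewrite size_map map_inj_uniq; last exact: iso_inj.
  by split=> // y /mapP[z /Hs[cz az] ->]; split; [apply/IH|apply/img_adjp].
Qed.

Lemma img_same x y : same gS (g x) (g y) <-> same S x y.
Proof. by split=> H n; have := H n; rewrite (propext (img_core n x)) (propext (img_core n y)). Qed.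

Lemma img_hasd i x : hasd gS i (g x) <-> hasd S i x.
Proof.
split=> [[u [[v Sv <-] xu d]]|[u [Su xu d]]].
  by exists v; rewrite iso_d2 in d; split=> // E; apply: xu; rewrite E.
by exists (g u); rewrite iso_d2; split; [apply/img_mem|move=> /iso_inj|].
Qed.

Lemma img_sep i x : sep gS i (g x) <-> sep S i x.
Proof.
split=> -[h1 h2]; (split; first by apply/img_hasd).
  by move=> y /img_adjp a /img_hasd; apply: h2.
by move=> z; have [y <-] := iso_surj z; move=> /img_adjp a /img_hasd; apply: h2.
Qed.

Lemma img_lab i x : lab gS i (g x) <-> lab S i x.
Proof. by split=> -[/img_sep h1 h2]; split=> // j ji /img_sep; apply: h2. Qed.

Lemma img_prec1 x y : prec1 gS (g x) (g y) <-> prec1 S x y.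
Proof.
by split=> -[/img_adjp a /img_same e [i [j [ij /img_lab li /img_lab lj]]]]; split=> //; exists i, j.
Qed.

Lemma img_prec2 x y : prec2 gS (g x) (g y) <-> prec2 S x y.
Proof.
have G i z := greedy_transfer iso_surj img_prec1 i z.
split=> -[/img_adjp a H]; split=> //.
  case: H => [[n [/img_core c nc]]|[/img_same e [i [j [ij /G gi /G gj]]]]].
    by left; exists n; split=> // /img_core.
  by right; split=> //; exists i, j.
case: H => [[n [c nc]]|[e [i [j [ij gi gj]]]]].
  by left; exists n; split; [apply/img_core|move=> /img_core].
by right; split; [apply/img_same|exists i, j; split=> //; apply/G].
Qed.

(** Preimages of bounded sets are bounded because |x|^2 <= 2 |g x|^2 + 2 |g 0|^2. *)
Lemma img_lf : locally_finite S -> locally_finite gS.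
Proof.
move=> lf B [r Hr].
have bB : Defs.bounded_set (g @^-1` B).
  pose D := d2 (g (0, 0)) (0, 0).
  exists (4 * r ^+ 2 + 2 * D + 1) => x /= /Hr[h1 h2].
  have E : d2 x (0, 0) <= 4 * r ^+ 2 + 2 * D.
    rewrite -iso_d2 /D /d2 /=; move: h1 h2; case: (g x) => a b; case: (g (0, 0)) => c d /=.
    rewrite !ler_norml => /andP[a1 a2] /andP[b1 b2]; rewrite !subr0.
    have := sqr_ge0 (a + c); have := sqr_ge0 (b + d).
    have : 0 <= (r - a) * (r + a) by rewrite mulr_ge0; lra.
    have : 0 <= (r - b) * (r + b) by rewrite mulr_ge0; lra.
    by rewrite !expr2; lra.
  move: E; rewrite /d2 /= !subr0; set F := 4 * _ + _ => E.
  have a1 := sqr_ge0 x.1; have a2 := sqr_ge0 x.2.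
  by rewrite !ler_norml; split; apply/andP; split; nra.
apply: sub_finite_set (finite_image g (lf _ bB)).
by move=> _ [[x Sx <-] Bx]; exists x.
Qed.

Lemma img_coloring i : locally_finite S -> g @` (coloring S i) = coloring gS i.
Proof.
move=> lf; have G k z := greedy_transfer iso_surj img_prec2 k z.
apply/seteqP; split=> [_ [x [_ Sx gx] <-]|_ [_ [x Sx <-] /G gx]].
  by split; [exact: img_lf|apply/img_mem|apply/G].
by exists x.
Qed.
End Isometry.

(** * Measurability *)

Section Measurable.
Variable R : realType.
Local Notation pt := (pt2 R).
Local Notation M := (Mspace R).
Local Notation org := (org R).
Implicit Types (A B : M -> Prop) (X Y Z : M -> pt).

Lemma measurable_lf : measurable [set S : M | locally_finite S].
Proof.
rewrite (_ : [set S | _] = ~` \bigcup_(ij : int * int) ~` \bigcup_k (count_event (cell org 1 ij) k : set M)).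
  apply: measurableC; apply: countable_bigcupT_measurable; first exact: countableP.
  move=> ij; apply: measurableC; apply: bigcupT_measurable => k.
  by apply: measurable_count; exact: good_cell.
apply/seteqP; split=> S /=.
  by move=> /locally_finite_cells h [ij _]; apply; have [k hk] := h ij; exists k.
move=> h; apply/locally_finite_cells => ij; apply: contrapT => n; apply: h; exists ij => // -[k _ hk].
by apply: n; exists k.
Qed.

Lemma supd_ge0 (a b : pt) : 0 <= supd a b.
Proof. by rewrite /supd le_max normr_ge0. Qed.

Lemma supd_eq0 (a b : pt) : supd a b = 0 -> a = b.
Proof.
move=> E; have /supd_le[] : supd a b <= 0 by rewrite E.
by rewrite !normr_le0 !subr_eq0; case: a b {E} => a1 a2 [b1 b2] /= /eqP -> /eqP ->.
Qed.

(** Measurability on locally finite configurations, whose points can be enumerated measurably. The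
    closure lemmas let a proof follow the syntax of a definition. *)
Definition mp A := measurable [set S : M | locally_finite S /\ A S].

Lemma mp_ext A B : (forall S, locally_finite S -> A S <-> B S) -> mp A -> mp B.
Proof.
move=> H; rewrite /mp => mA; rewrite (_ : [set S | _] = [set S : M | locally_finite S /\ A S]) //.
by apply/seteqP; split=> S [lf b]; split=> //; apply/(H S lf).
Qed.

Lemma mp_measurable A : measurable [set S : M | A S] -> mp A.
Proof. by move=> mA; apply: measurableI => //; exact: measurable_lf. Qed.

Lemma mp_and A B : mp A -> mp B -> mp (fun S => A S /\ B S).
Proof.
move=> mA mB; rewrite /mp (_ : [set S | _] = [set S : M | locally_finite S /\ A S] `&` [set S : M | locally_finite S /\ B S]).
  exact: measurableI.
by apply/seteqP; split=> S; [move=> [? []]|move=> [[? ?] []]].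
Qed.

Lemma mp_not A : mp A -> mp (fun S => ~ A S).
Proof.
move=> mA; rewrite /mp (_ : [set S | _] = [set S : M | locally_finite S] `\` [set S : M | locally_finite S /\ A S]).
  by apply: measurableD => //; exact: measurable_lf.
by apply/seteqP; split=> S [lf n]; split=> //; [case|move=> a; apply: n].
Qed.

Lemma mp_ex (I : countType) (A : I -> M -> Prop) : (forall i, mp (A i)) -> mp (fun S => exists i, A i S).
Proof.
move=> mA; rewrite /mp (_ : [set S | _] = \bigcup_i [set S : M | locally_finite S /\ A i S]).
  exact: countable_bigcupT_measurable.
by apply/seteqP; split=> S; [move=> [lf [i a]]; exists i|move=> [i _ [lf a]]; split=> //; exists i].
Qed.

Lemma mp_all (I : countType) (A : I -> M -> Prop) : (forall i, mp (A i)) -> mp (fun S => forall i, A i S).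
Proof.
move=> mA; apply: (@mp_ext (fun S => ~ exists i, ~ A i S)).
  move=> S _; split=> [n i|h [i]]; last by apply.
  by apply: contrapT => na; apply: n; exists i.
by apply: mp_not; apply: mp_ex => i; apply: mp_not.
Qed.

Lemma mp_imp A B : mp A -> mp B -> mp (fun S => A S -> B S).
Proof.
move=> mA mB; apply: (@mp_ext (fun S => ~ (A S /\ ~ B S))).
  by move=> S _; split=> [n a|h [a]]; [apply: contrapT => nb; apply: n|apply; apply: h].
by apply: mp_not; apply: mp_and => //; apply: mp_not.
Qed.

Lemma mp_or A B : mp A -> mp B -> mp (fun S => A S \/ B S).
Proof.
move=> mA mB; apply: (@mp_ext (fun S => ~ A S -> B S)).
  move=> S _; split=> [n|[a|b] na //]; have [a|na] := pselect (A S); [by left|by right; apply: n].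
by apply: mp_imp => //; apply: mp_not.
Qed.

Lemma mp_iff A B : mp A -> mp B -> mp (fun S => A S <-> B S).
Proof. by move=> mA mB; apply: mp_and; apply: mp_imp. Qed.

Lemma mp_const (Q : Prop) : mp (fun=> Q).
Proof.
apply: mp_measurable; have [q|nq] := pselect Q.
  by rewrite (_ : [set S | _] = setT); [exact: measurableT|apply/seteqP; split].
by rewrite (_ : [set S | _] = set0); [exact: measurable0|apply/seteqP; split].
Qed.

Local Notation mfun X := (measurable_fun setT X).

Lemma mp_fun (h : M -> R) (V : set R) : mfun h -> measurable V -> mp (fun S => V (h S)).
Proof.
move=> mh mV; apply: mp_measurable; rewrite -[X in measurable X]setTI; exact: mh.
Qed.

Lemma mfun_d2 X Y : mfun X -> mfun Y -> mfun (fun S => d2 (X S) (Y S)).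
Proof.
move=> mX mY; exact: (measurableT_comp (@measurable_d2 R) (measurable_fun_pair mX mY)).
Qed.

Lemma mp_eq X Y : mfun X -> mfun Y -> mp (fun S => X S = Y S).
Proof.
move=> mX mY; apply: (@mp_ext (fun S => ([set` `[0, 0]] : set R) (d2 (X S) (Y S)))).
  move=> S _ /=; rewrite in_itv /=; split=> [/andP[h1 h2]|->]; last by rewrite d2xx lexx.
  by apply: d2_eq0; apply/le_anti/andP.
by apply: mp_fun; [exact: mfun_d2|exact: measurable_itv].
Qed.

Lemma mp_le X Y Z (W : M -> pt) : mfun X -> mfun Y -> mfun Z -> mfun W ->
  mp (fun S => d2 (X S) (Y S) <= d2 (Z S) (W S)).
Proof.
move=> mX mY mZ mW; apply: (@mp_ext (fun S => ([set` `]-oo, 0]] : set R) (d2 (X S) (Y S) - d2 (Z S) (W S)))).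
  by move=> S _ /=; rewrite in_itv /= subr_le0.
by apply: mp_fun; [apply: measurable_funB; exact: mfun_d2|exact: measurable_itv].
Qed.

Lemma mp_between X Y (a b : R) : mfun X -> mfun Y -> mp (fun S => a < d2 (X S) (Y S) < b).
Proof.
move=> mX mY; apply: (@mp_ext (fun S => ([set` `]a, b[] : set R) (d2 (X S) (Y S)))).
  by move=> S _ /=; rewrite in_itv.
by apply: mp_fun; [exact: mfun_d2|exact: measurable_itv].
Qed.

Definition ctype : countType := (nat * (int * int))%type.
Definition box (c : ctype) : set pt := cell org (c.1.+1%:R^-1) c.2.
Definition alone (c : ctype) (S : set pt) := card_eq (S `&` box c) 1.
(** Countably many measurable selections; the origin is the default when the box holds no point or
    several. *)
Definition sel (c : ctype) (S : M) : pt := xget org [set x | alone c S /\ (S `&` box c) x].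

Lemma card_eq1_uniq (A : set pt) x y : card_eq A 1 -> A x -> A y -> x = y.
Proof.
by case/card_eq1P=> a _ H /H -> /H ->.
Qed.

Lemma sel_alone c S : alone c S -> (S `&` box c) (sel c S).
Proof.
move=> a; have [x Hx _] := card_eq1P a.
by rewrite /sel; case: xgetP => [y _ [_ h] //|/(_ x)[]].
Qed.

Lemma good_box c : good (box c). Proof. by apply: good_cell; rewrite invr_ge0. Qed.

Lemma card_eq_sub1 (A U : set pt) x : card_eq A 1 -> A x -> card_eq (A `&` U) 1 <-> U x.
Proof.
move=> c1 Ax; split=> [/card_eq1P[y [Ay Uy] _]|Ux].
  by rewrite (card_eq1_uniq c1 Ax Ay).
exists [:: x]; split=> //; apply/seteqP; split=> z /=; rewrite inE.
  by move=> [Az _]; rewrite (card_eq1_uniq c1 Az Ax).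
by move=> /eqP ->.
Qed.

(** If the box holds a single point, that point is in U exactly when the box cut by U also has count
    1, so the preimage is made of counting events. *)
Lemma measurable_sel c : mfun (sel c).
Proof.
move=> _ U mU; rewrite setTI.
have ma : measurable [set S : M | alone c S] by apply: measurable_count (good_box c).
have gU : good (box c `&` U).
  have [mb [r br]] := good_box c; split; first exact: measurableI.
  by exists r => x [/br].
have mb : measurable [set S : M | card_eq (S `&` (box c `&` U)) 1] by apply: measurable_count.
rewrite (_ : _ @^-1` _ = ([set S : M | alone c S] `&` [set S : M | card_eq (S `&` (box c `&` U)) 1]) `|`
   (~` [set S : M | alone c S] `&` [set S : M | U org])).
  apply: measurableU; first exact: measurableI.
  apply: measurableI; first exact: measurableC.
  have [u|nu] := pselect (U org).
    by rewrite (_ : [set S | _] = setT); [exact: measurableT|apply/seteqP; split].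
  by rewrite (_ : [set S | _] = set0); [exact: measurable0|apply/seteqP; split].
apply/seteqP; split=> S /=; have [a|na] := pselect (alone c S).
- by move=> Us; left; split=> //; rewrite setIA; apply/(card_eq_sub1 _ a (sel_alone a)).
- move=> Us; right; split=> //; move: Us; rewrite /sel; case: xgetP => // x _ [a]; by case: na.
- by case=> [[_]|[]//]; rewrite setIA => /(card_eq_sub1 _ a (sel_alone a)).
- by case=> [[]//|[_ Uo]]; rewrite /sel; case: xgetP => // x _ [a]; case: na.
Qed.

(** A fine enough grid isolates x. Hence the selections exhaust S, and quantifiers over S become
    countable. *)
Lemma sel_surj S x : locally_finite S -> S x -> exists c, alone c S /\ sel c S = x.
Proof.
move=> lf Sx.
have [l El] : exists l : seq pt, S `&` [set v | supd v org <= supd x org + 1] = [set` l].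
  by apply/finite_seqP/finite_box.
have [|e e0 He] := @gap R 0 [seq supd v x | v <- l & v != x].
  by apply/mapP => -[v]; rewrite mem_filter => /andP[vx _] E; move: vx; rewrite (supd_eq0 (esym E)) eqxx.
pose n := Num.bound (e^-1 + 1).
have nb : e^-1 + 1 < n.+1%:R.
  apply: lt_trans (archi_boundP _) _; first by rewrite addr_ge0 // invr_ge0 ltW.
  by rewrite ltr_nat.
have n0 : 0 < n.+1%:R :> R by rewrite ltr0n.
have t0 : 0 < n.+1%:R^-1 :> R by rewrite invr_gt0.
have te : n.+1%:R^-1 < e.
  by rewrite invf_plt ?posrE //; lra.
have t1 : n.+1%:R^-1 <= 1 :> R by rewrite invf_le1 // ler1n.
pose c : ctype := (n, idx org n.+1%:R^-1 x).
have cx : box c x by exact: mem_cell.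
have only v : S v -> box c v -> v = x.
  move=> Sv cv; have [h1 h2] := cell_dist t0 cv cx.
  have vx : supd v x < n.+1%:R^-1 by apply/supd_lt.
  apply/eqP/negPn/negP => nvx.
  have vl : v \in l.
    have : (S `&` [set v | supd v org <= supd x org + 1]) v.
      by split=> //=; apply: le_trans (supd_tri (ltW vx) (lexx (supd x org))) _; rewrite addrC lerD2l.
    by rewrite El.
  have := He (supd v x); rewrite subr0 ger0_norm ?supd_ge0 // leNgt (lt_trans vx te).
  by move=> H; have : ~~ true by apply: H; apply/mapP; exists v; rewrite ?mem_filter ?nvx.
have a : alone c S.
  exists [:: x]; split=> //; apply/seteqP; split=> v /=; rewrite inE.
    by move=> [Sv cv]; rewrite (only v).
  by move=> /eqP ->.
by exists c; split=> //; have [Ss cs] := sel_alone a; apply: only.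
Qed.

Lemma mp_exS (Q : M -> pt -> Prop) : (forall Y, mfun Y -> mp (fun S => Q S (Y S))) ->
  mp (fun S => exists y, (S : set pt) y /\ Q S y).
Proof.
move=> mQ; apply: (@mp_ext (fun S => exists c, alone c S /\ Q S (sel c S))).
  move=> S lf; split=> [[c [a q]]|[y [Sy q]]].
    by exists (sel c S); split=> //; case: (sel_alone a).
  by have [c [a E]] := sel_surj lf Sy; exists c; rewrite E.
apply: mp_ex => c; apply: mp_and; last by apply: mQ; exact: measurable_sel.
by apply: mp_measurable; apply: measurable_count (good_box c).
Qed.

Lemma mp_allS (Q : M -> pt -> Prop) : (forall Y, mfun Y -> mp (fun S => Q S (Y S))) ->
  mp (fun S => forall y, (S : set pt) y -> Q S y).
Proof.
move=> mQ; apply: (@mp_ext (fun S => ~ exists y, (S : set pt) y /\ ~ Q S y)).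
  move=> S _; split=> [n y Sy|h [y [Sy n]]]; last by apply: n; apply: h.
  by apply: contrapT => nq; apply: n; exists y.
by apply: mp_not; apply: mp_exS => Y mY; apply: mp_not; apply: mQ.
Qed.

Lemma mp_mem X : mfun X -> mp (fun S => (S : set pt) (X S)).
Proof.
move=> mX; apply: (@mp_ext (fun S => exists y, (S : set pt) y /\ y = X S)).
  by move=> S _; split=> [[y [Sy <-]]|Sx] //; exists (X S).
by apply: mp_exS => Y mY; exact: mp_eq.
Qed.

(** Points are chosen one at a time; that the others differ from the chosen one is added to Q, which
    is why Q is general in the induction. *)
Lemma mp_many m (Q : M -> pt -> Prop) : (forall Y, mfun Y -> mp (fun S => Q S (Y S))) ->
  mp (fun S => exists s : seq pt, [/\ uniq s, size s = m & forall y, y \in s -> (S : set pt) y /\ Q S y]).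
Proof.
elim: m Q => [|m IH] Q mQ.
  by apply: (@mp_ext (fun=> True)); [move=> S _; split=> // _; exists [::]|exact: mp_const].
apply: (@mp_ext (fun S => exists y, (S : set pt) y /\ (Q S y /\
   exists s : seq pt, [/\ uniq s, size s = m & forall z, z \in s -> (S : set pt) z /\ (Q S z /\ z <> y)]))).
  move=> S _; split=> [[y [Sy [q [s [us ss Hs]]]]]|[[|y s] [us ss Hs]]]; last first.
  - case/andP: us => ys us; case: ss => ss.
    have [Sy q] := Hs y (mem_head _ _); exists y; split=> //; split=> //; exists s; split=> // z zs.
    have [Sz qz] : (S : set pt) z /\ Q S z by apply: Hs; rewrite inE zs orbT.
    by split=> //; split=> // E; move: ys; rewrite -E zs.
  - by [].
  - exists (y :: s); split=> /=; [|by rewrite ss|].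
      by rewrite us andbT; apply/negP => /Hs[_ []].
    by move=> z; rewrite inE => /orP[/eqP ->//|/Hs[Sz [qz _]]].
apply: mp_exS => Y mY; apply: mp_and; first exact: mQ.
by apply: IH => Z mZ; apply: mp_and; [exact: mQ|apply: mp_not; exact: mp_eq].
Qed.
End Measurable.

(** * Rational witnesses of Delaunay adjacency *)

Section Bisector.
Variable R : realType.
Local Notation pt := (pt2 R).
Implicit Types (x y z w : pt).

(** The perpendicular bisector, parametrised from the midpoint in the direction of x - y turned by a
    right angle. *)
Definition bis x y (t : R) : pt :=
  (2^-1 * (x.1 + y.1) - t * (x.2 - y.2), 2^-1 * (x.2 + y.2) + t * (x.1 - y.1)).

Lemma perp (p q u v : R) : u ^+ 2 + v ^+ 2 != 0 -> p * u + q * v = 0 ->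
  p = - ((q * u - p * v) / (u ^+ 2 + v ^+ 2) * v) /\ q = (q * u - p * v) / (u ^+ 2 + v ^+ 2) * u.
Proof.
move=> D0 H; set t := _ / _.
have E : t * (u ^+ 2 + v ^+ 2) = q * u - p * v by rewrite divfK.
split; apply: (mulIf D0); apply/eqP; rewrite -subr_eq0; apply/eqP.
  transitivity (p * (u ^+ 2 + v ^+ 2) + t * (u ^+ 2 + v ^+ 2) * v); first by ring.
  by rewrite E; transitivity (u * (p * u + q * v)); [ring|rewrite H mulr0].
transitivity (q * (u ^+ 2 + v ^+ 2) - t * (u ^+ 2 + v ^+ 2) * u); first by ring.
by rewrite E; transitivity (v * (p * u + q * v)); [ring|rewrite H mulr0].
Qed.

Lemma bis_surj x y z : x <> y -> d2 z x = d2 z y -> exists t, z = bis x y t.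
Proof.
move=> xy E.
have D0 : d2 x y != 0 by apply/eqP => /d2_eq0.
have [|u v] := @perp (z.1 - 2^-1 * (x.1 + y.1)) (z.2 - 2^-1 * (x.2 + y.2)) _ _ D0.
  by move: E; rewrite /d2; lra.
set t := _ / _ in u v; exists t; rewrite /bis -v.
by rewrite (surjective_pairing z) /=; congr pair; lra.
Qed.

Lemma bis_inj x y s t : x <> y -> bis x y s = bis x y t -> s = t.
Proof.
move=> xy [E1 E2]; have D0 : d2 x y != 0 by apply/eqP => /d2_eq0.
apply: (mulIf D0); rewrite /d2.
transitivity ((s * (x.1 - y.1)) * (x.1 - y.1) + (s * (x.2 - y.2)) * (x.2 - y.2)); first by ring.
have -> : s * (x.1 - y.1) = t * (x.1 - y.1) by lra.
have -> : s * (x.2 - y.2) = t * (x.2 - y.2) by lra.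
by ring.
Qed.

(** Along the bisector the difference of the squared distances to w and to x is affine in t. *)
Lemma bis_convex x y w t1 t t2 : t1 < t < t2 ->
  d2 (bis x y t1) x <= d2 (bis x y t1) w -> d2 (bis x y t2) x <= d2 (bis x y t2) w ->
  d2 (bis x y t) x <= d2 (bis x y t) w.
Proof.
move=> /andP[h1 h2] a b; rewrite -subr_ge0 in a; rewrite -subr_ge0 in b; rewrite -subr_ge0.
rewrite -(@pmulr_lge0 _ (t2 - t1)); last by lra.
have -> : (d2 (bis x y t) w - d2 (bis x y t) x) * (t2 - t1) =
  (d2 (bis x y t1) w - d2 (bis x y t1) x) * (t2 - t) + (d2 (bis x y t2) w - d2 (bis x y t2) x) * (t - t1).
  by rewrite /d2 /bis /=; ring.
by rewrite addr_ge0 // mulr_ge0 //; lra.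
Qed.

Lemma bis_mid x y t : d2 (bis x y t) x = d2 (bis x y t) y.
Proof. by rewrite /d2 /bis /=; field. Qed.

(** The common part of the two cells is convex in the parameter of the bisector, so two witnesses
    may be replaced by rational parameters between them, over which a quantifier is countable. *)
Lemma adjp_rat (S : set pt) x y : adjp S x y <-> [/\ x <> y, S x, S y &
  exists q : rat * rat, q.1 <> q.2 /\ nearest2 S x y (bis x y (ratr q.1)) /\ nearest2 S x y (bis x y (ratr q.2))].
Proof.
rewrite (propext (adjpP S x y)); split=> -[xy Sx Sy H]; split=> //; last first.
  case: H => -[p q] /= [pq [h1 h2]]; exists (bis x y (ratr p)), (bis x y (ratr q)); split=> //.
  by move=> /(bis_inj xy) /(fmorph_inj _).
case: H => z1 [z2 [z12 h1 h2]].
have eqd z : nearest2 S x y z -> d2 z x = d2 z y.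
  by move=> h; apply/le_anti; rewrite (h y Sy).1 (h x Sx).2.
have [t1 E1] := bis_surj xy (eqd _ h1); have [t2 E2] := bis_surj xy (eqd _ h2); subst z1 z2.
have key a b : a < b -> nearest2 S x y (bis x y a) -> nearest2 S x y (bis x y b) ->
  exists q : rat * rat, q.1 <> q.2 /\ nearest2 S x y (bis x y (ratr q.1)) /\ nearest2 S x y (bis x y (ratr q.2)).
  move=> ab na nb.
  have H t : a < t < b -> nearest2 S x y (bis x y t).
    move=> tab w Sw; have h : d2 (bis x y t) x <= d2 (bis x y t) w.
      by apply: (bis_convex tab); [case: (na w Sw)|case: (nb w Sw)].
    by rewrite -bis_mid.
  have [p] := rat_in_itvoo ab; rewrite in_itv /= => hp; have [pa pb] := andP hp.
  have [q] := rat_in_itvoo pb; rewrite in_itv /= => /andP[qp qb].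
  exists (p, q) => /=; split; last by split; apply: H => //; rewrite qb (lt_trans pa qp).
  by move=> E; move: qp; rewrite E ltxx.
have [lt|lt|E] := ltgtP t1 t2; [exact: (key t1 t2)|exact: (key t2 t1)|].
by case: z12; rewrite E.
Qed.
End Bisector.

(** * Measurability of the coloring *)

Section Measurable.
Variable R : realType.
Local Notation pt := (pt2 R).
Local Notation M := (Mspace R).
Implicit Types (X Y Z : M -> pt).
Local Notation mfun X := (measurable_fun setT X).

Lemma mfun_bis X Y t : mfun X -> mfun Y -> mfun (fun S => bis (X S) (Y S) t).
Proof.
move=> mX mY.
have f1 Z : mfun Z -> mfun (fun S => (Z S).1).
  by move=> mZ; exact: (measurableT_comp (@measurable_fst _ _ R R) mZ).
have f2 Z : mfun Z -> mfun (fun S => (Z S).2).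
  by move=> mZ; exact: (measurableT_comp (@measurable_snd _ _ R R) mZ).
apply: measurable_fun_pair.
  apply: measurable_funB; apply: measurable_funM; try exact: measurable_cst.
    by apply: measurable_funD; exact: f1.
  by apply: measurable_funB; exact: f2.
apply: measurable_funD; apply: measurable_funM; try exact: measurable_cst.
  by apply: measurable_funD; exact: f2.
by apply: measurable_funB; exact: f1.
Qed.

Lemma mp_nearest2 X Y Z : mfun X -> mfun Y -> mfun Z -> mp (fun S => nearest2 S (X S) (Y S) (Z S)).
Proof.
move=> mX mY mZ.
apply: (@mp_allS R (fun S w => d2 (Z S) (X S) <= d2 (Z S) w /\ d2 (Z S) (Y S) <= d2 (Z S) w)) => W mW.
by apply: mp_and; exact: mp_le.
Qed.

(** Relations are tested along measurable choices of points, the form in which [mp_exS] and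
    [mp_allS] take their hypotheses. *)
Definition m2 (r : set pt -> pt -> pt -> Prop) := forall X Y, mfun X -> mfun Y -> mp (fun S => r S (X S) (Y S)).
Definition m1 (r : set pt -> pt -> Prop) := forall X, mfun X -> mp (fun S => r S (X S)).

Lemma mp_adjp : m2 (@adjp R).
Proof.
move=> X Y mX mY.
apply: (@mp_ext _ (fun S => ~ X S = Y S /\ (S : set pt) (X S) /\ (S : set pt) (Y S) /\
  exists q : rat * rat, q.1 <> q.2 /\ nearest2 S (X S) (Y S) (bis (X S) (Y S) (ratr q.1)) /\
    nearest2 S (X S) (Y S) (bis (X S) (Y S) (ratr q.2)))).
  by move=> S _; rewrite (propext (adjp_rat S (X S) (Y S))); split=> [[? [? []]]|[]].
apply: mp_and; first by apply: mp_not; exact: mp_eq.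
apply: mp_and; first exact: mp_mem.
apply: mp_and; first exact: mp_mem.
apply: mp_ex => q; apply: mp_and; first exact: mp_const.
by apply: mp_and; apply: mp_nearest2 => //; exact: mfun_bis.
Qed.

Lemma mp_core n : m1 (fun S => core S n).
Proof.
elim: n => [|n IH] X mX; first exact: mp_mem.
apply: mp_and; first exact: IH.
apply: (@mp_ext _ (fun S => exists s : seq pt, [/\ uniq s, size s = 6%N &
   forall y, y \in s -> (S : set pt) y /\ (core S n y /\ adjp S (X S) y)])).
  move=> S _; split=> -[s [us ss H]]; exists s; split=> // y /H; first by case.
  by move=> h; split=> //; case: h => /core_sub.
by apply: mp_many => Y mY; apply: mp_and; [exact: IH|exact: mp_adjp].
Qed.

Lemma mp_same : m2 (@same R).
Proof. by move=> X Y mX mY; apply: mp_all => n; apply: mp_iff; exact: mp_core. Qed.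

Lemma mp_hasd i : m1 (fun S => hasd S i).
Proof.
move=> X mX; apply: (@mp_ext _ (fun S => exists u, (S : set pt) u /\
  (~ X S = u /\ ratr (itvl i).1 < d2 (X S) u < ratr (itvl i).2))).
  by move=> S _; split=> [[u [Su [xu d]]]|[u [Su xu d]]]; exists u.
by apply: mp_exS => Y mY; apply: mp_and; [apply: mp_not; exact: mp_eq|exact: mp_between].
Qed.

Lemma mp_sep i : m1 (fun S => sep S i).
Proof.
move=> X mX; apply: mp_and; first exact: mp_hasd.
apply: (@mp_ext _ (fun S => forall y, (S : set pt) y -> (adjp S (X S) y -> ~ hasd S i y))).
  move=> S _; split=> H y; last by move=> _; apply: H.
  by move=> a; apply: H => //; case: (adjp_mem a).
by apply: mp_allS => Y mY; apply: mp_imp; [exact: mp_adjp|apply: mp_not; exact: mp_hasd].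
Qed.

Lemma mp_lab i : m1 (fun S => lab S i).
Proof.
move=> X mX; apply: mp_and; first exact: mp_sep.
by apply: mp_all => j; apply: mp_imp; [exact: mp_const|apply: mp_not; exact: mp_sep].
Qed.

Lemma mp_less (Q : nat -> set pt -> pt -> Prop) : (forall i, m1 (Q i)) ->
  m2 (fun S x y => exists i j, [/\ (i < j)%N, Q i S x & Q j S y]).
Proof.
move=> mQ X Y mX mY; apply: mp_ex => i; apply: mp_ex => j.
apply: (@mp_ext _ (fun S => (i < j)%N /\ (Q i S (X S) /\ Q j S (Y S)))).
  by move=> S _; split=> [[? []]|[]].
by apply: mp_and; [exact: mp_const|apply: mp_and; exact: mQ].
Qed.

Lemma mp_prec1 : m2 (@prec1 R).
Proof.
move=> X Y mX mY.
apply: (@mp_ext _ (fun S => adjp S (Y S) (X S) /\ (same S (Y S) (X S) /\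
   exists i j, [/\ (i < j)%N, lab S i (X S) & lab S j (Y S)]))).
  by move=> S _; split=> [[? []]|[]].
apply: mp_and; first exact: mp_adjp.
by apply: mp_and; [exact: mp_same|exact: (mp_less mp_lab)].
Qed.

Section Greedy.
Variable prec : set pt -> pt -> pt -> Prop.
Hypothesis prec_mem : forall S x y, prec S x y -> S x.
Hypothesis mp_prec : m2 prec.

Lemma mp_stage t i : m1 (fun S => stage (prec S) t i).
Proof.
elim: t i => [|t IH] i X mX; first exact: mp_const.
apply: (@mp_ext _ (fun S => (forall y, (S : set pt) y -> (prec S y (X S) -> exists j, stage (prec S) t j y)) /\
  ((forall y, (S : set pt) y -> (prec S y (X S) -> ~ stage (prec S) t i y)) /\
   (forall j, (j < i)%N -> exists y, (S : set pt) y /\ (prec S y (X S) /\ stage (prec S) t j y))))).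
  move=> S _; split=> [[h1 [h2 h3]]|[h1 h2 h3]]; split.
  - by move=> y p; apply: h1 (p); apply: prec_mem p.
  - by move=> y p; apply: h2 (p); apply: prec_mem p.
  - by move=> j /h3[y [_ [p s]]]; exists y.
  - by move=> y _; apply: h1.
  - split; first by move=> y _; apply: h2.
    by move=> j /h3[y p s]; exists y; split=> //; apply: prec_mem p.
apply: mp_and.
  by apply: mp_allS => Y mY; apply: mp_imp; [exact: mp_prec|apply: mp_ex => j; exact: IH].
apply: mp_and.
  by apply: mp_allS => Y mY; apply: mp_imp; [exact: mp_prec|apply: mp_not; exact: IH].
apply: mp_all => j; apply: mp_imp; first exact: mp_const.
by apply: mp_exS => Y mY; apply: mp_and; [exact: mp_prec|exact: IH].
Qed.

Lemma mp_greedy i : m1 (fun S => greedy (prec S) i).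
Proof. by move=> X mX; apply: mp_ex => t; exact: mp_stage. Qed.
End Greedy.

Lemma mp_prec2 : m2 (@prec2 R).
Proof.
have mg i : m1 (fun S => greedy (prec1 S) i).
  by apply: mp_greedy mp_prec1 _ => S x y [a _ _]; case: (adjp_mem a).
move=> X Y mX mY; apply: mp_and; first exact: mp_adjp.
apply: mp_or.
  by apply: mp_ex => n; apply: mp_and; [exact: mp_core|apply: mp_not; exact: mp_core].
by apply: mp_and; [exact: mp_same|exact: (mp_less mg)].
Qed.

Lemma mp_greedy2 i : m1 (fun S => greedy (prec2 S) i).
Proof. by apply: mp_greedy mp_prec2 _ => S x y [a _]; case: (adjp_mem a). Qed.

(** At least k but not at least k + 1, the form that [mp_many] can handle. *)
Lemma card_eq_many (A : set pt) k : card_eq A k <->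
  (exists s : seq pt, [/\ uniq s, size s = k & forall y, y \in s -> A y]) /\
  ~ (exists s : seq pt, [/\ uniq s, size s = k.+1 & forall y, y \in s -> A y]).
Proof.
split=> [[s [us ss E]]|[[s [us ss Hs]] n]].
  split; first by exists s; split=> // y ys; rewrite E.
  move=> [s' [us' ss' Hs']].
  have : (size s' <= size s)%N by apply: uniq_leq_size => // y /Hs'; rewrite E.
  by rewrite ss ss' ltnn.
exists s; split=> //; apply/seteqP; split=> y /=; last exact: Hs.
move=> Ay; apply/negPn/negP => ys; apply: n; exists (y :: s); split=> /=.
- by rewrite ys.
- by rewrite ss.
- by move=> z; rewrite inE => /orP[/eqP ->//|/Hs].
Qed.

(** It suffices to treat the generating counting events. Off the locally finite configurations the
    image is empty, so the preimage there is everything or nothing according to whether k = 0. *)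
Lemma measurable_coloring (i : 'I_6) : measurable_fun setT (fun S : M => (coloring S i : M)).
Proof.
apply: (@measurability _ _ M M setT (fun S : M => (coloring S i : M)) (@count_gen R) erefl).
move=> _ [_ [B [k [mB bB ->]]] <-]; rewrite setTI.
have mB1 : m1 (fun _ x => B x).
  move=> X mX; apply: mp_measurable; rewrite -[X in measurable X]setTI; exact: mX.
have mm m : mp (fun S => exists s : seq pt, [/\ uniq s, size s = m &
    forall y, y \in s -> (S : set pt) y /\ (greedy (prec2 S) i y /\ B y)]).
  by apply: mp_many => Y mY; apply: mp_and; [exact: mp_greedy2|exact: mB1].
have E (S : M) m : locally_finite S -> (exists s : seq pt, [/\ uniq s, size s = m & forall y, y \in s -> (coloring S i `&` B) y]) <->
   (exists s : seq pt, [/\ uniq s, size s = m & forall y, y \in s -> (S : set pt) y /\ (greedy (prec2 S) i y /\ B y)]).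
  move=> lf; split=> -[s [us ss H]]; exists s; split=> // y /H; first by move=> [[_ ? ?] ?].
  by move=> [? [? ?]].
have mk : mp (fun S => card_eq (coloring S i `&` B) k).
  apply: (mp_ext _ (mp_and (mm k) (mp_not (mm k.+1)))) => S lf.
  by rewrite (propext (card_eq_many _ _)) (propext (E S k lf)) (propext (E S k.+1 lf)).
rewrite (_ : _ @^-1` _ = [set S : M | locally_finite S /\ card_eq (coloring S i `&` B) k] `|`
  (~` [set S : M | locally_finite S] `&` [set S : M | k = 0%N])).
  apply: measurableU => //; apply: measurableI; first by apply: measurableC; exact: measurable_lf.
  have [E0|n0] := pselect (k = 0%N).
    by rewrite (_ : [set S | _] = setT); [exact: measurableT|apply/seteqP; split].
  by rewrite (_ : [set S | _] = set0); [exact: measurable0|apply/seteqP; split].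
have empty (S : M) : ~ locally_finite S -> coloring S i `&` B = set0.
  by move=> n; apply/seteqP; split=> // x [[lf]].
apply/seteqP; split=> S /=; have [lf|nlf] := pselect (locally_finite S).
- by left.
- rewrite /count_event /= (empty _ nlf) => c; right; split=> //.
  by apply: card_eq_uniq c _; apply/card_eq_set0.
- by case=> [[]|[]].
- by case=> [[]//|[_ ->]]; rewrite /count_event /= (empty _ nlf); apply/card_eq_set0.
Qed.
End Measurable.

Theorem theorem1 (R : realType) (P : probability (Mspace R) R) :
  poisson_law P ->
  exists F : Mspace R -> 'I_6 -> set (pt2 R),
    [/\ (forall i : 'I_6, measurable_fun setT (fun S : Mspace R => (F S i : Mspace R))),
        (forall (S : set (pt2 R)), locally_finite S ->
           forall i, locally_finite (F S i)),
        {ae P, forall S : Mspace R, proper_coloring S (F S)} &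
        (forall g : pt2 R -> pt2 R, is_isometry g ->
           forall S : set (pt2 R), locally_finite S ->
           forall i, g @` (F S i) = F (g @` S) i)].
Proof.
move=> HP; exists (@coloring R); split.
- exact: measurable_coloring.
- by move=> S lf i; exact: coloring_lf.
- apply: (negligibleS _ (negligible_not_tame HP)) => S /= n t; apply: n; exact: coloring_proper.
- by move=> g ig S lf i; exact: img_coloring.
Qed.
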